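(* Let $R$ be a discrete valuation ring of characteristic $p>0$ with fraction field $K$. Let $X=\alpha_{p,R}$, let $x\in X(R)$ be its identity element, and let $X_\eta=\alpha_{p,K}$ and $x_\eta\in X_\eta(K)$ be their generic fibres. Let $G$ be an affine $K$-group scheme of finite type and let $f:Y\to X_\eta$ be a $G$-torsor pointed in $y\in Y_{x_\eta}(K)$. Then, possibly after pulling back $Y$ over an automorphism (as a scheme) of $\alpha_{p,K}$, there exist an affine flat $R$-group scheme $G'$ and a $G'$-torsor $f':Y'\to\alpha_{p,R}$, pointed in some $y'\in Y'_x(R)$, extending the given $G$-torsor $Y$. (That is, there exists a $K$-automorphism $\varphi$ of the scheme $\alpha_{p,K}$ such that the $G$-torsor $\varphi^*Y\to\alpha_{p,K}$ is extended by such a pointed $G'$-torsor $Y'\to\alpha_{p,R}$.)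
   Context: As a scheme, $\alpha_{p,R}=\mathrm{Spec}(R[x]/(x^p))$ and its identity element is the section $x\mapsto 0$; the group structure of $\alpha_{p,R}$ plays no other role. Torsors: for a scheme $S$, an $S$-scheme $X$, an affine flat $S$-group scheme $G$ and an $S$-scheme $Y$ with a right action $\sigma:Y\times_S G\to Y$, an $S$-morphism $Y\to X$ is a $G$-torsor if it is affine, faithfully flat, $G$-invariant, and the canonical morphism $(\sigma,pr_Y):Y\times_S G\to Y\times_X Y$ is an isomorphism. For a point $x\in X(T)$, $Y_x$ denotes the fibre product $Y\times_{X,x} T$; a torsor $Y\to X$ is pointed in $y\in Y_x(T)$ if such a $T$-point $y$ of $Y$ over $x$ is given. Extension: let $X$ be an $R$-scheme with generic fibre $X_\eta=X\times_R K$. A $G'$-torsor $Y'\to X$, with $G'$ an affine flat $R$-group scheme, extends a $G$-torsor $Y\to X_\eta$ ($G$ a $K$-group scheme) if $G'\times_R K\simeq G$ as $K$-group schemes and the generic fibre $Y'_\eta\to X_\eta$ is isomorphic to $Y\to X_\eta$ as a $G$-torsor. *)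

(* Defs.v *)
From HB Require Import structures.
From mathcomp Require Import all_boot all_algebra.
From mathcomp Require Import boolp.

Set Implicit Arguments.
Unset Strict Implicit.
Unset Printing Implicit Defensive.

Import GRing.Theory.
Local Open Scope ring_scope.

(* Affine schemes are represented by their coordinate rings: a morphism
   Spec C -> Spec B is a ring morphism B -> C, and fibre products are tensor
   products.  This covers every scheme of the statement: G and G' are affine
   over the base, and a torsor is affine over an affine X.  The rings are
   'comPzRingType's because a tensor product may be the zero ring. *)

(* Elements of M (x) N are formal sums of pairs (m, n), represented by
   sequences, modulo the congruence generated by bilinearity. *)

Section TensorDef.
Variables (A : comPzRingType) (M N : lmodType A).

Inductive tens_rel : seq (M * N) -> seq (M * N) -> Prop :=
| tens_refl s : tens_rel s s
| tens_sym s t : tens_rel s t -> tens_rel t s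
| tens_trans s t u : tens_rel s t -> tens_rel t u -> tens_rel s u
| tens_cat s s' t t' :
    tens_rel s s' -> tens_rel t t' -> tens_rel (s ++ t) (s' ++ t')
| tens_comm s t : tens_rel (s ++ t) (t ++ s)
| tens_addl m m' n : tens_rel [:: (m + m', n)] [:: (m, n); (m', n)]
| tens_addr m n n' : tens_rel [:: (m, n + n')] [:: (m, n); (m, n')]
| tens_zero : tens_rel [:: (0, 0)] [::]
| tens_scale a m n : tens_rel [:: (a *: m, n)] [:: (m, a *: n)].

Definition tens_relb (s t : seq (M * N)) : bool := `[< tens_rel s t >].

Fact tens_relb_equiv : equiv_class_of tens_relb.
Proof.
split=> [s|s t|t s u].
- exact/asboolP/tens_refl.
- by apply/asboolP/asboolP; apply: tens_sym.
- by move=> /asboolP h1 /asboolP h2; apply/asboolP; apply: tens_trans h1 h2.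
Qed.

Canonical tens_equiv := EquivRelPack tens_relb_equiv.

Definition tens := {eq_quot tens_equiv}%qT.

HB.instance Definition _ := Choice.on tens.

Definition tens_of (s : seq (M * N)) : tens := (\pi_tens s)%qT.
Definition pure (m : M) (n : N) : tens := tens_of [:: (m, n)].

Lemma tens_ofP s t : tens_of s = tens_of t <-> tens_rel s t.
Proof.
split=> [/eqP|st]; first by rewrite /tens_of eqmodE => /asboolP.
by apply/eqP; rewrite /tens_of eqmodE; apply/asboolP.
Qed.

Lemma tens_ofK (x : tens) : tens_of (repr x) = x.
Proof. exact: reprK. Qed.

Lemma repr_tens s : tens_rel (repr (tens_of s)) s.
Proof. by apply/tens_ofP; rewrite tens_ofK. Qed.

Definition tens_add (x y : tens) : tens := tens_of (repr x ++ repr y).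
Definition tens_opp (x : tens) : tens := tens_of [seq (- u.1, u.2) | u <- repr x].

Lemma tens_addE s t : tens_add (tens_of s) (tens_of t) = tens_of (s ++ t).
Proof. by apply/tens_ofP/tens_cat; apply: repr_tens. Qed.

Lemma tens_rel0l n : tens_rel [:: (0, n)] [::].
Proof.
have := tens_scale 0 0 n; rewrite !scale0r => h.
exact: tens_trans h tens_zero.
Qed.

Fact tens_addA : associative tens_add.
Proof.
move=> x y z; rewrite -(tens_ofK x) -(tens_ofK y) -(tens_ofK z) !tens_addE.
by rewrite catA.
Qed.
Fact tens_addC : commutative tens_add.
Proof.
move=> x y; rewrite -(tens_ofK x) -(tens_ofK y) !tens_addE.
exact/tens_ofP/tens_comm.
Qed.
Fact tens_add0 : left_id (tens_of [::]) tens_add.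
Proof. by move=> x; rewrite -(tens_ofK x) tens_addE. Qed.
Fact tens_addN : left_inverse (tens_of [::]) tens_opp tens_add.
Proof.
move=> x; rewrite -[X in tens_add _ X]tens_ofK tens_addE; apply/tens_ofP.
elim: (repr x) => [|[m n] s IH] /=; first exact: tens_refl.
set S := [seq _ | _ <- s] in IH *.
apply: tens_trans (_ : tens_rel ([:: (- m, n); (m, n)] ++ (s ++ S)) _).
  exact: tens_cat (tens_refl [:: (- m, n)]) (tens_comm S ((m, n) :: s)).
rewrite -[X in tens_rel _ X]cat0s; apply: tens_cat.
  apply: tens_trans (tens_rel0l n); rewrite -(addNr m).
  exact/tens_sym/tens_addl.
exact: tens_trans (tens_comm s S) IH.
Qed.

HB.instance Definition _ :=
  GRing.isZmodule.Build tens tens_addA tens_addC tens_add0 tens_addN.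

Lemma tens_of_cat s t : tens_of (s ++ t) = tens_of s + tens_of t.
Proof. by rewrite -tens_addE. Qed.

Lemma tens_ofE s : tens_of s = \sum_(u <- s) pure u.1 u.2.
Proof.
elim: s => [|[m n] s IH]; first by rewrite big_nil.
by rewrite big_cons -IH -cat1s tens_of_cat.
Qed.

Lemma tensE (x : tens) : x = \sum_(u <- repr x) pure u.1 u.2.
Proof. by rewrite -tens_ofE tens_ofK. Qed.

Lemma pureDl m m' n : pure (m + m') n = pure m n + pure m' n.
Proof. by rewrite -tens_of_cat; apply/tens_ofP/tens_addl. Qed.
Lemma pureDr m n n' : pure m (n + n') = pure m n + pure m n'.
Proof. by rewrite -tens_of_cat; apply/tens_ofP/tens_addr. Qed.
Lemma pureZ a m n : pure (a *: m) n = pure m (a *: n).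
Proof. exact/tens_ofP/tens_scale. Qed.

Lemma tens_ind (P : tens -> Prop) :
  P 0 -> (forall x y, P x -> P y -> P (x + y)) -> (forall m n, P (pure m n)) ->
  forall x, P x.
Proof.
by move=> P0 PD Pp x; rewrite (tensE x); apply: big_ind.
Qed.

(* Defined for every b, but independent of the choice of representatives
   only when b is balanced. *)
Definition tens_lift (P : zmodType) (b : M -> N -> P) (x : tens) : P :=
  \sum_(u <- repr x) b u.1 u.2.

Definition balanced (P : zmodType) (b : M -> N -> P) : Prop :=
  [/\ forall m m' n, b (m + m') n = b m n + b m' n,
      forall m n n', b m (n + n') = b m n + b m n'
    & forall a m n, b (a *: m) n = b m (a *: n)].

Section Lift.
Variables (P : zmodType) (b : M -> N -> P).
Hypothesis hb : balanced b.

Lemma tens_liftE s : tens_lift b (tens_of s) = \sum_(u <- s) b u.1 u.2.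
Proof.
have [bl br bz] := hb; rewrite /tens_lift.
move: (repr _) (repr_tens s) => r; elim=> //=.
- by move=> x y z _ -> _ ->.
- by move=> x x' y y' _ e1 _ e2; rewrite !big_cat /= e1 e2.
- by move=> x y; rewrite !big_cat /= addrC.
- by move=> m m' n; rewrite !big_cons big_nil /= bl !addr0.
- by move=> m n n'; rewrite !big_cons big_nil /= br !addr0.
- rewrite big_cons big_nil /= addr0; apply: (addIr (b 0 0)).
  by rewrite -bl addr0 add0r.
- by move=> a m n; rewrite !big_cons big_nil /= bz.
Qed.

Lemma tens_lift_pure m n : tens_lift b (pure m n) = b m n.
Proof. by rewrite tens_liftE big_cons big_nil addr0. Qed.

Lemma tens_liftD x y : tens_lift b (x + y) = tens_lift b x + tens_lift b y.
Proof.
by rewrite -(tens_ofK x) -(tens_ofK y) -tens_of_cat !tens_liftE big_cat.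
Qed.

Lemma tens_lift0 : tens_lift b 0 = 0.
Proof. by apply: (addIr (tens_lift b 0)); rewrite -tens_liftD !add0r. Qed.
End Lift.

End TensorDef.

Arguments pure {A M N}.

(* g (x) 1_N, for a linear map g *)
Definition tens_map (A : comPzRingType) (M M' N : lmodType A)
  (g : M -> M') (x : tens M N) : tens M' N :=
  tens_lift (fun m n => pure (g m) n) x.

(* B as an A-module through f *)

Definition restr (A B : comPzRingType) (f : {rmorphism A -> B}) : Type := B.

Section Restr.
Variables (A B : comPzRingType) (f : {rmorphism A -> B}).
HB.instance Definition _ := GRing.ComPzRing.on (restr f).
Definition restr_scale (a : A) (b : restr f) : restr f := f a * b.
Fact restr_scaleA a b v : restr_scale a (restr_scale b v) = restr_scale (a * b) v.
Proof. by rewrite /restr_scale rmorphM mulrA. Qed.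
Fact restr_scale1 : left_id 1 restr_scale.
Proof. by move=> v; rewrite /restr_scale rmorph1 mul1r. Qed.
Fact restr_scaleDr : right_distributive restr_scale +%R.
Proof. by move=> a u v; rewrite /restr_scale mulrDr. Qed.
Fact restr_scaleDl v : {morph restr_scale^~ v : a b / a + b}.
Proof. by move=> a b; rewrite /restr_scale rmorphD mulrDl. Qed.
HB.instance Definition _ := GRing.Zmodule_isLmodule.Build A (restr f)
  restr_scaleA restr_scale1 restr_scaleDr restr_scaleDl.
End Restr.

(* The ring B (x)_A C of Spec B x_{Spec A} Spec C. *)

Definition tring (A B C : comPzRingType) (f : {rmorphism A -> B})
  (g : {rmorphism A -> C}) : Type := tens (restr f) (restr g).

Section TRing.
Variables (A B C : comPzRingType) (f : {rmorphism A -> B}) (g : {rmorphism A -> C}).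
Local Notation T := (tring f g).
HB.instance Definition _ := GRing.Zmodule.on T.

Definition tpure (b : B) (c : C) : T := pure (b : restr f) (c : restr g).

Lemma tpureDl b b' c : tpure (b + b') c = tpure b c + tpure b' c.
Proof. exact: pureDl. Qed.
Lemma tpureDr b c c' : tpure b (c + c') = tpure b c + tpure b c'.
Proof. exact: pureDr. Qed.
Lemma tpureZ a b c : tpure (f a * b) c = tpure b (g a * c).
Proof. exact: (pureZ a (b : restr f) (c : restr g)). Qed.

Lemma tring_ind (P : T -> Prop) :
  P 0 -> (forall x y, P x -> P y -> P (x + y)) -> (forall b c, P (tpure b c)) ->
  forall x, P x.
Proof. exact: tens_ind. Qed.

Definition tmul_pure (b : restr f) (c : restr g) (y : T) : T :=
  tens_lift (fun (b' : restr f) (c' : restr g) => tpure (b * b') (c * c')) y.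

Fact tmul_pure_balanced (b : restr f) (c : restr g) :
  balanced (fun (b' : restr f) (c' : restr g) => tpure (b * b') (c * c')).
Proof.
split=> [m m' n|m n n'|a m n].
- by rewrite mulrDr tpureDl.
- by rewrite mulrDr tpureDr.
- by rewrite /GRing.scale /= /restr_scale mulrCA tpureZ mulrCA.
Qed.

Definition tmul (x y : T) : T :=
  tens_lift (fun (b : restr f) (c : restr g) => tmul_pure b c y) x.

Fact tmul_balanced (y : T) :
  balanced (fun (b : restr f) (c : restr g) => tmul_pure b c y).
Proof.
have h := tmul_pure_balanced.
split=> [m m' n|m n n'|a m n]; rewrite /tmul_pure; elim/tring_ind: y.
- by rewrite !tens_lift0 ?addr0.
- by move=> x y e1 e2; rewrite !tens_liftD // e1 e2 addrACA.
- by move=> b c; rewrite !tens_lift_pure // mulrDl tpureDl.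
- by rewrite !tens_lift0 ?addr0.
- by move=> x y e1 e2; rewrite !tens_liftD // e1 e2 addrACA.
- by move=> b c; rewrite !tens_lift_pure // mulrDl tpureDr.
- by rewrite !tens_lift0.
- by move=> x y e1 e2; rewrite !tens_liftD // e1 e2.
- move=> b c; rewrite !tens_lift_pure //.
  by rewrite /GRing.scale /= /restr_scale -!mulrA tpureZ.
Qed.

Lemma tmulE b c b' c' : tmul (tpure b c) (tpure b' c') = tpure (b * b') (c * c').
Proof.
rewrite /tmul (tens_lift_pure (tmul_balanced _)).
by rewrite /tmul_pure (tens_lift_pure (tmul_pure_balanced _ _)).
Qed.

Fact tmulDl : left_distributive tmul +%R.
Proof. by move=> x y z; rewrite /tmul (tens_liftD (tmul_balanced _)). Qed.

Fact tmul0 y : tmul 0 y = 0.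
Proof. exact: (tens_lift0 (tmul_balanced _)). Qed.

Fact tmul_0 y : tmul y 0 = 0.
Proof.
elim/tring_ind: y => [|x y e1 e2|b c]; first exact: tmul0.
  by rewrite tmulDl e1 e2 addr0.
rewrite /tmul (tens_lift_pure (tmul_balanced _)).
exact: (tens_lift0 (tmul_pure_balanced _ _)).
Qed.

Fact tmulDr : right_distributive tmul +%R.
Proof.
move=> x y z; elim/tring_ind: x => [|x x' e1 e2|b c].
- by rewrite !tmul0 addr0.
- by rewrite !tmulDl e1 e2 addrACA.
rewrite /tmul !(tens_lift_pure (tmul_balanced _)).
exact: (tens_liftD (tmul_pure_balanced _ _)).
Qed.

Fact tmulA : associative tmul.
Proof.
move=> x y z; elim/tring_ind: x => [|x x' e1 e2|b c]; rewrite ?tmul0 //.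
  by rewrite !tmulDl e1 e2.
elim/tring_ind: y => [|y y' e1 e2|b' c']; rewrite ?tmul0 ?tmul_0 ?tmul0 //.
  by rewrite !(tmulDl, tmulDr) e1 e2.
elim/tring_ind: z => [|z z' e1 e2|b'' c'']; rewrite ?tmul_0 //.
  by rewrite !tmulDr e1 e2.
by rewrite !tmulE !mulrA.
Qed.

Fact tmulC : commutative tmul.
Proof.
move=> x y; elim/tring_ind: x => [|x x' e1 e2|b c]; rewrite ?tmul0 ?tmul_0 //.
  by rewrite tmulDl tmulDr e1 e2.
elim/tring_ind: y => [|y y' e1 e2|b' c']; rewrite ?tmul0 ?tmul_0 //.
  by rewrite tmulDl tmulDr e1 e2.
by rewrite !tmulE mulrC [c * _]mulrC.
Qed.

Fact tmul1 : left_id (tpure 1 1) tmul.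
Proof.
move=> x; elim/tring_ind: x => [|x x' e1 e2|b c]; rewrite ?tmul_0 //.
  by rewrite tmulDr e1 e2.
by rewrite tmulE !mul1r.
Qed.

HB.instance Definition _ :=
  GRing.Zmodule_isComPzRing.Build T tmulA tmulC tmul1 tmulDl.

Lemma tpureM b c b' c' : tpure b c * tpure b' c' = tpure (b * b') (c * c').
Proof. exact: tmulE. Qed.

End TRing.

Section TRingMaps.
Variables (A B C : comPzRingType) (f : {rmorphism A -> B}) (g : {rmorphism A -> C}).

Definition tin1 (b : B) : tring f g := tpure f g b 1.
Definition tin2 (c : C) : tring f g := tpure f g 1 c.

Fact tin1_zmod : zmod_morphism tin1.
Proof.
move=> x y; apply: (addIr (tin1 y)); rewrite subrK /tin1 -tpureDl.
by rewrite subrK.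
Qed.
Fact tin1_monoid : monoid_morphism tin1.
Proof. by split=> // x y; rewrite /tin1 tpureM mulr1. Qed.
HB.instance Definition _ := GRing.isZmodMorphism.Build B (tring f g) tin1 tin1_zmod.
HB.instance Definition _ := GRing.isMonoidMorphism.Build B (tring f g) tin1 tin1_monoid.

Fact tin2_zmod : zmod_morphism tin2.
Proof.
move=> x y; apply: (addIr (tin2 y)); rewrite subrK /tin2 -tpureDr.
by rewrite subrK.
Qed.
Fact tin2_monoid : monoid_morphism tin2.
Proof. by split=> // x y; rewrite /tin2 tpureM mulr1. Qed.
HB.instance Definition _ := GRing.isZmodMorphism.Build C (tring f g) tin2 tin2_zmod.
HB.instance Definition _ := GRing.isMonoidMorphism.Build C (tring f g) tin2 tin2_monoid.

Lemma tin_comm a : tin1 (f a) = tin2 (g a).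
Proof. by rewrite /tin1 /tin2 -[f a]mulr1 tpureZ mulr1. Qed.

Lemma tpureE b c : tpure f g b c = tin1 b * tin2 c.
Proof. by rewrite tpureM mulr1 mul1r. Qed.

Lemma tring_ext (D : comPzRingType) (h h' : {rmorphism tring f g -> D}) :
  (forall b, h (tin1 b) = h' (tin1 b)) -> (forall c, h (tin2 c) = h' (tin2 c)) ->
  h =1 h'.
Proof.
move=> e1 e2 x; elim/tring_ind: x => [|x y ex ey|b c]; first by rewrite !rmorph0.
  by rewrite !rmorphD ex ey.
by rewrite tpureE !rmorphM e1 e2.
Qed.

Section Copair.
Variables (D : comPzRingType) (u : {rmorphism B -> D}) (v : {rmorphism C -> D}).

(* b (x) c |-> u b * v c *)
Definition tcop of (forall a, u (f a) = v (g a)) : tring f g -> D :=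
  fun x => tens_lift (fun (b : restr f) (c : restr g) => u b * v c) x.

Hypothesis uv : forall a, u (f a) = v (g a).

Fact tcop_balanced : balanced (fun (b : restr f) (c : restr g) => u b * v c).
Proof.
split=> [m m' n|m n n'|a m n].
- by rewrite rmorphD mulrDl.
- by rewrite rmorphD mulrDr.
- rewrite /GRing.scale /= /restr_scale !rmorphM -uv.
  by rewrite mulrCA mulrA.
Qed.

Lemma tcop_pure b c : tcop uv (tpure f g b c) = u b * v c.
Proof. exact: (tens_lift_pure tcop_balanced). Qed.

Fact tcop_zmod : zmod_morphism (tcop uv).
Proof.
move=> x y; apply: (addIr (tcop uv y)); rewrite subrK.
by rewrite -[LHS](tens_liftD tcop_balanced) subrK.
Qed.
HB.instance Definition _ := GRing.isZmodMorphism.Build (tring f g) D (tcop uv) tcop_zmod.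

Fact tcop_monoid : monoid_morphism (tcop uv).
Proof.
split; first by rewrite [LHS]tcop_pure !rmorph1 mulr1.
move=> x y; elim/tring_ind: x => [|x x' e1 e2|b c].
- by rewrite mul0r !raddf0 mul0r.
- by rewrite mulrDl !raddfD /= e1 e2 mulrDl.
elim/tring_ind: y => [|y y' e1 e2|b' c'].
- by rewrite mulr0 !raddf0 mulr0.
- by rewrite mulrDr !raddfD /= e1 e2 mulrDr.
by rewrite tpureM !tcop_pure !rmorphM mulrACA.
Qed.
HB.instance Definition _ := GRing.isMonoidMorphism.Build (tring f g) D (tcop uv) tcop_monoid.

Lemma tcop1 b : tcop uv (tin1 b) = u b.
Proof. by rewrite tcop_pure rmorph1 mulr1. Qed.
Lemma tcop2 c : tcop uv (tin2 c) = v c.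
Proof. by rewrite tcop_pure rmorph1 mul1r. Qed.
End Copair.

End TRingMaps.

Arguments tin1 {A B C} f g.
Arguments tin2 {A B C} f g.
Arguments tcop {A B C f g D} u v.

Lemma rmorph_eq (A B : comPzRingType) (f g : {rmorphism A -> B}) : f =1 g -> f = g.
Proof.
case: f g => [f cf] [g cg] /= /funext e; move: cf cg; rewrite {f}e => cf cg.
congr GRing.RMorphism.Pack.
case: cf cg => [[a1] [a2]] [[b1] [b2]].
by rewrite (Prop_irrelevance a1 b1) (Prop_irrelevance a2 b2).
Qed.

Record aff (S : comPzRingType) := Aff {
  ring_of : comPzRingType;
  str_map : {rmorphism S -> ring_of} }.

Record mor (S : comPzRingType) (X Y : aff S) := Mor {
  pb : {rmorphism ring_of Y -> ring_of X};
  pbE : forall s, pb (str_map Y s) = str_map X s }.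

Section Schemes.
Variable S : comPzRingType.
Implicit Types X Y Z T W : aff S.

Lemma mor_eq X Y (u v : mor X Y) : pb u =1 pb v -> u = v.
Proof.
case: u v => [u hu] [v hv] /= /rmorph_eq e; move: hu hv; rewrite {u}e => hu hv.
congr Mor; exact: Prop_irrelevance.
Qed.

Definition idm X : mor X X :=
  @Mor S X X (@idfun (ring_of X) : {rmorphism _ -> _}) (fun=> erefl).

Fact comp_pbE X Y Z (u : mor Y Z) (v : mor X Y) s :
  (pb v \o pb u) (str_map Z s) = str_map X s.
Proof. by rewrite /= !pbE. Qed.
Definition compm X Y Z (u : mor Y Z) (v : mor X Y) : mor X Z :=
  @Mor S X Z (pb v \o pb u : {rmorphism _ -> _}) (comp_pbE u v).

Definition is_iso X Y (u : mor X Y) : Prop :=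
  exists v : mor Y X, compm u v = idm Y /\ compm v u = idm X.

Lemma compA X Y Z W (u : mor Z W) (v : mor Y Z) (w : mor X Y) :
  compm u (compm v w) = compm (compm u v) w.
Proof. exact: mor_eq. Qed.
Lemma comp1m X Y (u : mor X Y) : compm (idm Y) u = u.
Proof. exact: mor_eq. Qed.
Lemma compm1 X Y (u : mor X Y) : compm u (idm X) = u.
Proof. exact: mor_eq. Qed.

(* S itself, the terminal S-scheme. *)
Definition base : aff S := @Aff S S (@idfun S : {rmorphism _ -> _}).
Definition to_base X : mor X base := @Mor S X base (str_map X) (fun=> erefl).

Lemma to_base_uniq X (u v : mor X base) : u = v.
Proof. by apply: mor_eq => s; rewrite -[s]/(str_map base s) !pbE. Qed.

Section Fibre.
Variables (X Y Z : aff S) (f : mor Y X) (g : mor Z X).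

(* Y x_X Z *)
Definition fib : aff S :=
  @Aff S (tring (pb f) (pb g)) (tin1 (pb f) (pb g) \o str_map Y : {rmorphism _ -> _}).

Definition fst_fib : mor fib Y :=
  @Mor S fib Y (tin1 (pb f) (pb g) : {rmorphism _ -> _}) (fun=> erefl).

Fact snd_fibE s : tin2 (pb f) (pb g) (str_map Z s) = str_map fib s.
Proof. by rewrite /= -(pbE g) -tin_comm pbE. Qed.
Definition snd_fib : mor fib Z :=
  @Mor S fib Z (tin2 (pb f) (pb g) : {rmorphism _ -> _}) snd_fibE.

Lemma fib_comm : compm f fst_fib = compm g snd_fib.
Proof. by apply: mor_eq => a /=; rewrite tin_comm. Qed.

Section Pair.
Variables (T : aff S) (u : mor T Y) (v : mor T Z).
Hypothesis uv : compm f u = compm g v.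

Fact pair_comm a : pb u (pb f a) = pb v (pb g a).
Proof. exact: (congr1 (fun w => pb w a) uv). Qed.

Fact pair_pbE s : tcop (pb u) (pb v) pair_comm (str_map fib s) = str_map T s.
Proof. by rewrite /= tcop1 pbE. Qed.

Definition pair_fib : mor T fib :=
  @Mor S T fib (tcop (pb u) (pb v) pair_comm : {rmorphism _ -> _}) pair_pbE.

Lemma fst_pair : compm fst_fib pair_fib = u.
Proof. by apply: mor_eq => b /=; rewrite tcop1. Qed.
Lemma snd_pair : compm snd_fib pair_fib = v.
Proof. by apply: mor_eq => b /=; rewrite tcop2. Qed.
End Pair.

Lemma fib_ext T (u v : mor T fib) :
  compm fst_fib u = compm fst_fib v -> compm snd_fib u = compm snd_fib v -> u = v.
Proof.
move=> e1 e2; apply: mor_eq; apply: tring_ext => b.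
  exact: (congr1 (fun w => pb w b) e1).
exact: (congr1 (fun w => pb w b) e2).
Qed.
End Fibre.

(* Y x_S Z *)
Definition prodm Y Z : aff S := fib (to_base Y) (to_base Z).
Definition pr1 {Y Z} : mor (prodm Y Z) Y := fst_fib (to_base Y) (to_base Z).
Definition pr2 {Y Z} : mor (prodm Y Z) Z := snd_fib (to_base Y) (to_base Z).
Definition pairm T Y Z (u : mor T Y) (v : mor T Z) : mor T (prodm Y Z) :=
  pair_fib (to_base_uniq (compm (to_base Y) u) (compm (to_base Z) v)).

Lemma pr1_pair T Y Z (u : mor T Y) (v : mor T Z) : compm pr1 (pairm u v) = u.
Proof. exact: fst_pair. Qed.
Lemma pr2_pair T Y Z (u : mor T Y) (v : mor T Z) : compm pr2 (pairm u v) = v.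
Proof. exact: snd_pair. Qed.
Lemma prod_ext T Y Z (u v : mor T (prodm Y Z)) :
  compm pr1 u = compm pr1 v -> compm pr2 u = compm pr2 v -> u = v.
Proof. exact: fib_ext. Qed.
Lemma pair_comp T W Y Z (u : mor T Y) (v : mor T Z) (w : mor W T) :
  compm (pairm u v) w = pairm (compm u w) (compm v w).
Proof.
by apply: prod_ext; rewrite compA ?pr1_pair ?pr2_pair.
Qed.

Definition compE X Y Z W (u : mor Z W) (v : mor Y Z) (w : mor X Y) :=
  esym (compA u v w).
Definition pair_compE := (pair_comp, pr1_pair, pr2_pair, comp1m, compm1).

Record grp := Grp {
  gsch :> aff S;
  gmul : mor (prodm gsch gsch) gsch;
  gone : mor base gsch;
  ginv : mor gsch gsch;
  gmulA : compm gmul (pairm (compm gmul (pairm (compm pr1 pr1) (compm pr2 pr1))) pr2)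
        = compm gmul (pairm (compm pr1 pr1) (compm gmul (pairm (compm pr2 pr1) pr2)))
        :> mor (prodm (prodm gsch gsch) gsch) gsch;
  gmul1l : compm gmul (pairm (compm gone (to_base gsch)) (idm gsch)) = idm gsch;
  gmul1r : compm gmul (pairm (idm gsch) (compm gone (to_base gsch))) = idm gsch;
  gmulVl : compm gmul (pairm ginv (idm gsch)) = compm gone (to_base gsch);
  gmulVr : compm gmul (pairm (idm gsch) ginv) = compm gone (to_base gsch) }.

(* A multiplicative morphism automatically preserves unit and inverse. *)
Definition grp_iso (G H : grp) (a : mor G H) : Prop :=
  is_iso a /\ compm a (gmul G) = compm (gmul H) (pairm (compm a pr1) (compm a pr2)).

(* An affine morphism Y -> X of S-schemes (X affine) with a right action of G
   on Y over S for which Y -> X is G-invariant. *)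
Record gspace (G : grp) (X : aff S) := Gspace {
  tot :> aff S;
  gact : mor (prodm tot G) tot;
  gproj : mor tot X;
  actA : compm gact (pairm (compm gact (pairm (compm pr1 pr1) (compm pr2 pr1))) pr2)
       = compm gact (pairm (compm pr1 pr1) (compm (gmul G) (pairm (compm pr2 pr1) pr2)))
       :> mor (prodm (prodm tot G) G) tot;
  act1 : compm gact (pairm (idm tot) (compm (gone G) (to_base tot))) = idm tot;
  proj_act : compm gproj gact = compm gproj pr1 }.

End Schemes.

Arguments idm {S} X.
Arguments base {S}.
Arguments to_base {S} X.
Arguments pr1 {S Y Z}.
Arguments pr2 {S Y Z}.

Definition flat (A B : comPzRingType) (f : {rmorphism A -> B}) : Prop :=
  forall (M N : lmodType A) (g : {linear M -> N}),
    injective g -> injective (tens_map (N := restr f) g).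

Definition is_ideal (A : comPzRingType) (I : A -> Prop) : Prop :=
  [/\ I 0, forall x y, I x -> I y -> I (x + y) & forall a x, I x -> I (a * x)].

Definition is_prime (A : comPzRingType) (P : A -> Prop) : Prop :=
  [/\ is_ideal P, ~ P 1 & forall x y, P (x * y) -> P x \/ P y].

Definition spec_surjective (A B : comPzRingType) (f : {rmorphism A -> B}) : Prop :=
  forall P : A -> Prop, is_prime P ->
    exists2 Q : B -> Prop, is_prime Q & forall a, P a <-> Q (f a).

Definition faithfully_flat (A B : comPzRingType) (f : {rmorphism A -> B}) : Prop :=
  flat f /\ spec_surjective f.

Definition finite_type (S : comPzRingType) (X : aff S) : Prop :=
  exists s : seq (ring_of X), forall P : ring_of X -> Prop,
    (forall c, P (str_map X c)) -> (forall x, x \in s -> P x) ->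
    (forall x y, P x -> P y -> P (x + y)) ->
    (forall x y, P x -> P y -> P (x * y)) ->
    forall x, P x.

Definition canonical_map (S : comPzRingType) (G : grp S) (X : aff S)
  (Y : gspace G X) : mor (prodm Y G) (fib (gproj Y) (gproj Y)) :=
  pair_fib (proj_act Y).

Definition is_torsor (S : comPzRingType) (G : grp S) (X : aff S)
  (Y : gspace G X) : Prop :=
  faithfully_flat (pb (gproj Y)) /\ is_iso (canonical_map Y).

Section GroupLemmas.
Variables (S : comPzRingType) (G : grp S).

Lemma gmulAp (T : aff S) (a b c : mor T G) :
  compm (gmul G) (pairm (compm (gmul G) (pairm a b)) c)
  = compm (gmul G) (pairm a (compm (gmul G) (pairm b c))).
Proof.
have := congr1 (fun w => compm w (pairm (pairm a b) c)) (gmulA G).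
by rewrite !(compE, pair_compE).
Qed.

Lemma actAp (X : aff S) (Y : gspace G X) (T : aff S) (a : mor T Y) (b c : mor T G) :
  compm (gact Y) (pairm (compm (gact Y) (pairm a b)) c)
  = compm (gact Y) (pairm a (compm (gmul G) (pairm b c))).
Proof.
have := congr1 (fun w => compm w (pairm (pairm a b) c)) (actA Y).
by rewrite !(compE, pair_compE).
Qed.
End GroupLemmas.

Section Pullback.
Variables (S : comPzRingType) (G : grp S) (X X' : aff S) (Y : gspace G X)
  (g : mor X' X).

Let P := fib (gproj Y) g.
Let q1 : mor P Y := fst_fib (gproj Y) g.
Let q2 : mor P X' := snd_fib (gproj Y) g.

Fact pullback_act_comm :
  compm (gproj Y) (compm (gact Y) (pairm (compm q1 (pr1 (Y := P) (Z := G))) pr2))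
  = compm g (compm q2 pr1).
Proof. by rewrite compA proj_act !(compE, pair_compE) !compA fib_comm. Qed.

(* (y, x') . g = (y . g, x') *)
Definition pullback_act : mor (prodm P G) P := pair_fib pullback_act_comm.

Lemma pullback_actE1 T (a : mor T P) (b : mor T G) :
  compm q1 (compm pullback_act (pairm a b)) = compm (gact Y) (pairm (compm q1 a) b).
Proof. by rewrite compA fst_pair !(compE, pair_compE). Qed.
Lemma pullback_actE2 T (a : mor T P) (b : mor T G) :
  compm q2 (compm pullback_act (pairm a b)) = compm q2 a.
Proof. by rewrite compA snd_pair !(compE, pair_compE). Qed.

Fact pullback_actA :
  compm pullback_act
    (pairm (compm pullback_act (pairm (compm pr1 pr1) (compm pr2 pr1))) pr2)
  = compm pullback_act
      (pairm (compm pr1 pr1) (compm (gmul G) (pairm (compm pr2 pr1) pr2)))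
  :> mor (prodm (prodm P G) G) P.
Proof.
apply: fib_ext; first by rewrite !pullback_actE1 actAp.
by rewrite !pullback_actE2.
Qed.

Fact pullback_act1 :
  compm pullback_act (pairm (idm P) (compm (gone G) (to_base P))) = idm P.
Proof.
apply: fib_ext; last by rewrite pullback_actE2.
rewrite pullback_actE1 !compm1.
have := congr1 (fun w => compm w q1) (act1 Y).
rewrite !(compE, pair_compE).
by rewrite (to_base_uniq (compm (to_base Y) q1) (to_base P)).
Qed.

Fact pullback_proj_act : compm q2 pullback_act = compm q2 pr1.
Proof. exact: snd_pair. Qed.

Definition pullback : gspace G X' :=
  Gspace pullback_actA pullback_act1 pullback_proj_act.
End Pullback.

Section BaseChange.
Variables (S S' : comPzRingType) (i : {rmorphism S -> S'}).

(* An S'-scheme viewed as an S-scheme. *)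
Definition res (T : aff S') : aff S :=
  @Aff S (ring_of T) (str_map T \o i : {rmorphism _ -> _}).
Fact res_pbE (T T' : aff S') (u : mor T T') s : pb u (str_map (res T') s) = str_map (res T) s.
Proof. exact: pbE. Qed.
Definition res_mor (T T' : aff S') (u : mor T T') : mor (res T) (res T') :=
  @Mor S (res T) (res T') (pb u) (res_pbE u).

(* X x_S S' *)
Definition bc (X : aff S) : aff S' :=
  @Aff S' (tring i (str_map X)) (tin1 i (str_map X) : {rmorphism _ -> _}).

Fact bc_projE X s : tin2 i (str_map X) (str_map X s) = str_map (res (bc X)) s.
Proof. by rewrite /= tin_comm. Qed.
Definition bc_proj X : mor (res (bc X)) X :=
  @Mor S (res (bc X)) X (tin2 i (str_map X) : {rmorphism _ -> _}) (@bc_projE X).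

Section Lift.
Variables (T : aff S') (X : aff S) (u : mor (res T) X).
Fact bc_lift_comm s : str_map T (i s) = pb u (str_map X s).
Proof. by rewrite pbE. Qed.
Fact bc_lift_pbE s : tcop (str_map T) (pb u) bc_lift_comm (str_map (bc X) s) = str_map T s.
Proof. by rewrite /= tcop1. Qed.
(* The S'-morphism T -> X x_S S' with first component u. *)
Definition bc_lift : mor T (bc X) :=
  @Mor S' T (bc X) (tcop (str_map T) (pb u) bc_lift_comm : {rmorphism _ -> _}) bc_lift_pbE.

Lemma bc_liftE : compm (bc_proj X) (res_mor bc_lift) = u.
Proof. by apply: mor_eq => x /=; rewrite tcop2. Qed.
End Lift.

Lemma bc_ext (T : aff S') (X : aff S) (u v : mor T (bc X)) :
  compm (bc_proj X) (res_mor u) = compm (bc_proj X) (res_mor v) -> u = v.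
Proof.
move=> e; apply: mor_eq; apply: tring_ext => b.
  by rewrite -![tin1 _ _ _]/(str_map (bc X) b) !pbE.
exact: (congr1 (fun w => pb w b) e).
Qed.

Lemma res_comp (T T' T'' : aff S') (u : mor T' T'') (v : mor T T') :
  res_mor (compm u v) = compm (res_mor u) (res_mor v).
Proof. exact: mor_eq. Qed.
Lemma res_id (T : aff S') : res_mor (idm T) = idm (res T).
Proof. exact: mor_eq. Qed.

Definition bc_mor (X Y : aff S) (u : mor X Y) : mor (bc X) (bc Y) :=
  bc_lift (compm u (bc_proj X)).

(* For m : X x_S Y -> Z, the morphism X_S' x_S' Y_S' -> Z_S'. *)
Definition bc_op (X Y Z : aff S) (m : mor (prodm X Y) Z) :
  mor (prodm (bc X) (bc Y)) (bc Z) :=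
  bc_lift (compm m (pairm (compm (bc_proj X) (res_mor pr1))
                        (compm (bc_proj Y) (res_mor pr2)))).

Local Notation "'pt' u" := (compm (bc_proj _) (res_mor u)) (at level 10).

Lemma bc_morE (X Y : aff S) (u : mor X Y) T (a : mor T (bc X)) :
  pt (compm (bc_mor u) a) = compm u (pt a).
Proof. by rewrite res_comp compA bc_liftE compE. Qed.

Lemma bc_opE (X Y Z : aff S) (m : mor (prodm X Y) Z) T
    (a : mor T (bc X)) (b : mor T (bc Y)) :
  pt (compm (bc_op m) (pairm a b)) = compm m (pairm (pt a) (pt b)).
Proof.
rewrite res_comp compA bc_liftE !(compE, pair_compE).
by rewrite -!res_comp !pair_compE.
Qed.

Section Group.
Variable G : grp S.

Definition bc_one : mor base (bc G) := bc_lift (compm (gone G) (to_base _)).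

Lemma bc_oneE T : pt (compm bc_one (to_base T)) = compm (gone G) (to_base (res T)).
Proof.
rewrite res_comp compA bc_liftE compE; congr compm; exact: to_base_uniq.
Qed.

Fact bc_gmulA :
  compm (bc_op (gmul G))
    (pairm (compm (bc_op (gmul G)) (pairm (compm pr1 pr1) (compm pr2 pr1))) pr2)
  = compm (bc_op (gmul G))
      (pairm (compm pr1 pr1) (compm (bc_op (gmul G)) (pairm (compm pr2 pr1) pr2)))
  :> mor (prodm (prodm (bc G) (bc G)) (bc G)) (bc G).
Proof. by apply: bc_ext; rewrite !bc_opE gmulAp. Qed.

Lemma gmul1lp (T : aff S) (a : mor T G) :
  compm (gmul G) (pairm (compm (gone G) (to_base T)) a) = a.
Proof.
have := congr1 (fun w => compm w a) (gmul1l G); rewrite !(compE, pair_compE).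
by rewrite (to_base_uniq (compm (to_base G) a) (to_base T)).
Qed.
Lemma gmul1rp (T : aff S) (a : mor T G) :
  compm (gmul G) (pairm a (compm (gone G) (to_base T))) = a.
Proof.
have := congr1 (fun w => compm w a) (gmul1r G); rewrite !(compE, pair_compE).
by rewrite (to_base_uniq (compm (to_base G) a) (to_base T)).
Qed.
Lemma gmulVlp (T : aff S) (a : mor T G) :
  compm (gmul G) (pairm (compm (ginv G) a) a) = compm (gone G) (to_base T).
Proof.
have := congr1 (fun w => compm w a) (gmulVl G); rewrite !(compE, pair_compE).
by rewrite (to_base_uniq (compm (to_base G) a) (to_base T)).
Qed.
Lemma gmulVrp (T : aff S) (a : mor T G) :
  compm (gmul G) (pairm a (compm (ginv G) a)) = compm (gone G) (to_base T).
Proof.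
have := congr1 (fun w => compm w a) (gmulVr G); rewrite !(compE, pair_compE).
by rewrite (to_base_uniq (compm (to_base G) a) (to_base T)).
Qed.

Fact bc_gmul1l :
  compm (bc_op (gmul G)) (pairm (compm bc_one (to_base (bc G))) (idm (bc G)))
  = idm (bc G).
Proof. by apply: bc_ext; rewrite bc_opE bc_oneE gmul1lp. Qed.
Fact bc_gmul1r :
  compm (bc_op (gmul G)) (pairm (idm (bc G)) (compm bc_one (to_base (bc G))))
  = idm (bc G).
Proof. by apply: bc_ext; rewrite bc_opE bc_oneE gmul1rp. Qed.
Fact bc_gmulVl :
  compm (bc_op (gmul G)) (pairm (bc_mor (ginv G)) (idm (bc G)))
  = compm bc_one (to_base (bc G)).
Proof.
apply: bc_ext; rewrite bc_opE bc_oneE -[bc_mor _]compm1 bc_morE.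
exact: gmulVlp.
Qed.
Fact bc_gmulVr :
  compm (bc_op (gmul G)) (pairm (idm (bc G)) (bc_mor (ginv G)))
  = compm bc_one (to_base (bc G)).
Proof.
apply: bc_ext; rewrite bc_opE bc_oneE -[bc_mor _]compm1 bc_morE.
exact: gmulVrp.
Qed.

Definition bc_grp : grp S' :=
  Grp bc_gmulA bc_gmul1l bc_gmul1r bc_gmulVl bc_gmulVr.

Section Space.
Variables (X : aff S) (Y : gspace G X).

Fact bc_actA :
  compm (bc_op (gact Y))
    (pairm (compm (bc_op (gact Y)) (pairm (compm pr1 pr1) (compm pr2 pr1))) pr2)
  = compm (bc_op (gact Y))
      (pairm (compm pr1 pr1) (compm (gmul bc_grp) (pairm (compm pr2 pr1) pr2)))
  :> mor (prodm (prodm (bc Y) bc_grp) bc_grp) (bc Y).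
Proof. by apply: bc_ext; rewrite !bc_opE actAp. Qed.

Fact bc_act1 :
  compm (bc_op (gact Y)) (pairm (idm (bc Y)) (compm (gone bc_grp) (to_base (bc Y))))
  = idm (bc Y).
Proof.
apply: bc_ext; rewrite bc_opE bc_oneE.
have := congr1 (fun w => compm w (pt (idm (bc Y)))) (act1 Y).
rewrite !(compE, pair_compE).
by rewrite (to_base_uniq (compm (to_base Y) _) (to_base _)).
Qed.

Fact bc_proj_act :
  compm (bc_mor (gproj Y)) (bc_op (gact Y))
  = compm (bc_mor (gproj Y)) (pr1 (Y := bc Y) (Z := bc_grp)).
Proof.
apply: bc_ext; rewrite !bc_morE bc_liftE compA proj_act.
by rewrite !(compE, pair_compE).
Qed.

Definition bc_gspace : gspace bc_grp (bc X) := Gspace bc_actA bc_act1 bc_proj_act.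
End Space.
End Group.
End BaseChange.

(* The G'-space Y' over X extends the G-space Y over Z, where the isomorphism
   c identifies Z with the base change of X to S': under some isomorphism of
   group schemes G'_S' = G, the base change Y'_S' -> X_S' is isomorphic to
   Y -> Z as a G-space. *)
Definition extends (S S' : comPzRingType) (i : {rmorphism S -> S'})
  (X : aff S) (Z : aff S') (c : mor Z (bc i X))
  (G' : grp S) (Y' : gspace G' X) (G : grp S') (Y : gspace G Z) : Prop :=
  exists2 a : mor (bc_grp i G') G, grp_iso a &
  exists t : mor (bc_gspace i Y') Y,
    [/\ is_iso t,
        compm c (compm (gproj Y) t) = gproj (bc_gspace i Y')
      & compm t (gact (bc_gspace i Y'))
        = compm (gact Y) (pairm (compm t pr1) (compm a pr2))].

Section Alpha.
Variables (S : comNzRingType) (p : nat).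
Local Notation A := {poly %/ 'X^p : {poly S}}.

Fact qpolyC_zmod : zmod_morphism (qpolyC ('X^p : {poly S})).
Proof. by move=> a b; rewrite qpolyCD qpolyCN. Qed.
Fact qpolyC_monoid : monoid_morphism (qpolyC ('X^p : {poly S})).
Proof. by split=> // a b; rewrite qpolyCM. Qed.
Definition alpha_str (s : S) : A := qpolyC 'X^p s.
HB.instance Definition _ := GRing.isZmodMorphism.Build S A alpha_str qpolyC_zmod.
HB.instance Definition _ := GRing.isMonoidMorphism.Build S A alpha_str qpolyC_monoid.

Definition alpha : aff S := @Aff S A (alpha_str : {rmorphism S -> A}).

(* The section x |-> 0. *)
Definition alpha_ev0 (q : A) : S := (q : {poly S}).[0].
Fact alpha_ev0_zmod : zmod_morphism alpha_ev0.
Proof. by move=> q r; rewrite /alpha_ev0 /= hornerD hornerN. Qed.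
Fact alpha_ev0_monoid : monoid_morphism alpha_ev0.
Proof.
split=> [|q r]; first by rewrite /alpha_ev0 /= hornerC.
rewrite /alpha_ev0 poly_of_qpolyM -hornerM.
have mon := monic_mk_monic ('X^p : {poly S}).
move: (polyn q * polyn r) => u.
rewrite [in RHS](Pdiv.RingMonic.rdivp_eq mon u).
by rewrite hornerD hornerM mk_monic_Xn hornerXn expr0n /= mulr0 add0r.
Qed.
HB.instance Definition _ := GRing.isZmodMorphism.Build A S alpha_ev0 alpha_ev0_zmod.
HB.instance Definition _ := GRing.isMonoidMorphism.Build A S alpha_ev0 alpha_ev0_monoid.

Fact alpha_unitE s : alpha_ev0 (str_map alpha s) = str_map base s.
Proof. by rewrite /alpha_ev0 /= hornerC. Qed.
Definition alpha_unit : mor base alpha :=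
  @Mor S base alpha (alpha_ev0 : {rmorphism A -> S}) alpha_unitE.
End Alpha.

Section AlphaBaseChange.
Variables (S S' : comNzRingType) (i : {rmorphism S -> S'}) (p : nat).
Local Notation A := {poly %/ 'X^p : {poly S}}.
Local Notation A' := {poly %/ 'X^p : {poly S'}}.

Definition alpha_map (q : A) : A' := in_qpoly 'X^p (map_poly i q).
Lemma alpha_map_in (q : {poly S}) :
  alpha_map (in_qpoly 'X^p q) = in_qpoly 'X^p (map_poly i q).
Proof.
have mon := monic_mk_monic ('X^p : {poly S}).
rewrite /alpha_map /= [in RHS](Pdiv.RingMonic.rdivp_eq mon q).
rewrite [in RHS]rmorphD rmorphM in_qpolyD in_qpolyM /=.
suff -> : in_qpoly 'X^p (map_poly i (mk_monic 'X^p)) = 0 by rewrite mulr0 add0r.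
apply: val_inj; rewrite /= !mk_monic_Xn map_polyXn.
by rewrite Pdiv.RingMonic.rmodpp // monicXn.
Qed.
Fact alpha_map_zmod : zmod_morphism alpha_map.
Proof. by move=> q r; rewrite /alpha_map /= !rmorphB. Qed.
Fact alpha_map_monoid : monoid_morphism alpha_map.
Proof.
split=> [|q r]; first by rewrite /alpha_map /= rmorph1 in_qpoly1.
by rewrite -[q * r]/(in_qpoly 'X^p (polyn q * polyn r)) alpha_map_in rmorphM in_qpolyM.
Qed.
HB.instance Definition _ := GRing.isZmodMorphism.Build A A' alpha_map alpha_map_zmod.
HB.instance Definition _ := GRing.isMonoidMorphism.Build A A' alpha_map alpha_map_monoid.

Fact alpha_mapE s : alpha_map (str_map (alpha S p) s) = str_map (res i (alpha S' p)) s.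
Proof.
apply: val_inj; rewrite /= map_polyC /= Pdiv.Ring.rmodp_small //.
by rewrite size_polyC; case: eqP => _ //=; rewrite ?size_mk_monic_gt0 ?size_mk_monic_gt1.
Qed.

(* alpha_{p,S'} -> alpha_{p,S} x_S S', x |-> x *)
Definition alpha_bc : mor (alpha S' p) (bc i (alpha S p)) :=
  bc_lift (@Mor S (res i (alpha S' p)) (alpha S p)
             (alpha_map : {rmorphism A -> A'}) alpha_mapE).
End AlphaBaseChange.

Lemma bij_is_iso (S : comPzRingType) (X Y : aff S) (u : mor X Y) :
  bijective (pb u) -> is_iso u.
Proof.
case=> g gK Kg.
have gz : zmod_morphism g.
  by move=> a b; apply: (can_inj gK); rewrite Kg rmorphB !Kg.
have gm : monoid_morphism g.
  by split=> [|a b]; apply: (can_inj gK); rewrite Kg ?rmorph1 // rmorphM !Kg.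
pose gM := GRing.isMonoidMorphism.Build _ _ g gm.
pose gZ := GRing.isZmodMorphism.Build _ _ g gz.
pose h : {rmorphism ring_of X -> ring_of Y} := HB.pack g gZ gM.
have hE s : h (str_map X s) = str_map Y s.
  by apply: (can_inj gK); rewrite /= Kg pbE.
by exists (Mor hE); split; apply: mor_eq => a /=; rewrite ?gK ?Kg.
Qed.

Section AlphaBaseChangeIso.
Variables (S S' : comNzRingType) (i : {rmorphism S -> S'}) (p : nat).
Local Notation A := {poly %/ 'X^p : {poly S}}.
Local Notation A' := {poly %/ 'X^p : {poly S'}}.
Local Notation n := p.-1.+1.

Lemma size_mk_monic_Xn (T : comNzRingType) : size (mk_monic ('X^p : {poly T})) = n.+1.
Proof. by rewrite mk_monic_Xn size_polyXn. Qed.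

Lemma in_qpolyK (T : comNzRingType) (q : {poly %/ 'X^p : {poly T}}) :
  in_qpoly 'X^p (polyn q) = q.
Proof. by apply: val_inj; rewrite [LHS]in_qpoly_small // size_mk_monic. Qed.

Lemma qpoly_expand (T : comNzRingType) (q : {poly %/ 'X^p : {poly T}}) :
  q = \sum_(j < n) alpha_str p (polyn q)`_j * in_qpoly 'X^p 'X ^+ j.
Proof.
rewrite -[LHS]in_qpolyK.
rewrite [in LHS](_ : polyn q = \sum_(j < n) ((polyn q)`_j)%:P * 'X^j); last first.
  apply/polyP => k; rewrite coef_sum.
  have [kn|nk] := ltnP k n.
    rewrite (bigD1 (Ordinal kn)) //= coefCM coefXn eqxx mulr1 big1 ?addr0 //.
    move=> j jk; rewrite coefCM coefXn [k == _]eq_sym.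
    by rewrite (_ : (j == k :> nat) = false) ?mulr0 //; apply: negbTE.
  rewrite nth_default; last first.
    rewrite -ltnS; apply: leq_trans (size_mk_monic q) _.
    by rewrite size_mk_monic_Xn.
  rewrite big1 // => j _; rewrite coefCM coefXn.
  by rewrite gtn_eqF ?mulr0 // (leq_trans (ltn_ord j)).
rewrite rmorph_sum; apply: eq_bigr => j _; rewrite rmorphM rmorphXn; congr (_ * _).
apply: val_inj; rewrite [LHS]in_qpoly_small ?qpolyCE //.
by rewrite size_polyC; apply: leq_ltn_trans (size_mk_monic_gt1 _); case: eqP.
Qed.

Lemma alpha_bc_iso : is_iso (alpha_bc i p).
Proof.
apply: bij_is_iso; set B := bc i (alpha S p).
pose t1 := tin1 i (str_map (alpha S p)); pose t2 := tin2 i (str_map (alpha S p)).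
pose g (q : A') : ring_of B :=
  \sum_(j < n) t1 (polyn q)`_j * t2 (in_qpoly 'X^p 'X ^+ j).
have gD q r : g (q + r) = g q + g r.
  rewrite /g -big_split; apply: eq_bigr => j _ /=.
  by rewrite coefD /t1 rmorphD mulrDl.
exists g => [x|q]; last first.
  rewrite rmorph_sum [RHS]qpoly_expand; apply: eq_bigr => j _.
  rewrite rmorphM; congr (_ * _); first exact: tcop1.
  rewrite [LHS]tcop2 /= rmorphXn /=; congr (_ ^+ _).
  by rewrite -[LHS]/(alpha_map i _) alpha_map_in map_polyX.
elim/tring_ind: x => [|x y e1 e2|s a].
- rewrite rmorph0 /g big1 // => j _.
  by rewrite /= coef0 /t1 rmorph0 mul0r.
- by rewrite rmorphD gD e1 e2.
rewrite tpureE rmorphM -![pb _ _]/(tcop _ _ _ _) tcop1 tcop2 /=.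
rewrite [in RHS](qpoly_expand a) rmorph_sum mulr_sumr; apply: eq_bigr => j _.
rewrite rmorphM mulrA.
set c := (polyn a)`_j.
have e : t2 (alpha_str p c) = t1 (i c).
  by rewrite /t1 (tin_comm i (str_map (alpha S p))).
rewrite -[RHS]/(t1 s * t2 (alpha_str p c) * t2 (in_qpoly 'X^p 'X ^+ j)) e.
rewrite -[t1 s * t1 _](rmorphM (tin1 i (str_map (alpha S p)))).
congr (t1 _ * _).
have sz : (size (map_poly i (polyn a)) < size (mk_monic ('X^p : {poly S'})))%N.
  apply: leq_ltn_trans (size_poly _ _) _.
  rewrite (size_mk_monic_Xn S'); apply: leq_trans (size_mk_monic a) _.
  by rewrite size_mk_monic_Xn.
rewrite /alpha_map poly_of_qpolyM in_qpoly_small // /alpha_str qpolyCE mul_polyC.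
rewrite Pdiv.Ring.rmodp_small ?coefZ ?coef_map //.
exact: leq_ltn_trans (size_scale_leq _ _) sz.
Qed.
End AlphaBaseChangeIso.

(* A principal ideal domain with exactly one nonzero prime ideal. *)

Definition is_dvr (R : idomainType) : Prop :=
  (forall I : R -> Prop, is_ideal I ->
     exists a, forall x, I x <-> exists b, x = b * a) /\
  (exists P : R -> Prop,
     [/\ is_prime P, exists2 x, P x & x != 0
       & forall Q : R -> Prop, is_prime Q -> (exists2 x, Q x & x != 0) ->
           forall x, Q x <-> P x]).

Definition tofrac_morphism (R : idomainType) : {rmorphism R -> {fraction R}} :=
  @tofrac R.

(* Main.v *)
Require Import Defs.
From HB Require Import structures.
From mathcomp Require Import all_boot all_algebra.
From mathcomp Require Import boolp classical_sets.

Set Implicit Arguments.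
Unset Strict Implicit.
Unset Printing Implicit Defensive.

Import GRing.Theory.
Local Open Scope ring_scope.

(** Write A = K[x]/(x^p), B = O(G), C = O(Y), and let rho : C -> C (x) B be the
    coaction.  The base point y gives the orbit map q : C -> B, the
    restriction to the fibre over x = 0; it is surjective with kernel x C.

    The torsor is embedded in X_eta x GL_n.  Matrix coefficients give a matrix
    d over B with Delta(d) = d (x) d whose entries generate B, its inverse
    being the antipode of d ([matrix_generators]).  It lifts to an invertible matrix c over
    C with rho(c) = c (x) d and q(c) = d ([torsor_matrices]): the torsor is
    cleft, that is, q has a section B -> C of comodules.  To construct it, take
    an A-linear map lam : C -> A that reduces to y modulo x, which exists since
    A is a Frobenius algebra and C is flat ([lift_point]), and send b to
    (id (x) lam)(t), where t in C (x)_A C corresponds to 1 (x) b under the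
    torsor isomorphism ([cleave]).

    The model of G is B' = R[d, d^-1]; the coaction on c shows that
    C' = R[z, c, c^-1] with z = x / r is stable under B'.  The
    point is to choose r such that C' is flat over A' = R[z]/(z^p), for which
    it suffices that the kernel of q : C' -> B' is z C' ([flat_model]).  The
    ring R[c, c^-1] is noetherian, so that its ideal of elements killed by q
    is generated by finitely many elements f = x w.  If r clears the
    denominators of all these w then f = z (r w) with r w in C', and
    this suffices ([scale_exists], [order_ker]).  Dividing x by r is the
    pullback by the automorphism x |-> r x of alpha_p.

    All identities over R (group axioms, action, invariance) follow from those
    over K because B' (x) B' and C' (x) B' embed in B (x) B and C (x) B
    ([prod_model]).  In the same way C' (x)_A' C' embeds in C (x)_A C, which
    makes the canonical map of Y' injective; it is surjective because
    1 (x) d = (c^-1 (x) 1) rho(c) ([canonical_surj]).  The point y maps c to 1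
    and z to 0, hence is integral. *)

(** * Flatness by equations *)

Section Equational.
Variable A : comPzRingType.

(** The equational criterion: every linear relation in N is explained by
    relations in A. Indices range over arbitrary finite types, so that
    families are concatenated by sums of types. *)
Definition eq_flat (N : lmodType A) : Prop :=
  forall (I : finType) (a : I -> A) (c : I -> N), \sum_i a i *: c i = 0 ->
  exists (J : finType) (b : I -> J -> A) (d : J -> N),
    (forall i, c i = \sum_k b i k *: d k) /\ forall k, \sum_i a i * b i k = 0.

Variable N : lmodType A.
Hypothesis N_flat : eq_flat N.

Lemma eq_flat_system (I : finType) (m : nat) (a : nat -> I -> A) (c : I -> N) :
  (forall j, (j < m)%N -> \sum_i a j i *: c i = 0) ->
  exists (J : finType) (b : I -> J -> A) (d : J -> N),
    (forall i, c i = \sum_k b i k *: d k) /\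
    forall j k, (j < m)%N -> \sum_i a j i * b i k = 0.
Proof.
elim: m => [|m IH] ac.
  exists I, (fun i k => (i == k)%:R), c; split=> // i.
  rewrite (bigD1 i) //= eqxx scale1r big1 ?addr0 // => k.
  by rewrite eq_sym => /negbTE ->; rewrite scale0r.
have [|J [b [d [cE ab]]]] := IH; first by move=> j jm; apply/ac/ltnW.
have /N_flat[J' [b' [d' [dE b'0]]]] : \sum_k (\sum_i a m i * b i k) *: d k = 0.
  rewrite -[RHS](ac m) //; under eq_bigr do rewrite scaler_suml.
  rewrite exchange_big; apply: eq_bigr => i _ /=.
  by rewrite [in RHS]cE scaler_sumr; apply: eq_bigr => k _; rewrite scalerA.
exists J', (fun i l => \sum_k b i k * b' k l), d'; split=> [i|j l].
  rewrite cE; under [RHS]eq_bigr do rewrite scaler_suml.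
  rewrite [RHS]exchange_big; apply: eq_bigr => k _ /=.
  by rewrite dE scaler_sumr; apply: eq_bigr => l _; rewrite scalerA.
have -> : \sum_i a j i * (\sum_k b i k * b' k l)
        = \sum_k (\sum_i a j i * b i k) * b' k l.
  under eq_bigr do rewrite mulr_sumr.
  rewrite exchange_big; apply: eq_bigr => k _ /=.
  by rewrite mulr_suml; apply: eq_bigr => i _; rewrite mulrA.
rewrite ltnS leq_eqVlt => /orP[/eqP->|jm]; first exact: b'0.
by apply: big1 => k _; rewrite ab // mul0r.
Qed.

Variable M : lmodType A.

Section Coordinates.
Variables (J : finType) (d : J -> N).
Definition with_coords (p : seq (M * (J -> A))) : seq (M * N) :=
  [seq (u.1, \sum_k u.2 k *: d k) | u <- p].
Definition coord_sum (p : seq (M * (J -> A))) (k : J) : M :=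
  \sum_(u <- p) u.2 k *: u.1.
End Coordinates.

Definition change_coords (J H : finType) (b : J -> H -> A)
    (p : seq (M * (J -> A))) : seq (M * (H -> A)) :=
  [seq (u.1, fun h => \sum_k u.2 k * b k h) | u <- p].

Lemma change_coordsE (J H : finType) (b : J -> H -> A) (d : J -> N) (e : H -> N) p :
  (forall k, d k = \sum_h b k h *: e h) ->
  with_coords e (change_coords b p) = with_coords d p.
Proof.
move=> dE; rewrite /with_coords /change_coords -map_comp; apply: eq_map => u /=.
congr (_, _); under eq_bigr do rewrite scaler_suml.
rewrite exchange_big; apply: eq_bigr => k _ /=.
by rewrite dE scaler_sumr; apply: eq_bigr => h _; rewrite scalerA.
Qed.

Lemma change_coords_sum (J H : finType) (b : J -> H -> A) p h :
  coord_sum (change_coords b p) h = \sum_k b k h *: coord_sum p k.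
Proof.
rewrite /coord_sum /change_coords big_map.
under eq_bigr do rewrite scaler_suml.
rewrite exchange_big; apply: eq_bigr => k _ /=.
by rewrite scaler_sumr; apply: eq_bigr => u _; rewrite scalerA mulrC.
Qed.

(** Two lists of tensors whose second factors have coordinates in common
    vectors d, for which the coefficients of each d_k in M agree. This implies
    equality in the tensor product; conversely it is implied by the defining
    congruence ([tens_rel_coord]). *)
Definition coord_equiv (s t : seq (M * N)) : Prop :=
  exists (J : finType) (d : J -> N) p p',
    [/\ s = with_coords d p, t = with_coords d p'
      & forall k, coord_sum p k = coord_sum p' k].

Lemma with_coords_exists (s : seq (M * N)) :
  exists (J : finType) (d : J -> N) p, s = with_coords d p.
Proof.
elim: s => [|[m n] s [J [d [p ->]]]]; first by exists void, (fun=> 0), [::].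
pose d' o := if o is Some k then d k else n.
exists (option J), d', ((m, fun k => (k == None)%:R) ::
   change_coords (fun k o => (o == Some k)%:R) p).
rewrite /with_coords /= -/(with_coords d' _) (@change_coordsE _ _ _ d) => [|k].
  congr ((_, _) :: _); rewrite (bigD1 None) //= scale1r big1 ?addr0 // => o.
  by move=> /negbTE ->; rewrite scale0r.
rewrite (bigD1 (Some k)) //= eqxx scale1r big1 ?addr0 // => o.
by move=> /negbTE ->; rewrite scale0r.
Qed.

Lemma coord_equiv_cat s s' t t' : coord_equiv s s' -> coord_equiv t t' ->
  coord_equiv (s ++ t) (s' ++ t').
Proof.
move=> [J [d [p [p' [-> -> pp']]]]] [J' [d' [u [u' [-> -> uu']]]]].
pose e k := match k with inl k => d k | inr k => d' k end.
pose bl (k : J) (o : J + J') : A := (o == inl k)%:R.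
pose br (k : J') (o : J + J') : A := (o == inr k)%:R.
have dl k : d k = \sum_h bl k h *: e h.
  rewrite (bigD1 (inl k)) //= /bl eqxx scale1r big1 ?addr0 // => o.
  by move=> /negbTE ->; rewrite scale0r.
have dr k : d' k = \sum_h br k h *: e h.
  rewrite (bigD1 (inr k)) //= /br eqxx scale1r big1 ?addr0 // => o.
  by move=> /negbTE ->; rewrite scale0r.
exists (J + J')%type, e, (change_coords bl p ++ change_coords br u),
  (change_coords bl p' ++ change_coords br u').
split=> [||k].
- by rewrite /with_coords map_cat -!/(with_coords _ _) (change_coordsE _ dl)
    (change_coordsE _ dr).
- by rewrite /with_coords map_cat -!/(with_coords _ _) (change_coordsE _ dl)
    (change_coordsE _ dr).
rewrite /coord_sum !big_cat -!/(coord_sum _ _) /= !change_coords_sum.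
by congr (_ + _); apply: eq_bigr => o _; rewrite (pp', uu').
Qed.

(** The middle list has coordinates in two systems d and d'; their comparison
    is a list of relations between d and d', and flatness of N yields a third
    system in which these relations hold between coordinates. *)
Lemma coord_equiv_trans s t u :
  coord_equiv s t -> coord_equiv t u -> coord_equiv s u.
Proof.
move=> [J [d [p [p1 [-> tE pp]]]]] [J' [d' [p2 [p' [tE' -> pp']]]]].
pose e k := match k with inl k => d k | inr k => d' k end.
have szE : size p2 = size p1.
  by have := congr1 size tE; rewrite tE' /with_coords !size_map.
pose x1 : M * (J -> A) := (0, fun=> 0).
pose x2 : M * (J' -> A) := (0, fun=> 0).
pose a j (k : J + J') : A := match k with
  inl k => (nth x1 p1 j).2 k | inr k => - (nth x2 p2 j).2 k end.
have tj j : (j < size p1)%N -> (nth x1 p1 j).1 = (nth x2 p2 j).1 /\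
    \sum_k (nth x1 p1 j).2 k *: d k = \sum_k (nth x2 p2 j).2 k *: d' k.
  move=> jp; have := congr1 (fun l => nth (0, 0) l j) tE.
  rewrite tE' /with_coords (nth_map x1) // (nth_map x2) ?szE //.
  by case=> -> ->.
have [|H [b [h [eE ab]]]] := @eq_flat_system _ (size p1) a e.
  move=> j jp; rewrite big_sumType /=.
  have [_ ->] := tj j jp; rewrite -big_split big1 // => k _.
  by rewrite /= scaleNr subrr.
exists H, h, (change_coords (fun k => b (inl k)) p),
  (change_coords (fun k => b (inr k)) p').
have hl k := eE (inl k); have hr k := eE (inr k).
split; rewrite ?(change_coordsE _ hl) ?(change_coordsE _ hr) // => k.
have -> : coord_sum (change_coords (fun k => b (inl k)) p) k
        = coord_sum (change_coords (fun k => b (inl k)) p1) k.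
  by rewrite !change_coords_sum; apply: eq_bigr => o _; rewrite pp.
have -> : coord_sum (change_coords (fun k => b (inr k)) p') k
        = coord_sum (change_coords (fun k => b (inr k)) p2) k.
  by rewrite !change_coords_sum; apply: eq_bigr => o _; rewrite pp'.
rewrite /coord_sum /change_coords !big_map (big_nth x1) (big_nth x2) szE.
rewrite !big_mkord; apply: eq_bigr => j _ /=.
have [-> _] := tj j (ltn_ord j); congr (_ *: _).
have := ab j k (ltn_ord j); rewrite big_sumType /=.
under [X in _ + X]eq_bigr do rewrite mulNr.
by rewrite sumrN => /eqP; rewrite subr_eq0 => /eqP.
Qed.

Lemma tens_rel_coord s t : tens_rel s t -> coord_equiv s t.
Proof.
elim=> {s t}.
- move=> s; have [J [d [p ->]]] := with_coords_exists s.
  by exists J, d, p, p.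
- move=> s t _ [J [d [p [p' [-> -> pp']]]]]; exists J, d, p', p.
  by split=> // k; rewrite pp'.
- by move=> s t u _ + _; apply: coord_equiv_trans.
- by move=> s s' t t' _ + _; apply: coord_equiv_cat.
- move=> s t; have [J [d [p E]]] := with_coords_exists (s ++ t).
  exists J, d, p, (drop (size s) p ++ take (size s) p); split=> // [|k].
    rewrite /with_coords map_cat map_drop map_take -/(with_coords d p) -E.
    by rewrite drop_size_cat // take_size_cat.
  by rewrite -{1}(cat_take_drop (size s) p) /coord_sum !big_cat /= addrC.
- move=> m m' n; exists unit, (fun=> n), [:: (m + m', fun=> 1)],
    [:: (m, fun=> 1); (m', fun=> 1)].
  have E : n = \sum_(k : unit) 1 *: n.
    by rewrite (bigD1 tt) //= scale1r big1 ?addr0 // => -[].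
  split; rewrite /with_coords /= -?E // => k.
  by rewrite /coord_sum !(big_cons, big_nil) !scale1r !addr0.
- move=> m n n'; exists bool, (fun b => if b then n else n'),
    [:: (m, fun=> 1)], [:: (m, fun b : bool => (b : nat)%:R); (m, fun b : bool => (~~ b : nat)%:R)].
  split; rewrite /with_coords /= ?big_bool /= ?scale1r ?scale0r ?addr0 ?add0r //.
  by case; rewrite /coord_sum !(big_cons, big_nil) /= !scale1r !scale0r !addr0 ?add0r.
- exists unit, (fun=> 0), [:: (0, fun=> 0)], [::]; split; rewrite /with_coords //=.
    by rewrite big1 // => k _; rewrite scale0r.
  by move=> k; rewrite /coord_sum !(big_cons, big_nil) scaler0 addr0.
- move=> a m n; exists unit, (fun=> n), [:: (a *: m, fun=> 1)], [:: (m, fun=> a)].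
  have E b : b *: n = \sum_(k : unit) b *: n.
    by rewrite (bigD1 tt) //= big1 ?addr0 // => -[].
  split; rewrite /with_coords /= -?E ?scale1r // => k.
  by rewrite /coord_sum !(big_cons, big_nil) !addr0 scale1r.
Qed.

(** A vanishing sum of tensors vanishes for a visible reason when the second
    module is flat: the n_i are combinations of vectors d_k whose total
    coefficients in M are zero. *)
Lemma tens_eq0 (I : finType) (m : I -> M) (n : I -> N) :
  \sum_i pure (m i) (n i) = 0 ->
  exists (J : finType) (b : I -> J -> A) (d : J -> N),
    (forall i, n i = \sum_k b i k *: d k) /\ forall k, \sum_i b i k *: m i = 0.
Proof.
have -> : \sum_i pure (m i) (n i) = tens_of [seq (m i, n i) | i : I].
  by rewrite tens_ofE big_map big_enum.
move/(tens_ofP _ [::])/tens_rel_coord => [J [d [p [p' [E E' p0]]]]].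
have {E'} p'0 : p' = [::] by case: p' E' {p0}.
pose x : M * (J -> A) := (0, fun=> 0).
have sz : size p = #|I| by have := congr1 size E; rewrite size_image size_map => ->.
pose b (i : I) := (nth x p (enum_rank i)).2.
have Ei i : m i = (nth x p (enum_rank i)).1 /\ n i = \sum_k b i k *: d k.
  have ip : (enum_rank i < size p)%N by rewrite sz.
  have := congr1 (fun l => nth (0, 0) l (enum_rank i)) E.
  rewrite /with_coords (nth_map x) // (nth_map i) -?cardE //.
  by rewrite nth_enum_rank => -[-> ->].
exists J, b, d; split=> [i|k]; first by case: (Ei i).
have := p0 k; rewrite p'0 /coord_sum big_nil (big_nth x) big_mkord => e0.
rewrite -[RHS]e0.
rewrite (reindex (fun i : I => cast_ord (esym sz) (enum_rank i))) /=.
  by apply: eq_bigr => i _; rewrite -(Ei i).1.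
exists (fun j => enum_val (cast_ord sz j)) => j _.
  by rewrite cast_ordKV enum_rankK.
by rewrite enum_valK cast_ordK.
Qed.

End Equational.

Lemma pure0l (A : comPzRingType) (M N : lmodType A) (n : N) : pure (0 : M) n = 0.
Proof. by apply: (addIr (pure 0 n)); rewrite -pureDl !add0r. Qed.

Lemma pure0r (A : comPzRingType) (M N : lmodType A) (m : M) : pure m (0 : N) = 0.
Proof. by apply: (addIr (pure m 0)); rewrite -pureDr !add0r. Qed.

Lemma eq_flat_flat (A B : comPzRingType) (f : {rmorphism A -> B}) :
  eq_flat (restr f) -> flat f.
Proof.
move=> ef M N g g_inj x x'.
have gb : balanced (fun (m : M) (n : restr f) => pure (g m) n).
  split=> [m m' n|m n n'|a m n]; rewrite ?raddfD ?linearZ ?pureDl ?pureDr //.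
  exact: pureZ.
have : forall z : tens M (restr f), tens_map g z = 0 -> z = 0; last first.
  move=> h e; apply/eqP; rewrite -subr_eq0; apply/eqP/h.
  rewrite /tens_map (tens_liftD gb); apply: (addIr (tens_map g x')).
  rewrite add0r -addrA -[X in _ + X](tens_liftD gb) addNr (tens_lift0 gb).
  by rewrite addr0.
move=> z; rewrite (tensE z); set s := repr z; pose x0 : M * restr f := (0, 0).
rewrite (big_nth x0) big_mkord => z0.
have : \sum_(i < size s) pure (g (nth x0 s i).1) (nth x0 s i).2 = 0.
  rewrite -z0 /tens_map; elim/big_rec2: _ => [|i u v _ ->].
    by rewrite (tens_lift0 gb).
  by rewrite (tens_liftD gb) (tens_lift_pure gb).
move/(tens_eq0 ef) => [J [b [d [nE m0]]]].
have bz k : \sum_i b i k *: (nth x0 s i).1 = 0.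
  apply: g_inj; rewrite raddf0 raddf_sum -[RHS](m0 k).
  by apply: eq_bigr => i _; rewrite /= linearZ.
transitivity (\sum_k pure (\sum_i b i k *: (nth x0 s i).1) (d k)); last first.
  by apply: big1 => k _; rewrite bz pure0l.
transitivity (\sum_i \sum_k pure (b i k *: (nth x0 s i).1) (d k)).
  apply: eq_bigr => i _; rewrite nE.
  rewrite (big_morph (pure _) (pureDr _) (pure0r _ _)).
  by apply: eq_bigr => k _; rewrite pureZ.
rewrite exchange_big; apply: eq_bigr => k _ /=.
by rewrite (big_morph (fun m => pure m (d k)) (fun m m' => pureDl m m' _) (pure0l _ _)).
Qed.

(** * Flatness over a valuation ring and over alpha_p *)

Definition valuation_ring (S : idomainType) : Prop :=
  forall a b : S, (exists c, b = c * a) \/ (exists c, a = c * b).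

Definition torsion_free (S : idomainType) (B : comPzRingType)
    (f : {rmorphism S -> B}) : Prop :=
  forall s b, s != 0 -> f s * b = 0 -> b = 0.

Lemma restr_scaleE (A B : comPzRingType) (f : {rmorphism A -> B}) (a : A)
  (b : restr f) : a *: b = f a * b :> B.
Proof. by []. Qed.

Lemma valuation_ring_min (S : idomainType) (I : finType) (a : I -> S) :
  valuation_ring S -> (forall i, a i = 0) \/
  exists i0, a i0 != 0 /\ forall i, exists t, a i = t * a i0.
Proof.
move=> hS; suff: forall s : seq I, (forall i, i \in s -> a i = 0) \/
  exists i0, a i0 != 0 /\ forall i, i \in s -> exists t, a i = t * a i0.
  move=> /(_ (enum I)) [h|[i0 [i0n h]]]; [left=> i|right].
    by apply: h; rewrite mem_enum.
  by exists i0; split=> // i; apply: h; rewrite mem_enum.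
elim=> [|i s [IH|[i0 [i0n IH]]]]; first by left.
  have [ai|ai] := eqVneq (a i) 0.
    by left=> j; rewrite inE => /predU1P[->|/IH].
  right; exists i; split=> // j; rewrite inE => /predU1P[->|/IH ->].
    by exists 1; rewrite mul1r.
  by exists 0; rewrite mul0r.
right; have [[t E]|[t E]] := hS (a i0) (a i).
  exists i0; split=> // j; rewrite inE => /predU1P[->|/IH //].
  by exists t.
exists i; split.
  by apply: contra_neq i0n => ai; rewrite E ai mulr0.
move=> j; rewrite inE => /predU1P[->|/IH [u ->]]; first by exists 1; rewrite mul1r.
by exists (u * t); rewrite E mulrA.
Qed.

(** In a relation sum_i a_i c_i = 0 some coefficient a_i0 divides the others;
    cancelling it expresses c_i0 by the other c_i. *)
Lemma torsion_free_eq_flat (S : idomainType) (B : comPzRingType)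
    (f : {rmorphism S -> B}) :
  valuation_ring S -> torsion_free f -> eq_flat (restr f).
Proof.
move=> hS tf I a c ac; have [a0|[i0 [i0n]]] := valuation_ring_min a hS.
  exists I, (fun i k => (i == k)%:R), c; split=> [i|k]; last first.
    by rewrite big1 // => i _; rewrite a0 mul0r.
  rewrite (bigD1 i) //= eqxx scale1r big1 ?addr0 // => k.
  by rewrite eq_sym => /negbTE ->; rewrite scale0r.
move=> /fin_all_exists[t tE].
have t0 : t i0 = 1.
  by apply: (mulIf i0n); rewrite -tE mul1r.
have tc : \sum_i t i *: c i = 0.
  apply: (tf (a i0)) => //; rewrite -[LHS]restr_scaleE scaler_sumr -[RHS]ac.
  by apply: eq_bigr => i _; rewrite scalerA mulrC -tE.
exists I, (fun i k => (i == k)%:R - (i == i0)%:R * t k), c; split=> [i|k].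
  under eq_bigr do rewrite scalerBl -scalerA.
  rewrite sumrB -scaler_sumr tc scaler0 subr0.
  rewrite (bigD1 i) //= eqxx scale1r big1 ?addr0 // => k.
  by rewrite eq_sym => /negbTE ->; rewrite scale0r.
under eq_bigr do rewrite mulrBr.
rewrite sumrB (bigD1 k) //= eqxx mulr1 big1 ?addr0; last first.
  by move=> i /negbTE ->; rewrite mulr0.
rewrite (bigD1 i0) //= eqxx mul1r big1 ?addr0; last first.
  by move=> i /negbTE ->; rewrite mul0r mulr0.
by rewrite (tE k) mulrC subrr.
Qed.

Section AlphaRing.
Variables (S : comNzRingType) (p : nat).
Local Notation A := {poly %/ 'X^p : {poly S}}.

Definition alpha_x : A := in_qpoly 'X^p 'X.

Lemma alpha_xX n : alpha_x ^+ n = in_qpoly 'X^p 'X^n.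
Proof. by rewrite rmorphXn. Qed.

Lemma alpha_x_nil : (0 < p)%N -> alpha_x ^+ p = 0.
Proof.
move=> p0; rewrite alpha_xX; apply: val_inj => /=.
by rewrite mk_monic_Xn prednK // Pdiv.RingMonic.rmodpp ?monicXn.
Qed.

Lemma alpha_in_polyC (s : S) : in_qpoly 'X^p s%:P = alpha_str p s.
Proof.
apply: val_inj; rewrite [LHS]in_qpoly_small ?qpolyCE //.
by rewrite size_polyC; apply: leq_ltn_trans (size_mk_monic_gt1 _); case: eqP.
Qed.

Lemma alpha_decomp (a : A) :
  exists a', a = alpha_str p (alpha_ev0 a) + alpha_x * a'.
Proof.
have : root (polyn a - ((polyn a).[0])%:P) 0.
  by rewrite rootE hornerD hornerN hornerC subrr.
case/factor_theorem => u uE; exists (in_qpoly 'X^p u).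
rewrite -[LHS]in_qpolyK.
have -> : polyn a = ((polyn a).[0])%:P + 'X * u.
  by move: uE; rewrite subr0 commr_polyX => <-; rewrite addrC subrK.
by rewrite rmorphD rmorphM /= alpha_in_polyC.
Qed.

Lemma alpha_ev0_str (s : S) : alpha_ev0 (alpha_str p s) = s.
Proof. by rewrite /alpha_ev0 /= hornerC. Qed.

Lemma alpha_ev0_x : (1 < p)%N -> alpha_ev0 alpha_x = 0.
Proof.
move=> p1; rewrite /alpha_ev0 /alpha_x in_qpoly_small ?hornerX //.
by rewrite mk_monic_Xn size_polyX size_polyXn; case: p p1 => [|[]].
Qed.

End AlphaRing.
Arguments alpha_x : clear implicits.

Section AlphaFlat.
Variables (S : idomainType) (p : nat) (C B : comPzRingType).
Local Notation A := {poly %/ 'X^p : {poly S}}.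
Variables (f : {rmorphism A -> C}) (g : {rmorphism S -> B}) (q : {rmorphism C -> B}).
Hypotheses (p_gt0 : (0 < p)%N) (hS : valuation_ring S) (tf : torsion_free g).
Hypothesis q_surj : forall b, exists c, q c = b.
Hypothesis qf : forall a, q (f a) = g (alpha_ev0 a).
Local Notation z := (f (alpha_x S p)).
Hypothesis q_ker : forall c, q c = 0 -> exists c', c = z * c'.
Hypothesis q_ann : forall c, z ^+ p.-1 * c = 0 -> q c = 0.

(** If z^(p-1) kills only multiples of z, then the annihilator of z consists
    of the multiples of z^(p-1), as in a free module. *)
Lemma ann_x (v : C) n : z * v = 0 -> (n < p)%N -> exists w, v = z ^+ n * w.
Proof.
move=> zv; elim: n => [|n IH] np; first by exists v; rewrite mul1r.
have [w vE] := IH (ltnW np).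
have /q_ker[w' wE] : q w = 0.
  apply: q_ann; have -> : p.-1 = (p.-1 - n.+1 + n.+1)%N by rewrite subnK // -ltnS prednK.
  by rewrite exprD -mulrA exprS -mulrA -vE zv mulr0.
by exists w'; rewrite vE wE exprSr mulrA.
Qed.

(** The local criterion of flatness for the nilpotent ideal (x), by equations
    and by induction on j. Modulo x the relation lives in the torsion-free
    algebra B and is explained by scalars r_ik; lifting these, the c_i differ
    from combinations of lifts F_k by elements z c'_i, and one factor z can be
    cancelled from the relation, which is then a relation modulo z^j between
    the F_k and the c'_i. *)
Lemma alpha_relation (j : nat) (I : finType) (a : I -> A) (c : I -> C) :
  (j <= p)%N -> (exists w, \sum_i f (a i) * c i = z ^+ j * w) ->
  exists (J : finType) (b : I -> J -> A) (d : J -> C),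
    (forall i, c i = \sum_k f (b i k) * d k) /\
    forall k, exists w, \sum_i a i * b i k = alpha_x S p ^+ j * w.
Proof.
elim: j I a c => [|j IH] I a c jp.
  move=> _; exists I, (fun i k => (i == k)%:R), c; split=> [i|k].
    rewrite (bigD1 i) //= eqxx rmorph1 mul1r big1 ?addr0 // => k.
    by rewrite eq_sym => /negbTE ->; rewrite rmorph0 mul0r.
  by exists (\sum_i a i * (i == k)%:R); rewrite mul1r.
case=> w acE.
(* For p = 1 the ring is S and x = 0. *)
have qz : q z = 0.
  have [p1|] := ltnP 1 p; first by rewrite qf alpha_ev0_x // rmorph0.
  move=> p1; have {p1} p1 : p = 1%N by apply/eqP; rewrite eqn_leq p1.
  rewrite qf -[alpha_x S p]expr1; have -> : 1%N = p by [].
  by rewrite alpha_x_nil // raddf0 rmorph0.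
have := @torsion_free_eq_flat _ _ g hS tf I (fun i => alpha_ev0 (a i)) (fun i => q (c i)).
case=> [|J [r [e [eE r0]]]].
  transitivity (q (\sum_i f (a i) * c i)); last first.
    by rewrite acE exprS !rmorphM /= qz !mul0r.
  by rewrite rmorph_sum; apply: eq_bigr => i _; rewrite rmorphM /= qf.
have /fin_all_exists[F FE] : forall k : J, exists u, q u = e k by move=> k; apply: q_surj.
have /fin_all_exists[c' c'E] : forall i, exists u,
    c i = \sum_k f (alpha_str p (r i k)) * F k + z * u.
  move=> i; have [|u uE] := @q_ker (c i - \sum_k f (alpha_str p (r i k)) * F k).
    rewrite rmorphB rmorph_sum /= eE; apply/eqP; rewrite subr_eq0; apply/eqP.
    by apply: eq_bigr => k _; rewrite rmorphM /= qf alpha_ev0_str FE.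
  by exists u; rewrite -uE addrC subrK.
have /fin_all_exists[al alE] : forall k : J, exists u,
    \sum_i a i * alpha_str p (r i k) = alpha_x S p * u.
  move=> k; have [u uE] := alpha_decomp (\sum_i a i * alpha_str p (r i k)).
  exists u; rewrite [LHS]uE rmorph_sum -[RHS]add0r; congr (_ + _).
  rewrite -[RHS](rmorph0 (@alpha_str S p)) /=; congr alpha_str; rewrite -[RHS](r0 k).
  by apply: eq_bigr => i _; rewrite rmorphM /= alpha_ev0_str.
have zE : z * (\sum_k f (al k) * F k + \sum_i f (a i) * c' i - z ^+ j * w) = 0.
  rewrite mulrBr mulrA -exprS -acE mulrDr; apply/eqP; rewrite subr_eq0; apply/eqP.
  under [in RHS]eq_bigr => i _ do rewrite c'E mulrDr mulr_sumr.
  rewrite big_split exchange_big /= !mulr_sumr; congr (_ + _); apply: eq_bigr.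
    move=> k _; rewrite mulrA -rmorphM -alE rmorph_sum mulr_suml.
    by apply: eq_bigr => i _; rewrite rmorphM mulrA.
  by move=> i _; rewrite mulrCA.
have [w' w'E] := ann_x zE jp.
pose a2 o := match o with inl k => al k | inr i => a i end.
pose c2 o := match o with inl k => F k | inr i => c' i end.
have [|H [b [d [dE bE]]]] := IH (J + I)%type a2 c2 (ltnW jp).
  exists (w + w'); rewrite big_sumType /= mulrDr -w'E.
  by rewrite [RHS]addrC subrK.
exists H, (fun i h => \sum_k alpha_str p (r i k) * b (inl k) h
                      + alpha_x S p * b (inr i) h), d.
split=> [i|h].
  rewrite c'E -[c' i]/(c2 (inr i)) dE.
  under eq_bigr => k _ do rewrite -[F k]/(c2 (inl k)) dE mulr_sumr.
  rewrite exchange_big mulr_sumr -big_split; apply: eq_bigr => h _ /=.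
  rewrite rmorphD rmorphM rmorph_sum mulrDl mulr_suml -mulrA; congr (_ + _).
  by apply: eq_bigr => k _; rewrite rmorphM mulrA.
have [u uE] := bE h; exists u; rewrite exprS -mulrA -uE big_sumType /= mulrDr.
under eq_bigr do rewrite mulrDr.
rewrite big_split !mulr_sumr; congr (_ + _) => /=; last first.
  by apply: eq_bigr => i _; rewrite mulrCA.
under eq_bigr do rewrite mulr_sumr.
rewrite exchange_big; apply: eq_bigr => k _ /=; rewrite mulrA -alE mulr_suml.
by apply: eq_bigr => i _; rewrite mulrA.
Qed.

Lemma alpha_eq_flat : eq_flat (restr f).
Proof.
move=> I a c ac; have [|J [b [d [cE bE]]]] := @alpha_relation p I a c (leqnn p).
  by exists 0; rewrite mulr0.
exists J, b, d; split=> // k; have [w ->] := bE k.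
by rewrite alpha_x_nil // mul0r.
Qed.

End AlphaFlat.

Section AlphaLift.
Variables (S : comNzRingType) (p : nat) (X : aff S) (z : ring_of X).
Hypotheses (p_gt0 : (0 < p)%N) (zp : z ^+ p = 0).
Local Notation A := {poly %/ 'X^p : {poly S}}.
Local Notation str := (str_map X).

(** Evaluation at z. Polynomials over the coordinate ring of X would exclude
    the zero ring, hence the explicit sum. *)
Definition poly_at (P : {poly S}) : ring_of X := \sum_(j < size P) str P`_j * z ^+ j.

Lemma poly_atE n (P : {poly S}) : (size P <= n)%N -> poly_at P = \sum_(j < n) str P`_j * z ^+ j.
Proof.
move=> Pn; rewrite /poly_at (big_ord_widen _ (fun j => str P`_j * z ^+ j) Pn).
rewrite big_mkcond; apply: eq_bigr => j _; case: ltnP => // Pj.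
by rewrite nth_default // rmorph0 mul0r.
Qed.

Lemma poly_at_zmod : zmod_morphism poly_at.
Proof.
move=> P Q; pose n := maxn (size P) (size Q).
have szB : (size (P - Q)%R <= n)%N.
  by apply: leq_trans (size_polyD _ _) _; rewrite size_polyN.
rewrite !(@poly_atE n) ?leq_maxl ?leq_maxr // -sumrB; apply: eq_bigr => j _.
by rewrite coefB rmorphB mulrBl.
Qed.
HB.instance Definition _ := GRing.isZmodMorphism.Build {poly S} (ring_of X) poly_at poly_at_zmod.

Lemma poly_atC s : poly_at s%:P = str s.
Proof. by rewrite (@poly_atE 1) ?size_polyC_leq1 // big_ord1 coefC mulr1. Qed.

Lemma poly_atMX P : poly_at (P * 'X) = poly_at P * z.
Proof.
rewrite (@poly_atE (size P).+1); last first.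
  by apply: leq_trans (size_polyMleq _ _) _; rewrite size_polyX addn2.
rewrite big_ord_recl coefMX rmorph0 mul0r add0r mulr_suml; apply: eq_bigr => j _.
by rewrite coefMX /= exprSr mulrA.
Qed.

Lemma poly_at_monoid : monoid_morphism poly_at.
Proof.
split=> [|P Q]; first by rewrite -[1]/(1%:P) poly_atC rmorph1.
elim/poly_ind: P => [|P s IH]; first by rewrite mul0r raddf0 mul0r.
rewrite mulrDl !raddfD /= mulrDl; congr (_ + _).
  by rewrite -mulrA -commr_polyX mulrA !poly_atMX IH mulrAC.
rewrite poly_atC; elim/poly_ind: Q {IH} => [|Q t IH].
  by rewrite mulr0 !raddf0 mulr0.
by rewrite mulrDr !raddfD /= mulrA !poly_atMX IH -polyCM !poly_atC rmorphM mulrDr mulrA.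
Qed.
HB.instance Definition _ := GRing.isMonoidMorphism.Build {poly S} (ring_of X) poly_at poly_at_monoid.

Definition alpha_at (a : A) : ring_of X := poly_at (polyn a).

Lemma alpha_at_in (P : {poly S}) : alpha_at (in_qpoly 'X^p P) = poly_at P.
Proof.
have mon := monic_mk_monic ('X^p : {poly S}).
rewrite /alpha_at /= [in RHS](Pdiv.RingMonic.rdivp_eq mon P) rmorphD rmorphM /=.
rewrite [X in _ * X](_ : _ = 0) ?mulr0 ?add0r //.
rewrite mk_monic_Xn prednK // rmorphXn /=.
by rewrite -['X]mul1r poly_atMX rmorph1 mul1r.
Qed.

Lemma alpha_at_zmod : zmod_morphism alpha_at.
Proof. by move=> a b; rewrite /alpha_at /= rmorphB. Qed.
Lemma alpha_at_monoid : monoid_morphism alpha_at.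
Proof.
split=> [|a b]; first by rewrite -(in_qpoly1 'X^p) alpha_at_in rmorph1.
by rewrite -[a * b]/(in_qpoly 'X^p (polyn a * polyn b)) alpha_at_in rmorphM.
Qed.
HB.instance Definition _ := GRing.isZmodMorphism.Build A (ring_of X) alpha_at alpha_at_zmod.
HB.instance Definition _ := GRing.isMonoidMorphism.Build A (ring_of X) alpha_at alpha_at_monoid.

Lemma alpha_at_str s : alpha_at (str_map (alpha S p) s) = str s.
Proof. by rewrite -[str_map _ s]alpha_in_polyC alpha_at_in poly_atC. Qed.

Definition alpha_lift : mor X (alpha S p) :=
  @Mor S X (alpha S p) (alpha_at : {rmorphism A -> ring_of X}) alpha_at_str.

Lemma alpha_lift_x : pb alpha_lift (alpha_x S p) = z.
Proof. by rewrite [LHS]alpha_at_in -['X]mul1r poly_atMX rmorph1 mul1r. Qed.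
End AlphaLift.

Lemma alpha_ext (S : comNzRingType) (p : nat) (C : comPzRingType)
    (f g : {rmorphism {poly %/ 'X^p : {poly S}} -> C}) :
  (forall s, f (alpha_str p s) = g (alpha_str p s)) ->
  f (alpha_x S p) = g (alpha_x S p) -> f =1 g.
Proof.
move=> fgs fgx a; rewrite (qpoly_expand a) !rmorph_sum; apply: eq_bigr => j _.
by rewrite !rmorphM !rmorphXn /= fgs -/(alpha_x S p) fgx.
Qed.

Lemma alpha_mor_ext (S : comNzRingType) (p : nat) (X : aff S) (u v : mor X (alpha S p)) :
  pb u (alpha_x S p) = pb v (alpha_x S p) -> u = v.
Proof.
move=> uv; apply: mor_eq; apply: alpha_ext => // s.
by rewrite -[alpha_str p s]/(str_map (alpha S p) s) !pbE.
Qed.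

(** * Maximal submodules, valuation rings and noetherian subrings *)

Definition is_submod (S B : comPzRingType) (f : {rmorphism S -> B}) (N : B -> Prop) :=
  [/\ N 0, forall x y, N x -> N y -> N (x + y) & forall s x, N x -> N (f s * x)].

(** With S = B and e = 1 this gives maximal ideals, with S a field it gives
    hyperplanes, hence linear functionals. *)
Lemma maximal_submod (S B : comPzRingType) (f : {rmorphism S -> B})
    (N0 : B -> Prop) (e : B) :
  is_submod f N0 -> ~ N0 e ->
  exists N : B -> Prop, [/\ is_submod f N, forall x, N0 x -> N x, ~ N e
    & forall c, ~ N c -> exists s n, N n /\ e = n + f s * c].
Proof.
move=> N0mod N0e.
(* N0 is joined to every candidate so that the empty chain is bounded. *)
pose ext (A : set B) : B -> Prop := fun x => N0 x \/ A x.
pose P : set (set B) := fun A => is_submod f (ext A) /\ ~ ext A e.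
have [F FP Ftot|A [[Amod Ae] Amax]] := @Zorn_bigcup B P.
  have [n0 nD nZ] := N0mod.
  have up X x : F X -> ext X x -> ext (\bigcup_(X in F) X)%classic x.
    by move=> FX [Nx|Xx]; [left|right; exists X].
  have low x : ext (\bigcup_(X in F) X)%classic x -> N0 x \/ exists2 X, F X & ext X x.
    by case=> [Nx|[X FX Xx]]; [left|right; exists X => //; right].
  split; last first.
    case=> [//|[X FX Xe]]; have [_] := FP X FX; apply; by right.
  split=> [|x y /low hx /low hy|s x /low [Nx|[X FX Xx]]]; first by left.
  - case: hx hy => [Nx|[X FX Xx]] [Ny|[Y FY Yy]].
    + by left; apply: nD.
    + by have [[_ XD _] _] := FP Y FY; apply: (up Y) => //; apply: XD => //; left.
    + by have [[_ XD _] _] := FP X FX; apply: (up X) => //; apply: XD => //; left.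
    + have [XY|YX] := Ftot X Y FX FY.
        have [[_ XD _] _] := FP Y FY; apply: (up Y) => //; apply: XD => //.
        by case: Xx => [|/XY]; [left|right].
      have [[_ XD _] _] := FP X FX; apply: (up X) => //; apply: XD => //.
      by case: Yy => [|/YX]; [left|right].
  - by left; apply: nZ.
  - by have [[_ _ XZ] _] := FP X FX; apply: (up X) => //; apply: XZ.
exists (ext A); split=> // [x Nx|c Ac]; first by left.
apply: contrapT => noe.
have [A0 AD AZ] := Amod.
pose Bc : set B := fun x => exists s n, ext A n /\ x = n + f s * c.
apply: (Amax Bc).
  split=> [x Ax|BA].
    by exists 0, x; split; [right|rewrite rmorph0 mul0r addr0].
  by apply: Ac; right; apply: BA; exists 1, 0; rewrite rmorph1 mul1r add0r.
have extB x : ext Bc x -> Bc x.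
  case=> // Nx; exists 0, x; split; [by left|by rewrite rmorph0 mul0r addr0].
split; last by move/extB.
split=> [|x y /extB [s [n [An ->]]] /extB [s' [n' [An' ->]]]|s x /extB [s' [n' [An' ->]]]].
- by left; case: N0mod.
- right; exists (s + s'), (n + n'); split; first exact: AD.
  by rewrite rmorphD mulrDl addrACA.
- right; exists (s * s'), (f s * n'); split; first exact: AZ.
  by rewrite rmorphM mulrDr mulrA.
Qed.

Lemma nonunit_prime (R : idomainType) (a : R) :
  ~ (exists b, b * a = 1) -> exists2 Q : R -> Prop, is_prime Q & Q a.
Proof.
move=> na; pose N0 x := exists b, x = b * a.
have [|[b /esym ba]|N [[N0' ND NZ] NN N1 Nmax]] :=
  @maximal_submod R R (@idfun R : {rmorphism R -> R}) N0 1.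
- split=> [|x y [b ->] [b' ->]|s x [b ->]]; first by exists 0; rewrite mul0r.
    by exists (b + b'); rewrite mulrDl.
  by exists (s * b); rewrite /= mulrA.
- by apply: na; exists b.
exists N; last by apply: NN; exists 1; rewrite mul1r.
split=> // x y Nxy; apply: contrapT => /not_orP[/Nmax [s [n [Nn e1]]] /Nmax [t [m [Nm e2]]]].
apply: N1; rewrite -[1]mulr1 {1}e1 e2 mulrDl /=.
apply: (ND); first by rewrite mulrC; apply: NZ.
rewrite mulrDr; apply: ND; first exact: NZ.
by rewrite mulrACA; apply: NZ.
Qed.

(** Divide a and b by a generator g of (a, b): the quotients a' and b'
    generate the unit ideal. If neither is a unit they are nonzero and each
    lies in a prime ideal; both primes are the unique nonzero one, which would
    contain 1. *)
Lemma dvr_valuation_ring (R : idomainType) : is_dvr R -> valuation_ring R.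
Proof.
move=> [pid [P [Pprime _ Puniq]]] a b.
have [|g gE] := pid (fun x => exists u v, x = u * a + v * b).
  split=> [|x y [u [v ->]] [u' [v' ->]]|c x [u [v ->]]].
  - by exists 0, 0; rewrite !mul0r addr0.
  - by exists (u + u'), (v + v'); rewrite !mulrDl addrACA.
  - by exists (c * u), (c * v); rewrite mulrDr !mulrA.
have [a' aE] : exists a', a = a' * g.
  by apply/gE; exists 1, 0; rewrite mul1r mul0r addr0.
have [b' bE] : exists b', b = b' * g.
  by apply/gE; exists 0, 1; rewrite mul1r mul0r add0r.
have [u [v gE']] : exists u v, g = u * a + v * b.
  by apply/gE; exists 1; rewrite mul1r.
have [g0|g0] := eqVneq g 0.
  by left; exists 0; rewrite bE g0 mulr0 mul0r.
have uv1 : u * a' + v * b' = 1.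
  by apply: (mulIf g0); rewrite mul1r [RHS]gE' aE bE mulrDl !mulrA.
have [[c ca]|na] := pselect (exists c, c * a' = 1).
  by left; exists (b' * c); rewrite aE mulrA -[_ * c * a']mulrA ca mulr1.
have [[c cb]|nb] := pselect (exists c, c * b' = 1).
  by right; exists (a' * c); rewrite bE mulrA -[_ * c * b']mulrA cb mulr1.
have [Q Qp Qa] := nonunit_prime na; have [Q' Qp' Qb] := nonunit_prime nb.
have a'0 : a' != 0.
  apply/eqP => a0; apply: nb; exists v.
  by rewrite a0 mulr0 add0r in uv1.
have b'0 : b' != 0.
  apply/eqP => b0; apply: na; exists u.
  by rewrite b0 mulr0 addr0 in uv1.
have Pa : P a' by apply/(Puniq Q) => //; exists a'.
have Pb : P b' by apply/(Puniq Q') => //; exists b'.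
case: Pprime => -[_ PD PZ] P1 _; case: P1; rewrite -uv1.
by apply: PD; apply: PZ.
Qed.

Definition is_subring (C : comPzRingType) (D : C -> Prop) : Prop :=
  [/\ D 1, forall x y, D x -> D y -> D (x - y) & forall x y, D x -> D y -> D (x * y)].

Section Subring.
Variables (C : comPzRingType) (D : C -> Prop).
Hypothesis hD : is_subring D.
Lemma subring0 : D 0. Proof. by case: hD => D1 DB _; rewrite -(subrr 1); apply: DB. Qed.
Lemma subringD x y : D x -> D y -> D (x + y).
Proof.
case: (hD) => _ DB _ Dx Dy; rewrite -[y]opprK; apply: (DB) => //.
by rewrite -sub0r; apply: DB => //; apply: subring0.
Qed.
Lemma subringX x n : D x -> D (x ^+ n).
Proof.
case: hD => D1 _ DM Dx; elim: n => [//|n IH]; rewrite exprS; exact: DM.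
Qed.
Lemma subring_sum (I : finType) (F : I -> C) : (forall i, D (F i)) -> D (\sum_i F i).
Proof. by move=> DF; apply: big_ind => //; [apply: subring0|apply: subringD]. Qed.
End Subring.

Section Noetherian.
Variable C : comPzRingType.

Definition rel_ideal (D I : C -> Prop) : Prop :=
  [/\ I 0, forall x y, I x -> I y -> I (x + y) & forall a x, D a -> I x -> I (a * x)].

Definition ideal_gen (D : C -> Prop) (s : seq C) (x : C) : Prop :=
  forall I, rel_ideal D I -> (forall g, g \in s -> I g) -> I x.

Definition noetherian (D : C -> Prop) : Prop :=
  forall I, rel_ideal D I -> (forall x, I x -> D x) ->
  exists s, (forall g, g \in s -> I g) /\ forall x, I x -> ideal_gen D s x.

Definition adjoin (D : C -> Prop) (t x : C) : Prop :=
  forall E, is_subring E -> (forall d, D d -> E d) -> E t -> E x.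

Lemma adjoin_subring D t : is_subring (adjoin D t).
Proof.
split=> [E hE _ _|x y Dx Dy E hE ED Et|x y Dx Dy E hE ED Et].
- by case: hE.
- by case: (hE) => _ EB _; apply: EB; [apply: Dx|apply: Dy].
- by case: (hE) => _ _ EM; apply: EM; [apply: Dx|apply: Dy].
Qed.

Section Hilbert.
Variables (D : C -> Prop) (t : C).
Hypotheses (hD : is_subring D) (nD : noetherian D).

(** Values at t of polynomials of degree less than n over D. The expression is
    not unique, as t need not be transcendental over D; Hilbert's argument
    below only uses the existence of expressions. *)
Fixpoint deg_lt (n : nat) : C -> Prop :=
  if n is m.+1 then fun x => exists u a, [/\ deg_lt m u, D a & x = u + a * t ^+ m]
  else fun x => x = 0.

Lemma deg_lt0 n : deg_lt n 0.
Proof.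
elim: n => [//|n IH]; exists 0, 0; split=> //; first exact: subring0.
by rewrite mul0r addr0.
Qed.

Lemma deg_ltS n x : deg_lt n x -> deg_lt n.+1 x.
Proof.
by move=> xn; exists x, 0; split=> //; [apply: subring0|rewrite mul0r addr0].
Qed.

Lemma deg_lt_le n m x : (n <= m)%N -> deg_lt n x -> deg_lt m x.
Proof.
move=> /subnK <-; elim: (m - n)%N => [//|k IH] xn.
by rewrite addSn; apply/deg_ltS/IH.
Qed.

Lemma deg_ltD n x y : deg_lt n x -> deg_lt n y -> deg_lt n (x + y).
Proof.
elim: n x y => [|n IH] x y /=; first by move=> -> ->; rewrite addr0.
move=> [u [a [un Da ->]]] [v [b [vn Db ->]]]; exists (u + v), (a + b).
by split; [apply: IH|apply: subringD|rewrite mulrDl addrACA].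
Qed.

Lemma deg_ltZ n a x : D a -> deg_lt n x -> deg_lt n (a * x).
Proof.
move=> Da; elim: n x => [|n IH] x /=; first by move=> ->; rewrite mulr0.
move=> [u [b [un Db ->]]]; exists (a * u), (a * b); split; first exact: IH.
  by case: hD => _ _; apply.
by rewrite mulrDr mulrA.
Qed.

Lemma deg_ltN n x : deg_lt n x -> deg_lt n (- x).
Proof.
move=> xn; rewrite -mulN1r; apply: deg_ltZ => //; rewrite -sub0r.
by case: (hD) => D1 DB _; apply: DB => //; apply: subring0.
Qed.

Lemma deg_ltMt n x : deg_lt n x -> deg_lt n.+1 (t * x).
Proof.
elim: n x => [|n IH] x; first by move=> ->; rewrite mulr0; apply: deg_lt0.
move=> [u [b [un Db ->]]]; exists (t * u), b; split=> //; first exact: IH.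
by rewrite mulrDr exprS mulrCA.
Qed.

Lemma deg_ltMtn n m x : deg_lt n x -> deg_lt (m + n) (t ^+ m * x).
Proof.
elim: m => [|m IH] xn; first by rewrite mul1r.
by rewrite exprS -mulrA addSn; apply/deg_ltMt/IH.
Qed.

Lemma adjoin_deg x : adjoin D t x -> exists n, deg_lt n x.
Proof.
move=> xD; apply: (xD (fun x => exists n, deg_lt n x)).
- split=> [|y z [n yn] [m zm]|y z [n yn] [m zm]].
  + by exists 1%N, 0, 1; split=> //; [case: hD|rewrite add0r mulr1].
  + exists (maxn n m); apply: deg_ltD; first exact: deg_lt_le (leq_maxl _ _) yn.
    by apply: deg_ltN; apply: deg_lt_le (leq_maxr _ _) zm.
  + elim: n y yn => [|n IH] y; first by move=> ->; exists 0%N; rewrite mul0r.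
    move=> [u [a [/IH [k uk] Da ->]]]; exists (maxn k (n + m)).
    rewrite mulrDl; apply: deg_ltD; first exact: deg_lt_le (leq_maxl _ _) uk.
    rewrite -mulrA; apply: deg_ltZ => //.
    by apply: deg_lt_le (leq_maxr _ _) _; apply: deg_ltMtn.
- by move=> d Dd; exists 1%N, 0, d; split=> //; rewrite mulr1 add0r.
- exists 2%N, 0, 1; split; [exact: deg_lt0|by case: hD|by rewrite mul1r add0r].
Qed.

Variable I : C -> Prop.
Hypothesis hI : rel_ideal (adjoin D t) I.
Let ID x y : I x -> I y -> I (x + y). Proof. by case: hI => _ + _; apply. Qed.
Let IZ a x : adjoin D t a -> I x -> I (a * x). Proof. by case: hI => _ _; apply. Qed.
Let adjD d : D d -> adjoin D t d. Proof. by move=> Dd E _ + _; apply. Qed.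
Let adjt : adjoin D t t. Proof. by move=> E. Qed.

(** Leading coefficients of the expressions of degree n, in the sense of
    [deg_lt], that lie in I. *)
Definition lead (n : nat) (a : C) : Prop :=
  D a /\ exists2 u, deg_lt n u & I (u + a * t ^+ n).

Lemma lead_ideal n : rel_ideal D (lead n).
Proof.
split=> [|a b [Da [u un Iu]] [Db [v vn Iv]]|d a Dd [Da [u un Iu]]].
- split; first exact: subring0.
  by exists 0; [apply: deg_lt0|rewrite mul0r addr0; case: hI].
- split; first exact: subringD.
  by exists (u + v); [apply: deg_ltD|rewrite mulrDl addrACA; apply: ID].
- split; first by case: hD => _ _; apply.
  exists (d * u); first exact: deg_ltZ.
  by rewrite -mulrA -mulrDr; apply: IZ => //; apply: adjD.
Qed.

Lemma leadS n a : lead n a -> lead n.+1 a.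
Proof.
move=> [Da [u un Iu]]; split=> //; exists (t * u); first exact: deg_ltMt.
by rewrite exprS mulrCA -mulrDr; apply: IZ.
Qed.

Lemma lead_le n m a : (n <= m)%N -> lead n a -> lead m a.
Proof.
move=> /subnK <-; elim: (m - n)%N => [//|k IH] an.
by rewrite addSn; apply/leadS/IH.
Qed.

Lemma lead_stable : exists m, forall n a, lead n a -> lead m a.
Proof.
have [|a [] //|s [sJ Js]] := @nD (fun a => exists n, lead n a).
- split=> [|a b [n an] [m bm]|d a Dd [n an]].
  + by exists 0%N; case: (lead_ideal 0).
  + exists (maxn n m); case: (lead_ideal (maxn n m)) => _ + _; apply.
      exact: lead_le (leq_maxl _ _) an.
    exact: lead_le (leq_maxr _ _) bm.
  + by exists n; case: (lead_ideal n) => _ _; apply.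
- by move=> n [].
have [m sm] : exists m, forall a, a \in s -> lead m a.
  elim: s sJ {Js} => [|a s IH] sJ; first by exists 0%N.
  have [|m ms] := IH; first by move=> b bs; apply: sJ; rewrite inE bs orbT.
  have [|n an] := sJ a; first by rewrite inE eqxx.
  exists (maxn n m) => b; rewrite inE => /predU1P[->|/ms].
    exact: lead_le (leq_maxl _ _) an.
  exact/lead_le/leq_maxr.
exists m => n a an; apply: (Js a) => //; [by exists n|exact: lead_ideal].
Qed.

Lemma lead_lift n : exists s, (forall g, g \in s -> I g) /\
  forall a, lead n a -> exists2 u, deg_lt n u & ideal_gen (adjoin D t) s (u + a * t ^+ n).
Proof.
have [|as_ [asJ Jas]] := @nD (lead n) (lead_ideal n); first by move=> x [].
have [s [sI sas]] : exists s : seq C, (forall g, g \in s -> I g) /\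
    forall a, a \in as_ -> exists2 u, deg_lt n u & u + a * t ^+ n \in s.
  elim: as_ asJ {Jas} => [|a l IH] asJ; first by exists [::].
  have [|s [sI sl]] := IH; first by move=> b bl; apply: asJ; rewrite inE bl orbT.
  have [|_ [u un Iu]] := asJ a; first by rewrite inE eqxx.
  exists (u + a * t ^+ n :: s); split=> [g|b]; rewrite !inE.
    by move=> /predU1P[->|/sI].
  move=> /predU1P[->|/sl [v vn vs]]; first by exists u => //; rewrite inE eqxx.
  by exists v => //; rewrite inE vs orbT.
exists s; split=> // a an; apply: (Jas a an (fun a => exists2 u, deg_lt n u &
  ideal_gen (adjoin D t) s (u + a * t ^+ n))) => [|b bas]; last first.
  have [u un us] := sas b bas; exists u => // J _; exact.
split=> [|x y [u un Iu] [v vn Iv]|d a' Dd [u un Iu]].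
- by exists 0; [apply: deg_lt0|rewrite mul0r addr0 => J [J0]].
- exists (u + v); first exact: deg_ltD.
  rewrite mulrDl addrACA => J hJ sJ; case: (hJ) => _ JD _; apply: JD.
    exact: Iu.
  exact: Iv.
- exists (d * u); first exact: deg_ltZ.
  rewrite -mulrA -mulrDr => J hJ sJ; case: (hJ) => _ _ JZ; apply: JZ.
    exact: adjD.
  exact: Iu.
Qed.

Lemma ideal_gen_sub s s' x : {subset s <= s'} ->
  ideal_gen (adjoin D t) s x -> ideal_gen (adjoin D t) s' x.
Proof. by move=> ss' sx J hJ s'J; apply: sx => // g /ss'/s'J. Qed.

Lemma ideal_gen_I s x : (forall g, g \in s -> I g) -> ideal_gen (adjoin D t) s x -> I x.
Proof. by move=> sI sx; apply: sx. Qed.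

Lemma IB x y : I x -> I y -> I (x - y).
Proof.
move=> Ix Iy; apply: ID => //; rewrite -mulN1r; apply: IZ => //; rewrite -sub0r.
have [D1 DB _] := adjoin_subring D t; apply: DB => //.
exact: (subring0 (adjoin_subring D t)).
Qed.

Lemma gen_below n : exists s, (forall g, g \in s -> I g) /\
  forall x, I x -> deg_lt n x -> ideal_gen (adjoin D t) s x.
Proof.
elim: n => [|n [s [sI sn]]].
  by exists [::]; split=> // x _ -> J [].
have [s' [s'I s'n]] := lead_lift n; exists (s ++ s'); split=> [g|x Ix].
  by rewrite mem_cat => /orP[/sI|/s'I].
move=> [u [a [un Da xE]]].
have [|v vn vgen] := s'n a; first by split=> //; exists u; rewrite -?xE.
have -> : x = (x - (v + a * t ^+ n)) + (v + a * t ^+ n) by rewrite subrK.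
have xv : ideal_gen (adjoin D t) s (x - (v + a * t ^+ n)).
  apply: sn; first by apply: IB => //; apply: (ideal_gen_I s'I).
  by rewrite xE opprD addrACA subrr addr0; apply/deg_ltD/deg_ltN.
move=> J hJ sJ; case: (hJ) => _ + _; apply.
  by apply: xv => // g gs; apply: sJ; rewrite mem_cat gs.
by apply: vgen => // g gs; apply: sJ; rewrite mem_cat gs orbT.
Qed.

Lemma gen_all : exists s, (forall g, g \in s -> I g) /\
  forall n x, I x -> deg_lt n x -> ideal_gen (adjoin D t) s x.
Proof.
have [m mJ] := lead_stable; have [s [sI sn]] := gen_below m.
have [s' [s'I s'n]] := lead_lift m; exists (s ++ s'); split=> [g|].
  by rewrite mem_cat => /orP[/sI|/s'I].
elim=> [|n IH] x Ix xn; first by rewrite xn => J [].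
have [nm|mn] := ltnP n m.
  apply: (@ideal_gen_sub s) => [g gs|]; first by rewrite mem_cat gs.
  by apply: sn => //; apply: deg_lt_le xn.
case: xn => u [a [un Da xE]].
have [|v vn vgen] := s'n a; first by apply: (mJ n); split=> //; exists u; rewrite -?xE.
pose y := t ^+ (n - m) * (v + a * t ^+ m).
have yE : y = t ^+ (n - m) * v + a * t ^+ n.
  by rewrite /y mulrDr mulrCA -exprD subnK.
have adjX (k : nat) : adjoin D t (t ^+ k).
  exact: (subringX (adjoin_subring D t)).
have Iy : I y by apply: IZ => //; apply: (ideal_gen_I s'I).
have xy : deg_lt n (x - y).
  rewrite xE yE opprD addrACA subrr addr0; apply/deg_ltD/deg_ltN => //.
  by rewrite -{1}(subnK mn); apply: deg_ltMtn.
have := IH _ (IB Ix Iy) xy; move=> gen J hJ sJ; rewrite -(subrK y x).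
case: (hJ) => _ JD JZ; apply: JD; first exact: gen.
by apply: JZ => //; apply: vgen => // g gs; apply: sJ; rewrite mem_cat gs orbT.
Qed.
End Hilbert.

(** Hilbert's basis theorem. *)
Lemma adjoin_noetherian D t :
  is_subring D -> noetherian D -> noetherian (adjoin D t).
Proof.
move=> hD nD I hI ID; have [s [sI sgen]] := gen_all hD nD hI.
by exists s; split=> // x Ix; have [n xn] := adjoin_deg hD (ID x Ix); apply: (sgen n).
Qed.

Section Subalgebra.
Variables (S : comPzRingType) (f : {rmorphism S -> C}).

Definition subalg (s : seq C) (x : C) : Prop :=
  forall E, is_subring E -> (forall r, E (f r)) -> (forall g, g \in s -> E g) -> E x.

Lemma subalg_subring s : is_subring (subalg s).
Proof.
split=> [E hE _ _|x y Dx Dy E hE ED Et|x y Dx Dy E hE ED Et].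
- by case: hE.
- by case: (hE) => _ EB _; apply: EB; [apply: Dx|apply: Dy].
- by case: (hE) => _ _ EM; apply: EM; [apply: Dx|apply: Dy].
Qed.

Lemma subalg_mem s g : g \in s -> subalg s g.
Proof. by move=> gs E _ _; apply. Qed.

Lemma subalg_str s r : subalg s (f r).
Proof. by move=> E _ Ef _; apply: Ef. Qed.

Lemma subalg_noetherian s :
  (forall I : S -> Prop, is_ideal I -> exists a, forall x, I x <-> exists b, x = b * a) ->
  noetherian (subalg s).
Proof.
move=> pid; elim: s => [|t s IH].
  move=> I [I0 ID IZ] Isub; have [|a aE] := pid (fun r => I (f r)).
    split=> [|x y|r x]; rewrite ?rmorph0 ?rmorphD ?rmorphM //.
      exact: ID.
    by apply: IZ => E _.
  exists [:: f a]; split=> [g|x Ix].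
    by rewrite inE => /eqP->; apply/aE; exists 1; rewrite mul1r.
  have [r xE] : exists r, x = f r.
    apply: (Isub x Ix (fun x => exists r, x = f r)) => // [|r]; last by exists r.
    split=> [|_ _ [r ->] [r' ->]|_ _ [r ->] [r' ->]]; first by exists 1; rewrite rmorph1.
      by exists (r - r'); rewrite rmorphB.
    by exists (r * r'); rewrite rmorphM.
  have [b rE] : exists b, r = b * a by apply/aE; rewrite -xE.
  move=> J [_ _ JZ] Ja; rewrite xE rE rmorphM; apply: JZ; first by move=> E _.
  by apply: Ja; rewrite inE.
have E x : subalg (t :: s) x <-> adjoin (subalg s) t x.
  split=> [xs E hE DE Et|xs E hE fE sE].
    apply: xs => // [r|g]; first by apply: DE => E' _.
    by rewrite inE => /predU1P[->|gs] //; apply: DE; apply: subalg_mem.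
  apply: xs => // [d sd|]; last by apply: sE; rewrite inE eqxx.
  by apply: sd => // g gs; apply: sE; rewrite inE gs orbT.
have -> : subalg (t :: s) = adjoin (subalg s) t.
  by apply/funext => x; apply/propext.
exact/adjoin_noetherian/IH/subalg_subring.
Qed.
End Subalgebra.
End Noetherian.

(** * Contraction of tensors by linear maps *)

(** A-linearity for the module structures given by f and f', stated on B and
    B' themselves so that their ring operations need no casts to [restr]. *)
Definition is_lin (A B B' : comPzRingType) (f : {rmorphism A -> B})
    (f' : {rmorphism A -> B'}) (phi : B -> B') : Prop :=
  (forall x y, phi (x + y) = phi x + phi y) /\
  (forall a x, phi (f a * x) = f' a * phi x).

Section Contractions.
Variables (A B C : comPzRingType) (f : {rmorphism A -> B}) (g : {rmorphism A -> C}).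

Section Map1.
Variables (B' : comPzRingType) (f' : {rmorphism A -> B'}) (phi : B -> B').
Hypothesis hphi : is_lin f f' phi.

Definition tmap1 (t : tring f g) : tring f' g :=
  tens_lift (fun (b : restr f) (c : restr g) => tpure f' g (phi b) c) t.

Lemma tmap1_balanced :
  balanced (fun (b : restr f) (c : restr g) => tpure f' g (phi b) c).
Proof.
case: hphi => hD hZ; split=> [m m' n|m n n'|a m n]; rewrite ?hD ?tpureDl ?tpureDr //.
by rewrite [phi _]hZ tpureZ.
Qed.

Lemma tmap1D : {morph tmap1 : t u / t + u}.
Proof. exact: tens_liftD tmap1_balanced. Qed.
Lemma tmap1_0 : tmap1 0 = 0.
Proof. exact: tens_lift0 tmap1_balanced. Qed.
Lemma tmap1_pure b c : tmap1 (tpure f g b c) = tpure f' g (phi b) c.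
Proof. exact: (tens_lift_pure tmap1_balanced). Qed.
End Map1.

Section Right.
Variable phi : C -> A.
Hypothesis hphi : is_lin g (@idfun A : {rmorphism A -> A}) phi.

Definition tright (t : tring f g) : B :=
  tens_lift (fun (b : restr f) (c : restr g) => b * f (phi c) : B) t.

Lemma tright_balanced :
  balanced (fun (b : restr f) (c : restr g) => b * f (phi c) : B).
Proof.
case: hphi => hD hZ; split=> [m m' n|m n n'|a m n].
- by rewrite mulrDl.
- by rewrite hD rmorphD mulrDr.
- by rewrite -[a *: n]/(g a * n) hZ rmorphM mulrA -[a *: m]/(f a * m) [f a * m]mulrC.
Qed.

Lemma trightD : {morph tright : t u / t + u}.
Proof. exact: tens_liftD tright_balanced. Qed.
Lemma tright0 : tright 0 = 0.
Proof. exact: tens_lift0 tright_balanced. Qed.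
Lemma tright_pure b c : tright (tpure f g b c) = b * f (phi c).
Proof. exact: (tens_lift_pure tright_balanced). Qed.
End Right.

Section Left.
Variable phi : B -> A.
Hypothesis hphi : is_lin f (@idfun A : {rmorphism A -> A}) phi.

Definition tleft (t : tring f g) : C :=
  tens_lift (fun (b : restr f) (c : restr g) => g (phi b) * c : C) t.

Lemma tleft_balanced :
  balanced (fun (b : restr f) (c : restr g) => g (phi b) * c : C).
Proof.
case: hphi => hD hZ; split=> [m m' n|m n n'|a m n].
- by rewrite hD rmorphD mulrDl.
- by rewrite mulrDr.
- rewrite -[a *: m]/(f a * m) -[a *: n]/(g a * n) hZ rmorphM /=.
  by rewrite -mulrA mulrCA.
Qed.

Lemma tleftD : {morph tleft : t u / t + u}.
Proof. exact: tens_liftD tleft_balanced. Qed.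
Lemma tleft0 : tleft 0 = 0.
Proof. exact: tens_lift0 tleft_balanced. Qed.
Lemma tleft_pure b c : tleft (tpure f g b c) = g (phi b) * c.
Proof. exact: (tens_lift_pure tleft_balanced). Qed.
End Left.

Lemma tpure0l c : tpure f g 0 c = 0.
Proof. by apply: (addIr (tpure f g 0 c)); rewrite -tpureDl !add0r. Qed.
Lemma tpure0r b : tpure f g b 0 = 0.
Proof. by apply: (addIr (tpure f g b 0)); rewrite -tpureDr !add0r. Qed.
Lemma tpure_suml (I : finType) (F : I -> B) c :
  tpure f g (\sum_i F i) c = \sum_i tpure f g (F i) c.
Proof. exact: (big_morph (fun b => tpure f g b c) (fun b b' => tpureDl _ _ b b' c) (tpure0l c)). Qed.
Lemma tpure_sumr (I : finType) (F : I -> C) b :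
  tpure f g b (\sum_i F i) = \sum_i tpure f g b (F i).
Proof. exact: (big_morph (tpure f g b) (tpureDr _ _ b) (tpure0r b)). Qed.

Lemma tring_sum (t : tring f g) :
  exists n (u : 'I_n -> B) (v : 'I_n -> C), t = \sum_i tpure f g (u i) (v i).
Proof.
rewrite [t]tensE; set s := repr t; exists (size s), (fun i => (nth (0, 0) s i).1),
  (fun i => (nth (0, 0) s i).2).
by rewrite (big_nth (0, 0)) big_mkord.
Qed.
End Contractions.

(** The functional is the one with kernel a maximal subspace that contains N
    but not e: such a subspace is a complement of the line spanned by e. *)
Lemma linear_functional (K : fieldType) (B : comPzRingType) (f : {rmorphism K -> B})
    (N : B -> Prop) (e : B) :
  is_submod f N -> ~ N e ->
  exists l : B -> K, [/\ is_lin f (@idfun K : {rmorphism K -> K}) l,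
    forall x, N x -> l x = 0 & l e = 1].
Proof.
move=> hN Ne; have [M [[M0 MD MZ] NM Me Mmax]] := maximal_submod hN Ne.
have kM k : M (f k * e) -> k = 0.
  move=> Mke; apply/eqP; apply: contraPT Me => k0; apply.
  by have := MZ k^-1 _ Mke; rewrite mulrA -rmorphM mulVf // rmorph1 mul1r.
have ex c : exists k, M (c - f k * e).
  have [Mc|/Mmax[s [n [Mn eE]]]] := pselect (M c).
    by exists 0; rewrite rmorph0 mul0r subr0.
  have s0 : s != 0.
    by apply/eqP => s0; apply: Me; rewrite eE s0 rmorph0 mul0r addr0.
  exists s^-1; have := MZ (- s^-1) _ Mn.
  rewrite [in X in _ -> M X]eE mulrDr mulrA -rmorphM mulVf // rmorph1 mul1r.
  by rewrite opprD addrCA subrr addr0 rmorphN mulNr.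
have /choice[l lE] := ex.
have uniq c k : M (c - f k * e) -> l c = k.
  move=> Mk; apply/eqP; rewrite -subr_eq0; apply/eqP/kM.
  have := MD _ _ Mk (MZ (-1) _ (lE c)); rewrite rmorphN1 mulN1r opprB addrC addrA subrK.
  by rewrite rmorphB mulrBl.
exists l; split.
- split=> [x y|k x]; apply: uniq.
    have := MD _ _ (lE x) (lE y); rewrite addrACA -opprD.
    by rewrite rmorphD mulrDl.
  by have := MZ k _ (lE x); rewrite mulrBr mulrA -rmorphM.
- by move=> x /NM Mx; apply: uniq; rewrite rmorph0 mul0r subr0.
- by apply: uniq; rewrite rmorph1 mul1r subrr.
Qed.

Lemma dual_functional (K : fieldType) (B : comPzRingType) (f : {rmorphism K -> B})
    (n : nat) (u : 'I_n -> B) (j : 'I_n) :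
  ~ (exists k : 'I_n -> K, u j = \sum_(i | i != j) f (k i) * u i) ->
  exists l : B -> K, is_lin f (@idfun K : {rmorphism K -> K}) l /\
    forall i, l (u i) = (i == j)%:R.
Proof.
move=> uj.
have [||l [llin l0 l1]] := @linear_functional K B f
  (fun x => exists k : 'I_n -> K, x = \sum_(i | i != j) f (k i) * u i) (u j).
- split=> [|x y [k ->] [k' ->]|s x [k ->]].
  + by exists (fun=> 0); rewrite big1 // => i _; rewrite rmorph0 mul0r.
  + exists (fun i => k i + k' i); rewrite -big_split; apply: eq_bigr => i _ /=.
    by rewrite rmorphD mulrDl.
  + exists (fun i => s * k i); rewrite mulr_sumr; apply: eq_bigr => i _ /=.
    by rewrite rmorphM mulrA.
- exact: uj.
exists l; split=> // i; have [->//|ij] := eqVneq i j.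
apply: l0; exists (fun k => (k == i)%:R); rewrite (bigD1 i) //= eqxx rmorph1 mul1r.
by rewrite big1 ?addr0 // => k /andP[_ /negbTE ->]; rewrite rmorph0 mul0r.
Qed.

Section LinFun.
Variables (A B B' : comPzRingType) (f : {rmorphism A -> B})
  (f' : {rmorphism A -> B'}) (phi : B -> B').
Hypothesis hphi : is_lin f f' phi.
Lemma lin0 : phi 0 = 0.
Proof. by have [_ h] := hphi; have := h 0 0; rewrite !rmorph0 !mul0r. Qed.
Lemma lin_sum (I : finType) (F : I -> B) : phi (\sum_i F i) = \sum_i phi (F i).
Proof. by have [h _] := hphi; exact: (big_morph phi h lin0). Qed.
Lemma linB x y : phi (x - y) = phi x - phi y.
Proof.
by have [h _] := hphi; apply: (addIr (phi y)); rewrite -h !subrK.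
Qed.
End LinFun.

(** * Matrix coefficients *)

Section GroupElements.
Variables (S : comPzRingType) (G : grp S).
Local Notation B := (ring_of G).
Local Notation str := (str_map G).
Local Notation delta := (pb (gmul G)).
Local Notation counit := (pb (gone G)).

Lemma pb_pairm (T Y Z : aff S) (u : mor T Y) (v : mor T Z) b c :
  pb (pairm u v) (tpure _ _ b c) = pb u b * pb v c.
Proof. exact: tcop_pure. Qed.

Lemma pb_pairm_sum (T Y Z : aff S) (u : mor T Y) (v : mor T Z) (I : finType)
    (b : I -> ring_of Y) (c : I -> ring_of Z) :
  pb (pairm u v) (\sum_i tpure _ _ (b i) (c i)) = \sum_i pb u (b i) * pb v (c i).
Proof. by rewrite rmorph_sum; apply: eq_bigr => i _; apply: pb_pairm. Qed.

Variables (I : finType) (b : B) (u v : I -> B).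
Hypothesis bE : delta b = \sum_i tpure str str (u i) (v i).

Lemma coassoc_sum :
  \sum_i tpure _ str (delta (u i)) (v i) =
  \sum_i tin1 _ str (tin1 str str (u i)) *
    pb (pairm (compm (pr2 (Y := G) (Z := G)) (pr1 (Y := prodm G G) (Z := G))) pr2)
       (delta (v i)).
Proof.
have := congr1 (fun w => pb w b) (gmulA G).
rewrite -[LHS]/(pb (pairm (compm (gmul G) (pairm (compm pr1 pr1) (compm pr2 pr1))) pr2) (delta b)).
rewrite -[RHS]/(pb (pairm (compm pr1 pr1) (compm (gmul G) (pairm (compm pr2 pr1) pr2))) (delta b)).
rewrite bE !pb_pairm_sum => E; transitivity (\sum_i pb (compm (gmul G)
    (pairm (compm pr1 pr1) (compm pr2 (pr1 (Y := prodm G G) (Z := G))))) (u i) *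
    pb (pr2 (Y := prodm G G) (Z := G)) (v i)).
  apply: eq_bigr => i _; rewrite tpureE; congr (_ * _).
  have eq1 : pairm (compm pr1 pr1) (compm pr2 pr1)
      = pr1 (Y := prodm G G) (Z := G) by apply: prod_ext; rewrite ?pr1_pair ?pr2_pair.
  by rewrite -[RHS]/(pb (pairm _ _) (delta (u i))) eq1.
by rewrite [LHS]E.
Qed.

Lemma counit_l : b = \sum_i str (counit (u i)) * v i.
Proof.
have := congr1 (fun w => pb w b) (gmul1l G); rewrite -[RHS]/b => <-.
rewrite -[LHS]/(pb (pairm (compm (gone G) (to_base G)) (idm G)) (delta b)).
by rewrite bE pb_pairm_sum.
Qed.

Lemma counit_r : b = \sum_i u i * str (counit (v i)).
Proof.
have := congr1 (fun w => pb w b) (gmul1r G); rewrite -[RHS]/b => <-.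
rewrite -[LHS]/(pb (pairm (idm G) (compm (gone G) (to_base G))) (delta b)).
by rewrite bE pb_pairm_sum.
Qed.

Lemma antipode_l : \sum_i pb (ginv G) (u i) * v i = str (counit b).
Proof.
have := congr1 (fun w => pb w b) (gmulVl G); rewrite -[RHS]/(str (counit b)) => <-.
rewrite -[RHS]/(pb (pairm (ginv G) (idm G)) (delta b)).
by rewrite bE pb_pairm_sum.
Qed.

Lemma antipode_r : \sum_i u i * pb (ginv G) (v i) = str (counit b).
Proof.
have := congr1 (fun w => pb w b) (gmulVr G); rewrite -[RHS]/(str (counit b)) => <-.
rewrite -[RHS]/(pb (pairm (idm G) (ginv G)) (delta b)).
by rewrite bE pb_pairm_sum.
Qed.

(** Coassociativity contracted by l on the last factor. *)
Lemma coassoc_r (l : B -> S) : is_lin str (@idfun S : {rmorphism S -> S}) l ->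
  \sum_i delta (u i) * tin1 str str (str (l (v i))) =
  \sum_i tpure str str (u i) (tright l (delta (v i))).
Proof.
move=> hl; have := congr1 (tright l) coassoc_sum.
rewrite !(big_morph _ (trightD hl) (tright0 _ hl)).
under eq_bigr do rewrite tright_pure //.
move=> E; etransitivity; first exact: E.
apply: eq_bigr => i _; move: (delta (v i)) => t.
elim/tring_ind: t => [|x y ex ey|c c'].
- by rewrite rmorph0 mulr0 !tright0 // tpure0r.
- by rewrite rmorphD mulrDr !trightD // ex ey tpureDr.
rewrite pb_pairm -[pb pr2 c']/(tin2 _ _ c') mulrA.
rewrite -[tin1 _ _ _ * _](rmorphM (tin1 _ str)) -tpureE tright_pure //.
rewrite -[pb pr2 c]/(tin2 _ _ c) -tpureE tright_pure //.
rewrite -[str_map (prodm G G) _]/(tin1 _ _ (str (l c'))) /tin1 tpureM mulr1.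
by rewrite [u i * _]mulrC [c * _]mulrC tpureZ.
Qed.

(** Coassociativity contracted by m on the first factor. *)
Lemma coassoc_l (m : B -> S) : is_lin str (@idfun S : {rmorphism S -> S}) m ->
  \sum_i tpure str str (tleft m (delta (u i))) (v i) =
  \sum_i tin1 str str (str (m (u i))) * delta (v i).
Proof.
move=> hm; have hl : is_lin (str_map (prodm G G)) str (tleft m : tring str str -> B).
  split=> [x y|a x]; first exact: tleftD.
  elim/tring_ind: x => [|x y ex ey|c c'].
  - by rewrite mulr0 tleft0 // mulr0.
  - by rewrite mulrDr !tleftD // ex ey mulrDr.
  rewrite -[str_map (prodm G G) a]/(tin1 _ _ (str a)) /tin1 tpureM mul1r !tleft_pure //.
  by have [_ ->] := hm; rewrite rmorphM mulrA.
have := congr1 (tmap1 (g := str) str (tleft m : tring str str -> B)) coassoc_sum.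
rewrite !(big_morph _ (tmap1D (g := str) hl) (tmap1_0 _ hl)).
under eq_bigr do rewrite tmap1_pure //.
move=> ->; apply: eq_bigr => i _; move: (delta (v i)) => t.
elim/tring_ind: t => [|x y ex ey|c c'].
- by rewrite rmorph0 !mulr0 tmap1_0.
- by rewrite rmorphD !mulrDr tmap1D // ex ey.
rewrite pb_pairm -[pb pr2 c']/(tin2 _ _ c') mulrA.
rewrite -[tin1 _ _ _ * _](rmorphM (tin1 _ str)) -tpureE tmap1_pure //.
rewrite -[pb pr2 c]/(tin2 _ _ c) -tpureE tleft_pure //.
by rewrite /tin1 tpureM mul1r.
Qed.

End GroupElements.

Section MatrixCoefficients.
Variables (K : fieldType) (G : grp K).
Local Notation B := (ring_of G).
Local Notation str := (str_map G).
Local Notation delta := (pb (gmul G)).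
Local Notation counit := (pb (gone G)).

Definition is_matcoef (I : finType) (d : I -> I -> B) : Prop :=
  (forall i j, delta (d i j) = \sum_k tpure str str (d i k) (d k j)) /\
  (forall i j, counit (d i j) = (i == j)%:R).

Lemma sum_lift (V : zmodType) (n : nat) (j : 'I_n.+1) (F : 'I_n.+1 -> V) :
  \sum_(i | i != j) F i = \sum_(i < n) F (lift j i).
Proof.
apply: (addrI (F j)); transitivity (\sum_i F i); first by rewrite [RHS](bigD1 j).
by rewrite (bigD1_ord j).
Qed.

(** A dependency between the left factors, or between the right factors, would
    shorten the expression. *)
Lemma tring_min (t : tring str str) :
  exists n (u v : 'I_n -> B), [/\ t = \sum_i tpure str str (u i) (v i),
    forall j, ~ exists k : 'I_n -> K, u j = \sum_(i | i != j) str (k i) * u i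
  & forall j, ~ exists k : 'I_n -> K, v j = \sum_(i | i != j) str (k i) * v i].
Proof.
pose P n := `[< exists u v : 'I_n -> B, t = \sum_i tpure str str (u i) (v i) >].
have exP : exists n, P n.
  by have [n [u [v tE]]] := tring_sum t; exists n; apply/asboolP; exists u, v.
have [n /asboolP[u [v tE]] nmin] := ex_minnP exP; exists n, u, v; split=> //.
  case: n u v tE nmin => [|n] u v tE nmin j; first by case: j.
  case=> k; rewrite sum_lift => uj; suff /nmin : P n by rewrite ltnn.
  apply/asboolP; exists (fun i => u (lift j i)).
  exists (fun i => v (lift j i) + str (k (lift j i)) * v j).
  rewrite tE (bigD1_ord j) //= uj tpure_suml -big_split; apply: eq_bigr => i _ /=.
  by rewrite tpureZ tpureDr addrC.
case: n u v tE nmin => [|n] u v tE nmin j; first by case: j.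
case=> k; rewrite sum_lift => vj; suff /nmin : P n by rewrite ltnn.
apply/asboolP; exists (fun i => u (lift j i) + str (k (lift j i)) * u j).
exists (fun i => v (lift j i)).
rewrite tE (bigD1_ord j) //= vj tpure_sumr -big_split; apply: eq_bigr => i _ /=.
by rewrite -tpureZ tpureDl addrC.
Qed.

Lemma kronecker_suml (I : finType) (A V : pzRingType) (f : {rmorphism A -> V}) (j : I) (F : I -> V) :
  \sum_i f (i == j)%:R * F i = F j.
Proof.
rewrite (bigD1 j) //= eqxx rmorph1 mul1r big1 ?addr0 // => i /negbTE ->.
by rewrite rmorph0 mul0r.
Qed.

(** In a shortest expression Delta(b) = sum_i u_i (x) v_i both families have
    dual functionals. Contracting coassociativity with the dual of v shows
    that the u_j span a comodule, Delta(u_j) = sum_i u_i (x) d_ij; contracting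
    once more with the dual of u gives Delta(d) = d (x) d, and both counit
    axioms give b = sum_ij eps(u_i) eps(v_j) d_ij. *)
Lemma matcoef_exists (b : B) : exists n (d : 'I_n -> 'I_n -> B),
  is_matcoef d /\ exists k : 'I_n -> 'I_n -> K, b = \sum_i \sum_j str (k i j) * d i j.
Proof.
have [n [u [v [bE uI vI]]]] := tring_min (delta b).
have /fin_all_exists[l lE] := fun j => dual_functional (vI j).
have /fin_all_exists[m mE] := fun j => dual_functional (uI j).
pose d i j := tright (l j) (delta (v i)).
have uE j : delta (u j) = \sum_i tpure str str (u i) (d i j).
  have [ljl lj] := lE j; rewrite -(coassoc_r bE ljl).
  under eq_bigr => i _ do rewrite lj mulrC.
  rewrite -[tin1 str str]/(tin1 str str : B -> _).
  rewrite (bigD1 j) //= eqxx !rmorph1 mul1r big1 ?addr0 // => i /negbTE ->.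
  by rewrite !rmorph0 mul0r.
exists n, d; split; first split=> i j.
- have [mil mi] := mE i.
  transitivity (\sum_k tin1 str str (str (m i (u k))) * delta (d k j)).
    under eq_bigr => k _ do rewrite mi.
    rewrite (bigD1 i) //= eqxx !rmorph1 mul1r big1 ?addr0 // => k /negbTE ->.
    by rewrite !rmorph0 mul0r.
  rewrite -(coassoc_l (uE j) mil); apply: eq_bigr => k _; congr tpure.
  rewrite uE (big_morph _ (tleftD mil) (tleft0 _ mil)).
  under eq_bigr do rewrite tleft_pure // mi.
  exact: kronecker_suml.
- have [mil mi] := mE i; have := counit_r (uE j) => /(congr1 (m i)).
  rewrite mi (lin_sum mil) eq_sym => ->.
  have [_ mZ] := mil.
  under eq_bigr do rewrite mulrC mZ mi mulrC.
  rewrite (bigD1 i) //= eqxx mul1r big1 ?addr0 // => k /negbTE ->.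
  by rewrite mul0r.
exists (fun i j => counit (u i) * counit (v j)).
rewrite {1}(counit_r bE) exchange_big; apply: eq_bigr => j _ /=.
rewrite {1}(counit_l (uE j)) mulr_suml; apply: eq_bigr => i _.
by rewrite rmorphM mulrAC.
Qed.

Lemma matcoef_generators (s : seq B) : exists (I : finType) (d : I -> I -> B),
  is_matcoef d /\ forall b, b \in s ->
    exists k : I -> I -> K, b = \sum_i \sum_j str (k i j) * d i j.
Proof.
elim: s => [|b s [I [d [[dM dU] ds]]]].
  by exists void, (fun _ _ => 0); split=> //; split=> -[].
have [n [e [[eM eU] [k bE]]]] := matcoef_exists b.
pose h (i j : I + 'I_n) : B := match i, j with
  inl i, inl j => d i j | inr i, inr j => e i j | _, _ => 0 end.
exists (I + 'I_n)%type, h; split; first split.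
- move=> [i|i] [j|j]; rewrite big_sumType /= ?dM ?eM ?rmorph0.
  + by rewrite [X in _ + X]big1 ?addr0 // => o _; rewrite tpure0r.
  + by rewrite !big1 ?addr0 // => o _; rewrite ?tpure0l ?tpure0r.
  + by rewrite !big1 ?addr0 // => o _; rewrite ?tpure0l ?tpure0r.
  + by rewrite [X in X + _]big1 ?add0r // => o _; rewrite tpure0r.
- by move=> [i|i] [j|j] /=; rewrite ?dU ?eU ?rmorph0.
move=> c; rewrite inE => /predU1P[->|/ds [k' cE]].
  exists (fun i j => match i, j with inr i, inr j => k i j | _, _ => 0 end).
  rewrite big_sumType /= [X in X + _]big1 ?add0r => [|i _].
    rewrite bE; apply: eq_bigr => i _; rewrite big_sumType /= [X in X + _]big1 ?add0r // => j _.
    by rewrite mulr0.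
  by rewrite big1 // => -[j|j] _; rewrite rmorph0 mul0r.
exists (fun i j => match i, j with inl i, inl j => k' i j | _, _ => 0 end).
rewrite big_sumType /= [X in _ + X]big1 ?addr0 => [|i _].
  rewrite cE; apply: eq_bigr => i _; rewrite big_sumType /= [X in _ + X]big1 ?addr0 // => j _.
  by rewrite mulr0.
by rewrite big1 // => -[j|j] _; rewrite rmorph0 mul0r.
Qed.

(** Comatrix: Delta(d) = d (x) d, as a product of matrices over B (x) B. *)
Definition mx_comul (n : nat) (d : 'M[B]_n) : Prop :=
  map_mx delta d = map_mx (tin1 str str) d *m map_mx (tin2 str str) d.

(** The matrix exhibits G as a closed subgroup of GL_n: the antipode of d is
    its inverse. *)
Lemma matrix_generators : finite_type G ->
  exists n (d : 'M[B]_n), [/\ mx_comul d, map_mx counit d = 1%:M,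
    map_mx (pb (ginv G)) d *m d = 1%:M, d *m map_mx (pb (ginv G)) d = 1%:M
  & forall b E, is_subring E -> (forall k, E (str k)) -> (forall i j, E (d i j)) -> E b].
Proof.
move=> [s sgen]; have [I [h [[hM hU] hs]]] := matcoef_generators s.
pose d : 'M[B]_#|I| := \matrix_(i, j) h (enum_val i) (enum_val j).
have sumE (V : zmodType) (F : I -> V) : \sum_k F k = \sum_(k < #|I|) F (enum_val k).
  rewrite (reindex (enum_val : 'I_#|I| -> I)) //=.
  by exists enum_rank => i _; rewrite ?enum_valK ?enum_rankK.
have dM i j : delta (d i j) = \sum_k tpure str str (d i k) (d k j).
  by rewrite !mxE hM sumE; apply: eq_bigr => k _; rewrite !mxE.
have dU i j : counit (d i j) = (i == j)%:R.
  by rewrite !mxE hU (inj_eq enum_val_inj).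
exists #|I|, d; split.
- apply/matrixP => i j; rewrite [LHS]mxE [RHS]mxE dM; apply: eq_bigr => k _.
  by rewrite tpureE; congr (_ * _); rewrite [RHS]mxE.
- by apply/matrixP => i j; rewrite [LHS]mxE dU [RHS]mxE.
- apply/matrixP => i j; rewrite [LHS]mxE [RHS]mxE.
  have := antipode_l (dM i j); rewrite dU rmorph_nat => <-.
  by apply: eq_bigr => k _; rewrite mxE.
- apply/matrixP => i j; rewrite [LHS]mxE [RHS]mxE.
  have := antipode_r (dM i j); rewrite dU rmorph_nat => <-.
  by apply: eq_bigr => k _; congr (_ * _); rewrite [LHS]mxE.
move=> b E hE Estr Ed; have hEM : forall x y, E x -> E y -> E (x * y) by case: hE.
apply: sgen => // [c /hs [k ->]|x y]; last exact: subringD.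
apply: subring_sum => // i; apply: subring_sum => // j; apply: hEM => //.
by have := Ed (enum_rank i) (enum_rank j); rewrite mxE !enum_rankK.
Qed.

End MatrixCoefficients.

(** * Pointed torsors over alpha_p over a field *)

Section PointedTorsor.
Variables (K : fieldType) (p : nat) (G : grp K) (Y : gspace G (alpha K p)).
Hypotheses (p_gt0 : (0 < p)%N) (hY : is_torsor Y).
Variables (y : mor base Y) (hy : compm (gproj Y) y = alpha_unit K p).
Local Notation A := {poly %/ 'X^p : {poly K}}.
Local Notation B := (ring_of G).
Local Notation C := (ring_of Y).
Local Notation strB := (str_map G).
Local Notation strC := (str_map Y).
Local Notation delta := (pb (gmul G)).
Local Notation rho := (pb (gact Y)).
Local Notation x := (alpha_x K p).

Definition alg_map : {rmorphism A -> C} := pb (gproj Y).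
Local Notation f := alg_map.

Lemma alg_str k : f (alpha_str p k) = strC k.
Proof. exact: (pbE (gproj Y) k). Qed.

(** The map g |-> y.g, an isomorphism of G with the fibre of Y over the
    origin. *)
Definition orbit_map : mor G Y := compm (gact Y) (pairm (compm y (to_base G)) (idm G)).
Local Notation q := (pb orbit_map).

Lemma y_alg a : pb y (f a) = alpha_ev0 a.
Proof. by rewrite -[LHS]/(pb (compm (gproj Y) y) a) hy. Qed.

Lemma rho_alg a : rho (f a) = tin1 strC strB (f a).
Proof. by rewrite -[LHS]/(pb (compm (gproj Y) (gact Y)) a) proj_act. Qed.

Lemma orbit_alg a : q (f a) = strB (alpha_ev0 a).
Proof.
rewrite -[LHS]/(pb (pairm (compm y (to_base G)) (idm G)) (rho (f a))) rho_alg.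
by rewrite /tin1 pb_pairm rmorph1 mulr1 -y_alg.
Qed.

Lemma orbit_one : compm orbit_map (gone G) = y.
Proof.
rewrite /orbit_map compE !pair_compE compE.
have := congr1 (fun w => compm w y) (act1 Y); rewrite !(compE, pair_compE) => {2}<-.
congr (compm _ (pairm _ _)).
  by rewrite (to_base_uniq (compm (to_base G) (gone G)) (idm base)) compm1.
by rewrite (to_base_uniq (compm (to_base Y) y) (idm base)) compm1.
Qed.

Lemma alpha_x_top (a : A) : a * x ^+ p.-1 = alpha_str p (alpha_ev0 a) * x ^+ p.-1.
Proof.
have [a' {1}->] := alpha_decomp a; rewrite mulrDl mulrAC -exprS prednK //.
by rewrite alpha_x_nil // mul0r addr0.
Qed.

(** Multiplication by x^(p-1) is an injective A-linear map K -> A, where x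
    acts by zero on K; by flatness it stays injective after tensoring with C,
    and K (x)_A C maps to B by q. *)
Lemma flat_top (c : C) : f x ^+ p.-1 * c = 0 -> q c = 0.
Proof.
move=> xc; have [[fl _] _] := hY.
pose M := restr (@alpha_ev0 K p : {rmorphism A -> K}).
pose N := restr (@idfun A : {rmorphism A -> A}).
pose g (k : M) : N := alpha_str p k * x ^+ p.-1.
have gD : zmod_morphism g by move=> k l; rewrite /g rmorphB mulrBl.
have gZ : scalable g.
  move=> a k; rewrite /g -[a *: k]/(alpha_ev0 a * k) rmorphM.
  rewrite -[RHS]/(a * (alpha_str p k * x ^+ p.-1)) [RHS]mulrCA
    [X in _ = _ * X]alpha_x_top.
  by rewrite -[LHS]mulrA mulrCA.
pose gl : {linear M -> N} := HB.pack g (GRing.isZmodMorphism.Build _ _ g gD)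
  (GRing.isScalable.Build _ _ _ _ g gZ).
have g_ker (m : K) : gl m = 0 -> m = 0.
  move=> gm; have : polyn (gl m) = m *: 'X^(p.-1).
    rewrite -[gl m]/(alpha_str p m * x ^+ p.-1) alpha_xX poly_of_qpolyM
      in_qpoly_small; last first.
      by rewrite mk_monic_Xn !size_polyXn.
    rewrite /alpha_str qpolyCE mk_monic_Xn Pdiv.Ring.rmodp_small ?mul_polyC // size_polyXn.
    by apply: leq_ltn_trans (size_scale_leq _ _) _; rewrite size_polyXn.
  rewrite gm /= => /(congr1 (fun P : {poly K} => P`_p.-1)).
  by rewrite coef0 coefZ coefXn eqxx mulr1 => <-.
have g_inj : injective gl.
  move=> k l kl; apply/eqP; rewrite -subr_eq0; apply/eqP/g_ker.
  by rewrite [LHS](linearB gl) -[gl l]kl subrr.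
pose Cm : lmodType (ring_of (alpha K p)) := restr (pb (gproj Y)).
have := fl M N gl g_inj (@pure _ (M : lmodType (ring_of (alpha K p))) Cm (1 : K) (c : Cm)) 0.
have bg : balanced (fun (m : M) (n : Cm) => pure (gl m) n).
  split=> [m m' n|m n n'|a m n]; rewrite ?raddfD ?linearZ ?pureDl ?pureDr //.
  exact: pureZ.
rewrite /tens_map (tens_lift0 bg) (tens_lift_pure bg).
have -> : pure (gl 1) (c : Cm) = 0.
  rewrite /= /g rmorph1 mul1r.
  have -> : x ^+ p.-1 = x ^+ p.-1 *: (1 : N) by rewrite -[RHS]/(x ^+ p.-1 * 1) mulr1.
  rewrite pureZ; have -> : x ^+ p.-1 *: (c : Cm) = 0.
    by rewrite -[LHS]/(f (x ^+ p.-1) * c) rmorphXn xc.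
  exact: pure0r.
move=> /(_ erefl) e.
have bq : balanced (fun (k : M) (c : Cm) => strB k * q c).
  split=> [m m' n|m n n'|a m n].
  - by rewrite rmorphD mulrDl.
  - by rewrite rmorphD mulrDr.
  - rewrite -[a *: m]/(alpha_ev0 a * (m : K) : K) -[a *: n]/(f a * (n : C) : C).
    by rewrite rmorphM [in LHS]rmorphM orbit_alg mulrCA mulrA.
have := congr1 (tens_lift (fun (k : M) (c : Cm) => strB k * q c)) e.
by rewrite (tens_lift_pure bq) (tens_lift0 bq) rmorph1 mul1r.
Qed.

Lemma y_orbit c : q c = 0 -> pb y c = 0.
Proof. by move=> qc; rewrite -orbit_one -[LHS]/(pb (gone G) (q c)) qc rmorph0. Qed.

Lemma y_str k : pb y (strC k) = k.
Proof. exact: (pbE y k). Qed.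

(** A is a Frobenius algebra over K: a K-linear functional l on C determines
    the A-linear map c |-> sum_j l(x^(p-1-j) c) x^j to A. It reduces to y
    modulo x as soon as l(x^(p-1) c) = y(c), and a functional with this
    property exists because x^(p-1) c determines y(c). *)
Lemma lift_point : exists lam : C -> A,
  is_lin f (@idfun A : {rmorphism A -> A}) lam /\ forall c, alpha_ev0 (lam c) = pb y c.
Proof.
have [||l [[lD lZ] l0 l1]] := @linear_functional K C strC
  (fun d => exists2 c, pb y c = 0 & d = f x ^+ p.-1 * c) (f x ^+ p.-1).
- split=> [|d d' [c yc ->] [c' yc' ->]|k d [c yc ->]].
  + by exists 0; rewrite ?rmorph0 ?mulr0.
  + by exists (c + c'); rewrite ?rmorphD /= ?yc ?yc' ?addr0 ?mulrDr.
  + by exists (strC k * c); rewrite ?rmorphM /= ?yc ?mulr0 // mulrCA.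
- case=> c yc /eqP; rewrite -subr_eq0 -{1}[_ ^+ _]mulr1 -mulrBr => /eqP/flat_top/y_orbit.
  by rewrite rmorphB rmorph1 yc subr0 => /eqP; rewrite oner_eq0.
have lsum (I : finType) (F : I -> C) : l (\sum_i F i) = \sum_i l (F i).
  by apply: (lin_sum (conj lD lZ)).
pose lam c : A := \sum_(j < p.-1.+1) alpha_str p (l (f x ^+ (p.-1 - j) * c)) * x ^+ j.
have lamD c d : lam (c + d) = lam c + lam d.
  rewrite /lam -big_split; apply: eq_bigr => j _ /=.
  by rewrite mulrDr lD rmorphD mulrDl.
have lam0 : lam 0 = 0 by apply: (addIr (lam 0)); rewrite -lamD !add0r.
have lamk k c : lam (strC k * c) = alpha_str p k * lam c.
  rewrite /lam mulr_sumr; apply: eq_bigr => j _.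
  by rewrite mulrCA lZ rmorphM mulrA.
have lamx c : lam (f x * c) = x * lam c.
  rewrite /lam big_ord_recl [in RHS]big_ord_recr /= subn0 subnn.
  rewrite mulrA -exprSr prednK // -rmorphXn alpha_x_nil // rmorph0 mul0r.
  have -> : l 0 = 0 by apply: (addIr (l 0)); rewrite -lD !add0r.
  rewrite rmorph0 mul0r add0r mulrDr mulr_sumr mulrCA -exprS prednK //.
  rewrite alpha_x_nil // mulr0 addr0; apply: eq_bigr => j _.
  rewrite [RHS]mulrCA -exprS; congr (alpha_str p (l _) * _).
  by rewrite mulrA -exprSr subnSK.
have lamxn c n : lam (f x ^+ n * c) = x ^+ n * lam c.
  elim: n => [|n IH]; first by rewrite !mul1r.
  by rewrite !exprS -!mulrA lamx IH.
exists lam; split; first split=> // a c.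
  rewrite {1}(qpoly_expand a) rmorph_sum mulr_suml (big_morph lam lamD lam0).
  rewrite [in RHS](qpoly_expand a) mulr_suml; apply: eq_bigr => j _.
  by rewrite rmorphM rmorphXn -!mulrA alg_str lamk lamxn.
move=> c; rewrite /lam rmorph_sum big_ord_recl /= subn0 big1.
  rewrite addr0 mulr1 alpha_ev0_str.
  have {1}-> : c = (c - strC (pb y c)) + strC (pb y c) by rewrite subrK.
  rewrite mulrDr lD l0 ?add0r; last first.
    by exists (c - strC (pb y c)); rewrite // rmorphB /= y_str subrr.
  by rewrite mulrC lZ l1 mulr1.
move=> j _; rewrite rmorphM rmorphXn /=; have [p1|p1] := ltnP 1 p.
  by rewrite alpha_ev0_x // expr0n mulr0.
have := ltn_ord j; rewrite ltnNge => /negP[].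
by move: (nat_of_ord j) => n; rewrite -subn1 leq_subLR (leq_trans p1).
Qed.

Variable lam : C -> A.
Hypotheses (lam_lin : is_lin f (@idfun A : {rmorphism A -> A}) lam)
  (lam_y : forall c, alpha_ev0 (lam c) = pb y c).

Local Notation P := (fib (gproj Y) (gproj Y)).
Variable v : mor P (prodm Y G).
Hypotheses (can_v : compm (canonical_map Y) v = idm P)
  (v_can : compm v (canonical_map Y) = idm (prodm Y G)).

Local Notation diff := (compm pr2 v).
(** The map id (x) lam : C (x)_A C -> C. *)
Definition retract (t : ring_of P) : C := tright lam (t : tring f f).
Local Notation L := retract.

Lemma retractD (t u : ring_of P) : L (t + u) = L t + L u.
Proof. exact: trightD. Qed.
Lemma retract0 : L 0 = 0.
Proof. exact: tright0. Qed.
Lemma retract_pure c c' : L (tpure (pb (gproj Y)) (pb (gproj Y)) c c') = c * f (lam c').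
Proof. exact: tright_pure. Qed.

Lemma can_pair T (a : mor T Y) (g : mor T G) :
  compm v (compm (canonical_map Y) (pairm a g)) = pairm a g.
Proof. by rewrite Defs.compA v_can comp1m. Qed.

Lemma fst_can T (a : mor T Y) (g : mor T G) :
  compm (fst_fib (gproj Y) (gproj Y)) (compm (canonical_map Y) (pairm a g))
  = compm (gact Y) (pairm a g).
Proof. by rewrite Defs.compA fst_pair. Qed.
Lemma snd_can T (a : mor T Y) (g : mor T G) :
  compm (snd_fib (gproj Y) (gproj Y)) (compm (canonical_map Y) (pairm a g)) = a.
Proof. by rewrite Defs.compA snd_pair pr1_pair. Qed.

Lemma diffE T (a b : mor T Y) (g : mor T G) (w : mor T P) :
  compm (fst_fib (gproj Y) (gproj Y)) w = compm (gact Y) (pairm a g) ->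
  compm (snd_fib (gproj Y) (gproj Y)) w = a -> compm diff w = g.
Proof.
move=> w1 w2; have -> : w = compm (canonical_map Y) (pairm a g).
  by apply: fib_ext; rewrite ?fst_can ?snd_can.
by rewrite -Defs.compA can_pair pr2_pair.
Qed.

Lemma pr1_inv : compm pr1 v = snd_fib (gproj Y) (gproj Y).
Proof.
rewrite -[RHS]compm1 -can_v Defs.compA; congr (compm _ _).
by rewrite snd_pair.
Qed.

Lemma diff_act : compm (gact Y) (pairm (snd_fib (gproj Y) (gproj Y)) diff)
  = fst_fib (gproj Y) (gproj Y).
Proof.
have e : pairm (snd_fib (gproj Y) (gproj Y)) diff = v.
  apply: prod_ext; rewrite ?pr1_pair ?pr2_pair //.
  by rewrite pr1_inv.
by rewrite e -[RHS]compm1 -can_v Defs.compA fst_pair.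
Qed.

Lemma diff_yy : compm diff (pair_fib (erefl (compm (gproj Y) y))) = gone G.
Proof.
apply: (@diffE _ y y); rewrite ?fst_pair ?snd_pair //.
have := congr1 (fun w => compm w y) (act1 Y); rewrite !(compE, pair_compE).
by rewrite (to_base_uniq (compm (to_base Y) y) (idm base)) compm1 => ->.
Qed.

Lemma act1_comm : compm (gproj Y)
    (compm (gact Y) (pairm (compm (fst_fib (gproj Y) (gproj Y)) (pr1 (Y := P) (Z := G))) pr2))
  = compm (gproj Y) (compm (snd_fib (gproj Y) (gproj Y)) pr1).
Proof. by rewrite Defs.compA proj_act compE pr1_pair !Defs.compA fib_comm. Qed.

Definition act_fst : mor (prodm P G) P := pair_fib act1_comm.

(** The point diff(y1, y2) of G is the g such that y1 = y2.g, so that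
    diff(y1.h, y2) = diff(y1, y2).h. *)
Lemma diff_equivariant : compm diff act_fst = compm (gmul G) (pairm (compm diff pr1) pr2).
Proof.
apply: (@diffE _ (compm (snd_fib (gproj Y) (gproj Y)) pr1)
                 (compm (snd_fib (gproj Y) (gproj Y)) pr1)); last by rewrite snd_pair.
rewrite fst_pair -actAp; congr (compm _ (pairm _ _)).
have := congr1 (fun w => compm w (pr1 (Y := P) (Z := G))) diff_act.
by rewrite !(compE, pair_compE) => ->.
Qed.

Lemma L_lin : is_lin (str_map P) strC L.
Proof.
split=> [t u|k t]; first exact: retractD.
elim/tring_ind: t => [|t u et eu|c c']; first by rewrite mulr0 retract0 mulr0.
  by rewrite mulrDr !retractD et eu mulrDr.
by rewrite -[str_map P k]/(tin1 (pb (gproj Y)) (pb (gproj Y)) (strC k)) /tin1 tpureM mul1r !retract_pure mulrA.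
Qed.

(** The cleaving map O(G) -> O(Y), a morphism of comodules and a section of
    the orbit map. *)
Definition cleave (b : B) : C := L (pb diff b).

Lemma diff_lin : is_lin strB (str_map P) (pb diff).
Proof. by split=> [b b'|k b]; rewrite ?rmorphD // rmorphM (pbE diff). Qed.

Lemma cleave_lin : is_lin strB strC cleave.
Proof.
have [LD LZ] := L_lin; have [dD dZ] := diff_lin.
by split=> [b b'|k b]; rewrite /cleave ?dD ?LD // dZ LZ.
Qed.

Lemma rho_L t : rho (L t) = tmap1 (g := strB) strC L (pb act_fst t).
Proof.
elim/tring_ind: t => [|t u et eu|c c'].
- by rewrite !rmorph0 retract0 rmorph0 (tmap1_0 _ L_lin).
- by rewrite !rmorphD retractD rmorphD et eu (tmap1D L_lin).
rewrite retract_pure rmorphM rho_alg tpureE rmorphM.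
have -> : pb act_fst (tin2 (pb (gproj Y)) (pb (gproj Y)) c') = tin1 (str_map P) strB (tin2 (pb (gproj Y)) (pb (gproj Y)) c') by apply: tcop2.
have -> : pb act_fst (tin1 (pb (gproj Y)) (pb (gproj Y)) c) = pb (pairm (compm (fst_fib (gproj Y) (gproj Y))
    (pr1 (Y := P) (Z := G))) pr2) (rho c) by apply: tcop1.
elim/tring_ind: (rho c) => [|t u et eu|d b].
- by rewrite rmorph0 !mul0r (tmap1_0 _ L_lin).
- by rewrite rmorphD !mulrDl (tmap1D L_lin) et eu.
rewrite pb_pairm -[pb (compm _ _) d]/(tin1 (str_map P) strB (tin1 (pb (gproj Y)) (pb (gproj Y)) d)).
rewrite -[pb pr2 b]/(tin2 _ _ b) mulrAC -rmorphM /= -tpureE.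
by rewrite /tin1 tpureM mulr1 tpureM mulr1 (tmap1_pure _ L_lin) mul1r retract_pure.
Qed.

Lemma rho_cleave b : rho (cleave b) = tmap1 (g := strB) strC cleave (delta b).
Proof.
rewrite /cleave rho_L; have := congr1 (fun w => pb w b) diff_equivariant.
rewrite -[LHS]/(pb act_fst (pb diff b)) => ->.
rewrite -[pb (compm _ _) b]/(pb (pairm (compm diff pr1) pr2) (delta b)).
elim/tring_ind: (delta b) => [|t u et eu|d d'].
- by rewrite rmorph0 (tmap1_0 _ L_lin) (tmap1_0 _ cleave_lin).
- by rewrite rmorphD (tmap1D L_lin) et eu (tmap1D cleave_lin).
rewrite pb_pairm (tmap1_pure _ cleave_lin) -[pb pr2 d']/(tin2 _ _ d').
by rewrite -[pb (compm _ _) d]/(tin1 (str_map P) strB (pb diff d)) -tpureE (tmap1_pure _ L_lin).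
Qed.

Lemma y_cleave b : pb y (cleave b) = pb (gone G) b.
Proof.
have yL t : pb y (L t) = pb (pair_fib (erefl (compm (gproj Y) y))) t.
  elim/tring_ind: t => [|t u et eu|c c'].
  - by rewrite retract0 !rmorph0.
  - by rewrite retractD !rmorphD et eu.
  by rewrite retract_pure rmorphM y_alg lam_y [RHS]tcop_pure.
by rewrite /cleave yL; have := congr1 (fun w => pb w b) diff_yy.
Qed.

Lemma orbit_cleave b : q (cleave b) = b.
Proof.
rewrite -[LHS]/(pb (pairm (compm y (to_base G)) (idm G)) (rho (cleave b))) rho_cleave.
have := congr1 (fun w => pb w b) (gmul1l G); rewrite -[RHS]/b => {2}<-.
rewrite -[RHS]/(pb (pairm (compm (gone G) (to_base G)) (idm G)) (delta b)).
elim/tring_ind: (delta b) => [|t u et eu|d d'].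
- by rewrite (tmap1_0 _ cleave_lin) !rmorph0.
- by rewrite (tmap1D cleave_lin) !rmorphD et eu.
by rewrite (tmap1_pure _ cleave_lin) !pb_pairm -[pb (compm y _) _]/(strB (pb y (cleave d))) y_cleave.
Qed.

Lemma alg_ev0 a : alpha_ev0 a = 0 -> exists a', f a = f x * f a'.
Proof.
move=> a0; have [a' aE] := alpha_decomp a.
by exists a'; rewrite aE a0 rmorph0 add0r rmorphM.
Qed.

(** Let psi : C (x) B -> C be the inverse of the torsor isomorphism followed
    by id (x) lam. It sends rho(c) to c lam(1), which is c modulo x. Modulo x
    it also factors through y on the first factor C, because lam reduces to y;
    hence c is modulo x the image of 1 (x) q(c) = 0. *)
Lemma orbit_ker c : q c = 0 -> exists c', c = f x * c'.
Proof.
move=> qc; pose X d := exists c', d = f x * c'.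
have XD d d' : X d -> X d' -> X (d + d').
  by move=> [e ->] [e' ->]; exists (e + e'); rewrite mulrDr.
have X0 : X 0 by exists 0; rewrite mulr0.
have Xj j t : pb y j = 0 -> X (L (tin2 (pb (gproj Y)) (pb (gproj Y)) j * t)).
  move=> yj; elim/tring_ind: t => [|t u et eu|d d'].
  - by rewrite mulr0 retract0.
  - by rewrite mulrDr retractD; apply: XD.
  rewrite /tin2 tpureM mul1r retract_pure.
  have [|a' ->] := @alg_ev0 (lam (j * d')); first by rewrite lam_y rmorphM yj mul0r.
  by exists (d * f a'); rewrite mulrCA.
pose psi u := L (pb v u).
have key u : X (psi u - psi (tin2 strC strB (pb (pairm (compm y (to_base G)) (idm G)) u))).
  elim/tring_ind: u => [|t u et eu|d b].
  - by rewrite !rmorph0 subrr.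
  - rewrite /psi !rmorphD !retractD opprD addrACA; exact: XD.
  rewrite pb_pairm -[pb (compm y _) d]/(strB (pb y d)) -[pb (idm G) b]/b.
  rewrite /tin2 -tpureZ mulr1 /psi -(linB L_lin) -rmorphB.
  have -> : tpure strC strB d b - tpure strC strB (strC (pb y d)) b
      = tpure strC strB (d - strC (pb y d)) b.
    by apply/eqP; rewrite subr_eq -tpureDl subrK.
  rewrite tpureE rmorphM.
  have := congr1 (fun w => pb w (d - strC (pb y d))) pr1_inv.
  rewrite -[LHS]/(pb v (tin1 strC strB _)) => ->.
  by apply: Xj; rewrite rmorphB y_str subrr.
have := key (rho c); rewrite -[pb (pairm _ _) (rho c)]/(q c) qc rmorph0.
have -> : psi 0 = 0 by rewrite /psi rmorph0 retract0.
have -> : psi (rho c) = c * f (lam 1).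
  have -> : rho c = pb (canonical_map Y) (tin1 (pb (gproj Y)) (pb (gproj Y)) c) by rewrite [RHS]tcop_pure rmorph1 mulr1.
  have := congr1 (fun w : mor P P => pb w (tin1 (pb (gproj Y)) (pb (gproj Y)) c)) can_v.
  rewrite -[LHS]/(pb v (pb (canonical_map Y) _)) /psi => ->.
  by rewrite -[pb (idm P) _]/(tpure (pb (gproj Y)) (pb (gproj Y)) c 1) retract_pure.
rewrite subr0 => -[e cE].
have [a' lE] : exists a', lam 1 = 1 + x * a'.
  have [a' {1}->] := alpha_decomp (lam 1); exists a'.
  by rewrite lam_y rmorph1 rmorph1.
have XE : c * f (1 + x * a') = c + f x * (f a' * c).
  by rewrite rmorphD rmorph1 rmorphM mulrDr mulr1 mulrC mulrA [_ * c]mulrC.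
by exists (e - f a' * c); rewrite mulrBr -cE lE XE addrK.
Qed.

End PointedTorsor.

Section LiftInverse.
Variables (C B : comPzRingType) (q : {rmorphism C -> B}) (z : C) (p : nat).
Hypotheses (zp : z ^+ p = 0) (q_surj : forall b, exists c, q c = b).
Hypothesis q_ker : forall c, q c = 0 -> exists c', c = z * c'.

Lemma lift_matrix n (s : 'M[B]_n) : exists e : 'M[C]_n, map_mx q e = s.
Proof.
have /fin_all_exists[g gE] : forall ij : 'I_n * 'I_n, exists c, q c = s ij.1 ij.2.
  by move=> ij; apply: q_surj.
exists (\matrix_(i, j) g (i, j)); apply/matrixP => i j.
by rewrite !mxE gE.
Qed.

(** A lift e0 of the inverse satisfies c e0 = 1 - z N, and the geometric
    series in z N is finite. *)
Lemma lift_rinverse n (c : 'M[C]_n) (s : 'M[B]_n) :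
  map_mx q c *m s = 1%:M -> exists e, c *m e = 1%:M.
Proof.
move=> cs; have [e0 e0E] := lift_matrix s.
have [N NE] : exists N, 1%:M - c *m e0 = z *: N.
  have /fin_all_exists[g gE] : forall ij : 'I_n * 'I_n, exists w,
      (1%:M - c *m e0) ij.1 ij.2 = z * w.
    move=> [i j]; apply: q_ker => /=.
    have := congr1 (fun m : 'M_n => m i j) (map_mxB q 1%:M (c *m e0)).
    by rewrite map_mx1 map_mxM e0E cs subrr mxE [RHS]mxE => ->.
  by exists (\matrix_(i, j) g (i, j)); apply/matrixP => i j; rewrite (gE (i, j)) !mxE.
have key j : exists e M, c *m e = 1%:M - z ^+ j *: M.
  elim: j => [|j [e [M eE]]].
    by exists 0, 1%:M; rewrite mulmx0 scale1r subrr.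
  exists (e + e0 *m (z ^+ j *: M)), (N *m M).
  have ce0 : c *m e0 = 1%:M - z *: N by rewrite -NE opprB addrC subrK.
  rewrite mulmxDr eE mulmxA ce0 mulmxBl mul1mx addrA subrK.
  by rewrite -scalemxAl -scalemxAr scalerA exprS.
by have [e [M]] := key p; rewrite zp scale0r subr0; exists e.
Qed.

Lemma lift_inverse n (c : 'M[C]_n) (s : 'M[B]_n) :
  map_mx q c *m s = 1%:M -> s *m map_mx q c = 1%:M ->
  exists e, c *m e = 1%:M /\ e *m c = 1%:M.
Proof.
move=> /lift_rinverse[e ce] sc.
have [|e' ce'] := @lift_rinverse _ c^T s^T.
  by rewrite -map_trmx -trmx_mul sc trmx1.
exists e; split=> //; suff -> : e = e'^T.
  by apply: trmx_inj; rewrite trmx_mul trmxK trmx1.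
rewrite -[RHS]mulmx1 -ce mulmxA.
have -> : e'^T *m c = 1%:M by apply: trmx_inj; rewrite trmx_mul trmxK trmx1.
by rewrite mul1mx.
Qed.
End LiftInverse.

Section TorsorData.
Variables (K : fieldType) (p : nat) (G : grp K) (Y : gspace G (alpha K p)).
Hypotheses (p_gt0 : (0 < p)%N) (hG : finite_type G) (hY : is_torsor Y).
Variables (y : mor base Y) (hy : compm (gproj Y) y = alpha_unit K p).
Local Notation x := (alg_map Y (alpha_x K p)).
Local Notation q := (pb (orbit_map y)).
Local Notation tC := (tin1 (str_map Y) (str_map G)).
Local Notation tB := (tin2 (str_map Y) (str_map G)).

Lemma alg_x_nil : x ^+ p = 0.
Proof. by rewrite -rmorphXn alpha_x_nil // rmorph0. Qed.

Lemma torsor_orbit_surj b : exists c, q c = b.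
Proof.
have [_ [v [can_v v_can]]] := hY; have [lam [lam_lin lam_y]] := lift_point p_gt0 hY hy.
by exists (cleave lam v b); apply: orbit_cleave.
Qed.

Lemma torsor_orbit_ker c : q c = 0 -> exists c', c = x * c'.
Proof.
have [_ [v [can_v v_can]]] := hY; have [lam [lam_lin lam_y]] := lift_point p_gt0 hY hy.
by apply: (orbit_ker lam_lin lam_y can_v).
Qed.

(** The matrix c is the image of d under the cleaving map. *)
Lemma torsor_matrices : exists n (d s : 'M[ring_of G]_n) (c e : 'M[ring_of Y]_n),
  [/\ mx_comul d, map_mx (pb (gone G)) d = 1%:M, map_mx (pb (ginv G)) d = s,
      s *m d = 1%:M /\ d *m s = 1%:M
    & forall b E, is_subring E -> (forall k, E (str_map G k)) -> (forall i j, E (d i j)) -> E b] /\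
  [/\ c *m e = 1%:M, e *m c = 1%:M, map_mx q c = d
    & map_mx (pb (gact Y)) c = map_mx tC c *m map_mx tB d].
Proof.
have [n [d [dM dU sd ds dgen]]] := matrix_generators hG.
have [_ [v [can_v v_can]]] := hY; have [lam [lam_lin lam_y]] := lift_point p_gt0 hY hy.
pose c := map_mx (cleave lam v) d.
have qc : map_mx q c = d.
  by apply/matrixP => i j; rewrite !mxE (orbit_cleave hy lam_lin lam_y can_v v_can).
have [||e [ce ec]] := @lift_inverse _ _ q _ _ alg_x_nil torsor_orbit_surj
  torsor_orbit_ker n c (map_mx (pb (ginv G)) d).
- by rewrite qc.
- by rewrite qc.
exists n, d, (map_mx (pb (ginv G)) d), c, e; split; split=> //.
apply/matrixP => i j; rewrite [LHS]mxE [RHS]mxE.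
have cl := cleave_lin lam_lin v.
rewrite [c i j]mxE (rho_cleave lam_lin can_v v_can).
have -> : pb (gmul G) (d i j) = \sum_k tpure _ _ (d i k) (d k j).
  have := congr1 (fun m : 'M_n => m i j) dM; rewrite mxE [RHS]mxE => ->.
  by apply: eq_bigr => k _; rewrite tpureE !mxE.
rewrite (big_morph _ (tmap1D cl) (tmap1_0 _ cl)); apply: eq_bigr => k _.
by rewrite (tmap1_pure _ cl) tpureE; congr (_ * _); rewrite !mxE.
Qed.
End TorsorData.

(** * Integral models *)

Lemma common_denominator (A : comPzRingType) (S : A -> Prop) (I : finType)
    (Q : I -> A -> Prop) :
  S 1 -> (forall s t, S s -> S t -> S (s * t)) ->
  (forall i, exists2 s, S s & Q i s) ->
  (forall i s t, Q i s -> S t -> Q i (t * s)) ->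
  exists2 s, S s & forall i, Q i s.
Proof.
move=> S1 SM ex QM; suff [s Ss sQ] : exists2 s, S s & forall i, i \in enum I -> Q i s.
  by exists s => // i; apply: sQ; rewrite mem_enum.
elim: (enum I) => [|i l [s Ss sQ]]; first by exists 1.
have [t St tQ] := ex i; exists (s * t); first exact: SM.
move=> j; rewrite inE => /predU1P[->|/sQ js]; first exact: QM.
by rewrite mulrC; apply: QM.
Qed.

Section LocalizedTensor.
Variables (A' A C' C D' D : comPzRingType).
Variables (f' : {rmorphism A' -> C'}) (g' : {rmorphism A' -> D'})
  (f : {rmorphism A -> C}) (g : {rmorphism A -> D})
  (jA : {rmorphism A' -> A}) (jC : {rmorphism C' -> C}) (jD : {rmorphism D' -> D}).
Variable S : A' -> Prop.
Hypotheses (S1 : S 1) (SM : forall s t, S s -> S t -> S (s * t)).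
Hypotheses (fj : forall a, f (jA a) = jC (f' a)) (gj : forall a, g (jA a) = jD (g' a)).
Hypotheses (jC_inj : injective jC) (jD_inj : injective jD).
Hypothesis denA : forall a, exists2 s, S s & exists a', jA s * a = jA a'.
Hypothesis denD : forall d, exists2 s, S s & exists d', g (jA s) * d = jD d'.
Hypothesis S_reg : forall s c, S s -> f' s * c = 0 -> c = 0.
Hypotheses (g_flat : eq_flat (restr g)) (g'_flat : eq_flat (restr g')).

Lemma tpure_system (I J : finType) (c : I -> C') (d : I -> D') (b : I -> J -> A') (e : J -> D') :
  (forall i, d i = \sum_k g' (b i k) * e k) -> (forall k, \sum_i f' (b i k) * c i = 0) ->
  \sum_i tpure f' g' (c i) (d i) = 0.
Proof.
move=> dE c0; transitivity (\sum_k tpure f' g' (\sum_i f' (b i k) * c i) (e k)).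
  under [RHS]eq_bigr do rewrite tpure_suml.
  rewrite exchange_big; apply: eq_bigr => i _ /=; rewrite dE tpure_sumr.
  by apply: eq_bigr => k _; rewrite tpureZ.
by apply: big1 => k _; rewrite c0 tpure0l.
Qed.

(** Here A, C and D are localizations of A', C' and D' at S. If t vanishes in
    C (x)_A D, flatness of D expresses this by finitely many scalars, which
    become integral after multiplication by some s in S; so s t = 0.
    Multiplication by s is injective on C', hence, D' being flat, on C' (x)
    D'. *)
Lemma localized_tensor_inj (h : {rmorphism tring f' g' -> tring f g}) :
  (forall c d, h (tpure f' g' c d) = tpure f g (jC c) (jD d)) -> injective h.
Proof.
move=> hE; suff h0 t : h t = 0 -> t = 0.
  by move=> t u tu; apply/eqP; rewrite -subr_eq0; apply/eqP/h0; rewrite rmorphB tu subrr.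
have [n [c [d ->]]] := tring_sum t; rewrite rmorph_sum.
under eq_bigr do rewrite hE.
move=> /(@tens_eq0 A (restr g) g_flat (restr f) 'I_n (jC \o c) (jD \o d)).
move=> [J [b [e [dE c0]]]].
have [s Ss sb] : exists2 s, S s & forall ik : 'I_n * J, exists b', jA s * b ik.1 ik.2 = jA b'.
  apply: common_denominator => // ik s u [b' bE] Su.
  by exists (u * b'); rewrite !rmorphM -mulrA bE.
have [s' Ss' se] : exists2 s, S s & forall k, exists e', g (jA s) * e k = jD e'.
  apply: common_denominator => // k u v [e' eE] Sv.
  by exists (g' v * e'); rewrite !rmorphM -mulrA eE /= gj.
have [b' b'E] := fin_all_exists sb; have [e' e'E] := fin_all_exists se.
have dE' i : g' (s * s') * d i = \sum_k g' (b' (i, k)) * e' k.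
  apply: jD_inj; rewrite rmorphM -gj [jD (d i)]dE mulr_sumr rmorph_sum.
  apply: eq_bigr => k _; rewrite !rmorphM /= -gj -e'E -b'E rmorphM /=.
  by rewrite mulrACA.
have c0' k : \sum_i f' (b' (i, k)) * c i = 0.
  apply: jC_inj; rewrite rmorph0 rmorph_sum.
  transitivity (f (jA s) * \sum_i f (b i k) * jC (c i)).
    rewrite mulr_sumr; apply: eq_bigr => i _.
    by rewrite rmorphM /= -fj -b'E rmorphM mulrA.
  by have := c0 k => /= ->; rewrite mulr0.
have : \sum_i tpure f' g' (f' (s * s') * c i) (d i) = 0.
  under eq_bigr do rewrite tpureZ.
  exact: (tpure_system dE' c0').
move=> /(@tens_eq0 A' (restr g') g'_flat (restr f') 'I_n (fun i => f' (s * s') * c i) d).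
move=> [H [be [h' [dE2 c2]]]]; apply: (tpure_system dE2) => k.
apply: (@S_reg (s * s')); first exact: SM.
rewrite mulr_sumr -[RHS](c2 k); apply: eq_bigr => i _.
by rewrite mulrCA.
Qed.
End LocalizedTensor.

Lemma field_valuation_ring (K : fieldType) : valuation_ring K.
Proof.
move=> a b; have [->|a0] := eqVneq a 0; first by right; exists 0; rewrite mul0r.
by left; exists (b / a); rewrite divfK.
Qed.

Lemma field_torsion_free (K : fieldType) (B : comPzRingType) (f : {rmorphism K -> B}) :
  torsion_free f.
Proof.
move=> s b s0 sb; have : f s^-1 * (f s * b) = 0 by rewrite sb mulr0.
by rewrite mulrA -rmorphM mulVf // rmorph1 mul1r.
Qed.

Lemma inj_surj_bij (T U : Type) (h : T -> U) :
  injective h -> (forall u, exists t, h t = u) -> bijective h.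
Proof.
move=> h_inj /choice[k kE]; exists k => // t; exact: h_inj.
Qed.

Section Models.
Variables (R : idomainType) (K : fieldType) (i : {rmorphism R -> K}).
Hypotheses (hR : valuation_ring R) (i_inj : injective i).
Hypothesis i_frac : forall k, exists2 r, r != 0 & exists r', i r * k = i r'.

(** T' is an R-form of T: its coordinate ring is a subring of that of T which
    spans it over K. *)
Definition is_model (T : aff K) (T' : aff R) (J : mor (res i T) T') : Prop :=
  injective (pb J) /\
  forall c, exists2 r, r != 0 & exists c', str_map T (i r) * c = pb J c'.

Lemma i_neq0 r : r != 0 -> i r != 0.
Proof. by move=> r0; rewrite -(inj_eq i_inj) rmorph0 in r0. Qed.

Lemma pb_model_str (T : aff K) (T' : aff R) (J : mor (res i T) T') r :
  pb J (str_map T' r) = str_map T (i r).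
Proof. exact: pbE. Qed.

Lemma model_torsion_free (T : aff K) (T' : aff R) (J : mor (res i T) T') :
  is_model J -> torsion_free (str_map T').
Proof.
move=> [J_inj _] r b r0 rb; apply: J_inj; rewrite rmorph0.
apply: (@field_torsion_free K _ (str_map T) (i r)); first exact: i_neq0.
by rewrite -(pb_model_str J) -rmorphM rb rmorph0.
Qed.

Lemma model_eq_flat (T : aff K) (T' : aff R) (J : mor (res i T) T') :
  is_model J -> eq_flat (restr (str_map T')).
Proof. by move=> /model_torsion_free; apply: torsion_free_eq_flat. Qed.

(** The comparison map of a model is an epimorphism, so that equations over R
    are checked over K. *)
Lemma model_ext (T : aff K) (T' Z' : aff R) (J : mor (res i T) T') (u v : mor T' Z') :
  is_model J -> compm u J = compm v J -> u = v.
Proof.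
move=> [J_inj _] uv; apply: mor_eq => z; apply: J_inj.
exact: (congr1 (fun w => pb w z) uv).
Qed.

Lemma model_lift (T : aff K) (T' Z' : aff R) (J : mor (res i T) T') (u : mor (res i T) Z') :
  is_model J -> (forall z, exists t, pb u z = pb J t) -> exists u' : mor T' Z', compm u' J = u.
Proof.
move=> [J_inj _] /choice[h hE].
have hz : zmod_morphism h by move=> a b; apply: J_inj; rewrite -hE [RHS]rmorphB /= -!hE rmorphB.
have hm : monoid_morphism h.
  by split=> [|a b]; apply: J_inj; rewrite -hE ?rmorph1 // [RHS]rmorphM /= -!hE rmorphM.
pose hM := GRing.isMonoidMorphism.Build _ _ h hm.
pose hZ := GRing.isZmodMorphism.Build _ _ h hz.
pose k : {rmorphism ring_of Z' -> ring_of T'} := HB.pack h hZ hM.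
have kE s : k (str_map Z' s) = str_map T' s.
  by apply: J_inj; rewrite /= -hE !pbE.
by exists (Mor kE); apply: mor_eq => z /=; rewrite -hE.
Qed.

Definition prod_J (T W : aff K) (T' W' : aff R) (J : mor (res i T) T')
    (J2 : mor (res i W) W') : mor (res i (prodm T W)) (prodm T' W') :=
  pairm (compm J (res_mor i pr1)) (compm J2 (res_mor i pr2)).

Lemma prod_J_pure (T W : aff K) (T' W' : aff R) (J : mor (res i T) T')
    (J2 : mor (res i W) W') a b :
  pb (prod_J J J2) (tpure _ _ a b) = tpure (str_map T) (str_map W) (pb J a) (pb J2 b).
Proof. by rewrite [LHS]tcop_pure tpureE. Qed.

Lemma prod_model (T W : aff K) (T' W' : aff R) (J : mor (res i T) T') (J2 : mor (res i W) W') :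
  is_model J -> is_model J2 -> is_model (prod_J J J2).
Proof.
move=> hJ hJ2; have [J_inj J_den] := hJ; have [J2_inj J2_den] := hJ2; split.
  apply: (@localized_tensor_inj R K (ring_of T') (ring_of T) (ring_of W') (ring_of W)
    (str_map T') (str_map W') (str_map T) (str_map W) i (pb J) (pb J2) (fun r => r != 0)).
  - exact: oner_neq0.
  - by move=> s t s0 t0; rewrite mulf_neq0.
  - by move=> a; rewrite pb_model_str.
  - by move=> a; rewrite pb_model_str.
  - by [].
  - by [].
  - exact: i_frac.
  - exact: J2_den.
  - exact: (model_torsion_free hJ).
  - exact: torsion_free_eq_flat (@field_valuation_ring K) (field_torsion_free (f := str_map W)).
  - exact: model_eq_flat hJ2.
  - exact: prod_J_pure.
elim/tring_ind => [|x y [r r0 [x' xE]] [s s0 [y' yE]]|a b].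
- by exists 1; [apply: oner_neq0|exists 0; rewrite mulr0 rmorph0].
- exists (r * s); first by rewrite mulf_neq0.
  exists (str_map _ s * x' + str_map _ r * y').
  rewrite rmorphD !rmorphM -xE -yE !(pb_model_str (prod_J J J2)) mulrDr !mulrA.
  by congr (_ * _ + _); rewrite mulrC.
- have [r r0 [a' aE]] := J_den a; have [s s0 [b' bE]] := J2_den b.
  exists (r * s); first by rewrite mulf_neq0.
  exists (tpure _ _ a' b'); rewrite prod_J_pure -aE -bE !rmorphM.
  rewrite -tpureZ -[str_map (prodm T W) _ in LHS]/(tin1 _ _ (str_map T (i r))).
  rewrite -[str_map (prodm T W) _ in LHS]/(tin1 _ _ (str_map T (i s))).
  by rewrite /tin1 !tpureM !mulr1 mul1r mulrA [str_map T (i s) * _]mulrC.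
Qed.

Lemma prod_J_pt (T W X : aff K) (T' W' : aff R) (J : mor (res i T) T') (J2 : mor (res i W) W')
    (a : mor X T) (b : mor X W) :
  compm (prod_J J J2) (res_mor i (pairm a b)) =
  pairm (compm J (res_mor i a)) (compm J2 (res_mor i b)).
Proof.
by rewrite /prod_J pair_comp -!Defs.compA -!res_comp ?pr1_pair ?pr2_pair.
Qed.

(** Every element of K (x)_R T' is r^-1 (x) c' for some r and c'. *)
Lemma model_bc_iso (T : aff K) (T' : aff R) (J : mor (res i T) T') :
  is_model J -> is_iso (bc_lift J).
Proof.
move=> [J_inj J_den]; apply/bij_is_iso/inj_surj_bij; last first.
  move=> c; have [r r0 [c' cE]] := J_den c.
  exists (tpure _ _ (i r)^-1 c'); rewrite [LHS]tcop_pure -cE mulrA -rmorphM.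
  by rewrite mulVf ?rmorph1 ?mul1r // i_neq0.
pose t1 := tin1 i (str_map T'); pose t2 := tin2 i (str_map T').
have den t : exists2 r, r != 0 & exists c', t1 (i r) * t = t2 c'.
  elim/tring_ind: t => [|x y [r r0 [x' xE]] [s s0 [y' yE]]|k b].
  - by exists 1; [apply: oner_neq0|exists 0; rewrite mulr0 /t2 rmorph0].
  - exists (r * s); first by rewrite mulf_neq0.
    exists (str_map _ s * x' + str_map _ r * y').
    rewrite /t2 rmorphD !rmorphM /= -!tin_comm -/t1 -/t2 -xE -yE mulrDr !mulrA.
    by rewrite /t1 !(rmorphM (tin1 i (str_map T'))) [tin1 _ _ (i s) * _]mulrC.
  - have [r r0 [r' rE]] := i_frac k; exists r => //.
    exists (str_map T' r' * b); rewrite /t1 /t2 tpureE mulrA -rmorphM rE rmorphM.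
    by rewrite /= tin_comm.
have t0 t : pb (bc_lift J) t = 0 -> t = 0.
  move=> Jt; have [r r0 [c' tE]] := den t.
  apply: (@field_torsion_free K _ (str_map (bc i T')) (i r)); first exact: i_neq0.
  rewrite -[LHS]/(t1 (i r) * t) tE.
  have : pb (bc_lift J) (t1 (i r) * t) = 0 by rewrite rmorphM Jt mulr0.
  rewrite tE [LHS]tcop2 => c0; have -> : c' = 0 by apply: J_inj; rewrite c0 rmorph0.
  by rewrite /t2 rmorph0.
by move=> t u tu; apply/eqP; rewrite -subr_eq0; apply/eqP/t0; rewrite rmorphB tu subrr.
Qed.

End Models.

Section FractionField.
Local Open Scope quotient_scope.

Lemma tofrac_frac (R : idomainType) (k : {fraction R}) :
  exists2 r, r != 0 & exists r', tofrac_morphism R r * k = tofrac_morphism R r'.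
Proof.
elim/quotW: k => x; exists x.2; first exact: denom_ratioP.
exists x.1.
rewrite -[tofrac_morphism R x.2]/(FracField.tofrac x.2) -[tofrac_morphism R x.1]/(FracField.tofrac x.1).
rewrite -[_ * _]/(FracField.mul _ _).
apply/eqP. rewrite !piE.
rewrite /= FracField.equivfE /FracField.mulf !numden_Ratio ?mulf_neq0 ?oner_neq0 ?denom_ratioP //.
by rewrite mulr1 mul1r mulrC.
Qed.
End FractionField.

(** * The integral model of the group *)

Section SubringType.
Variables (C : comPzRingType) (D : C -> Prop) (hD : is_subring D).

(** The proof that D is a subring is an argument because the ring structure on
    [subring_type] depends on it. *)
Definition subring_pred of is_subring D : {pred C} := fun c => `[< D c >].
Local Notation P := (subring_pred hD).

Lemma subring_predE c : c \in P <-> D c.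
Proof. by rewrite unfold_in; split=> /asboolP. Qed.

Fact subring_pred_closed : subring_closed P.
Proof.
have [D1 DB DM] := hD.
split=> [|x y /subring_predE Dx /subring_predE Dy|x y /subring_predE Dx /subring_predE Dy].
- exact/subring_predE.
- exact/subring_predE/DB.
- exact/subring_predE/DM.
Qed.

Record subring_type := SubringElt { subring_val : C; _ : subring_val \in P }.
HB.instance Definition _ := [isSub for subring_val].
HB.instance Definition _ := [Choice of subring_type by <:].
HB.instance Definition _ :=
  GRing.SubChoice_isSubComPzRing.Build C P subring_type subring_pred_closed.

Lemma subring_valP (c : subring_type) : D (val c).
Proof. exact/subring_predE/valP. Qed.

Lemma subring_valE c : D c -> exists c' : subring_type, val c' = c.
Proof. by move=> /subring_predE Dc; exists (SubringElt Dc). Qed.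

Variables (S : comPzRingType) (h : {rmorphism S -> C}) (hh : forall s, D (h s)).
Definition subring_corestr (s : S) : subring_type :=
  SubringElt (proj2 (subring_predE _) (hh s)).
Fact subring_corestr_zmod : zmod_morphism subring_corestr.
Proof. by move=> a b; apply: val_inj; rewrite /= rmorphB. Qed.
Fact subring_corestr_monoid : monoid_morphism subring_corestr.
Proof. by split=> [|a b]; apply: val_inj; rewrite /= ?rmorph1 ?rmorphM. Qed.
HB.instance Definition _ :=
  GRing.isZmodMorphism.Build S subring_type subring_corestr subring_corestr_zmod.
HB.instance Definition _ :=
  GRing.isMonoidMorphism.Build S subring_type subring_corestr subring_corestr_monoid.
End SubringType.

Section SubringModel.
Variables (R : idomainType) (K : fieldType) (i : {rmorphism R -> K}).
Variables (T : aff K) (D : ring_of T -> Prop).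
Hypotheses (hD : is_subring D) (Dstr : forall r, D (str_map T (i r))).

Lemma subring_model :
  (forall c, exists2 r, r != 0 & D (str_map T (i r) * c)) ->
  exists (T' : aff R) (J : mor (res i T) T'),
    [/\ is_model J, forall c, D (pb J c) & forall c, D c -> exists c', pb J c' = c].
Proof.
move=> den; pose h : {rmorphism R -> ring_of T} := (str_map T \o i).
pose T' := @Aff R (subring_type hD)
  (subring_corestr hD (h := h) Dstr : {rmorphism R -> subring_type hD}).
have JE s : (val : {rmorphism subring_type hD -> ring_of T}) (str_map T' s)
   = str_map (res i T) s by [].
exists T', (@Mor R (res i T) T' _ JE); split=> [|c|c]; last exact: subring_valE.
  split=> [|c]; first exact: val_inj.
  have [r r0 Drc] := den c; exists r => //.
  by have [c' c'E] := subring_valE hD Drc; exists c'.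
exact: subring_valP.
Qed.
End SubringModel.

Lemma image_subring (A B : comPzRingType) (h : {rmorphism A -> B}) :
  is_subring (fun b => exists a, b = h a).
Proof.
split=> [|_ _ [a ->] [a' ->]|_ _ [a ->] [a' ->]]; first by exists 1; rewrite rmorph1.
  by exists (a - a'); rewrite rmorphB.
by exists (a * a'); rewrite rmorphM.
Qed.

Lemma preim_subring (A B : comPzRingType) (h : {rmorphism A -> B}) (E : B -> Prop) :
  is_subring E -> is_subring (fun a => E (h a)).
Proof.
move=> [E1 EB EM]; split=> [|x y|x y]; rewrite ?rmorph1 ?rmorphB ?rmorphM //.
  exact: EB.
exact: EM.
Qed.

Lemma subalg_sub (C S : comPzRingType) (f : {rmorphism S -> C}) (s : seq C) (E : C -> Prop) :
  is_subring E -> (forall r, E (f r)) -> (forall g, g \in s -> E g) ->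
  forall c, subalg f s c -> E c.
Proof. by move=> hE Ef Es c; apply. Qed.

Definition entries (C : Type) n (m : 'M[C]_n) : seq C :=
  [seq m ij.1 ij.2 | ij : 'I_n * 'I_n].

Lemma entriesP (C : eqType) n (m : 'M[C]_n) (E : C -> Prop) :
  (forall i j, E (m i j)) -> forall g, g \in entries m -> E g.
Proof. by move=> Em g /fintype.imageP[ij _ ->]. Qed.

Lemma mem_entries (C : eqType) n (m : 'M[C]_n) i j : m i j \in entries m.
Proof. exact: (fintype.image_f (fun ij : 'I_n * 'I_n => m ij.1 ij.2) (x := (i, j))). Qed.

Lemma mx_inverse_uniq (C : comPzRingType) n (m a b : 'M[C]_n) :
  b *m m = 1%:M -> m *m a = 1%:M -> b = a.
Proof. by move=> bm ma; rewrite -[b]mulmx1 -ma mulmxA bm mul1mx. Qed.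

Section GroupModel.
Variables (R : idomainType) (K : fieldType) (i : {rmorphism R -> K}).
Hypotheses (hR : valuation_ring R) (i_inj : injective i).
Hypothesis i_frac : forall k, exists2 r, r != 0 & exists r', i r * k = i r'.

Lemma base_model : is_model (to_base (res i (base : aff K))).
Proof. by split. Qed.

Lemma op_model_pt (T W Z X : aff K) (T' W' Z' : aff R) (J : mor (res i T) T')
    (J2 : mor (res i W) W') (J3 : mor (res i Z) Z') (m : mor (prodm T W) Z)
    (m' : mor (prodm T' W') Z') (a : mor X T) (b : mor X W) :
  compm m' (prod_J J J2) = compm J3 (res_mor i m) ->
  compm m' (pairm (compm J (res_mor i a)) (compm J2 (res_mor i b)))
  = compm J3 (res_mor i (compm m (pairm a b))).
Proof. by move=> e; rewrite -prod_J_pt Defs.compA e -Defs.compA -res_comp. Qed.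

Lemma pr1_prod_J (T W : aff K) (T' W' : aff R) (J : mor (res i T) T') (J2 : mor (res i W) W') :
  compm pr1 (prod_J J J2) = compm J (res_mor i pr1).
Proof. exact: pr1_pair. Qed.
Lemma pr2_prod_J (T W : aff K) (T' W' : aff R) (J : mor (res i T) T') (J2 : mor (res i W) W') :
  compm pr2 (prod_J J J2) = compm J2 (res_mor i pr2).
Proof. exact: pr2_pair. Qed.

Lemma pr1_prod_J_comp (T W : aff K) (T' W' X : aff R) (J : mor (res i T) T')
    (J2 : mor (res i W) W') (w : mor X _) :
  compm pr1 (compm (prod_J J J2) w) = compm J (compm (res_mor i pr1) w).
Proof. by rewrite Defs.compA pr1_pair Defs.compA. Qed.
Lemma pr2_prod_J_comp (T W : aff K) (T' W' X : aff R) (J : mor (res i T) T')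
    (J2 : mor (res i W) W') (w : mor X _) :
  compm pr2 (compm (prod_J J J2) w) = compm J2 (compm (res_mor i pr2) w).
Proof. by rewrite Defs.compA pr2_pair Defs.compA. Qed.

Variable G : grp K.
Local Notation strB := (str_map G).
Variables (n : nat) (d s : 'M[ring_of G]_n).
Hypotheses (dM : mx_comul d) (dU : map_mx (pb (gone G)) d = 1%:M)
  (dS : map_mx (pb (ginv G)) d = s) (sd : s *m d = 1%:M) (ds : d *m s = 1%:M).
Hypothesis dgen : forall b E, is_subring E -> (forall k, E (strB k)) ->
  (forall i j, E (d i j)) -> E b.

(** The Hopf order R[d, d^-1]. *)
Definition matrix_order : ring_of G -> Prop :=
  subalg (strB \o i : {rmorphism R -> ring_of G}) (entries d ++ entries s).

Lemma matrix_order_sub (E : ring_of G -> Prop) :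
  is_subring E -> (forall r, E (strB (i r))) -> (forall j k, E (d j k)) ->
  (forall j k, E (s j k)) -> forall b, matrix_order b -> E b.
Proof.
move=> hE Er Ed Es b; apply: subalg_sub => // g; rewrite mem_cat => /orP[].
  exact: entriesP.
exact: entriesP.
Qed.

Lemma matrix_order_d j k : matrix_order (d j k).
Proof. by apply: subalg_mem; rewrite mem_cat mem_entries. Qed.
Lemma matrix_order_s j k : matrix_order (s j k).
Proof. by apply: subalg_mem; rewrite mem_cat mem_entries orbT. Qed.

Lemma den_subring (T : aff K) (D : ring_of T -> Prop) :
  is_subring D -> (forall r, D (str_map T (i r))) ->
  is_subring (fun c => exists2 r, r != 0 & D (str_map T (i r) * c)).
Proof.
move=> hD Dr; have [D1 DB DM] := hD.
split=> [|x y [r r0 Dx] [t t0 Dy]|x y [r r0 Dx] [t t0 Dy]].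
- by exists 1; [apply: oner_neq0|rewrite !rmorph1 mul1r].
- exists (r * t); first by rewrite mulf_neq0.
  rewrite !rmorphM mulrBr; apply: DB; last by rewrite -mulrA; apply: DM.
  by rewrite mulrAC mulrC; apply: DM.
- exists (r * t); first by rewrite mulf_neq0.
  by rewrite !rmorphM mulrACA; apply: DM.
Qed.

Lemma den_str (T : aff K) (D : ring_of T -> Prop) : (forall r, D (str_map T (i r))) ->
  forall k, exists2 r, r != 0 & D (str_map T (i r) * str_map T k).
Proof.
by move=> Dr k; have [r r0 [r' rE]] := i_frac k; exists r; rewrite // -rmorphM rE.
Qed.

Lemma den_mem (T : aff K) (D : ring_of T -> Prop) c : D c ->
  exists2 r : R, r != 0 & D (str_map T (i r) * c).
Proof. by move=> Dc; exists 1; [apply: oner_neq0|rewrite !rmorph1 mul1r]. Qed.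

Lemma comul_s : map_mx (pb (gmul G)) s
  = map_mx (tin2 strB strB) s *m map_mx (tin1 strB strB) s.
Proof.
apply: (@mx_inverse_uniq _ _ (map_mx (pb (gmul G)) d)).
  by rewrite -map_mxM sd map_mx1.
rewrite dM mulmxA -[map_mx (tin1 strB strB) d *m _ *m _]mulmxA -map_mxM ds map_mx1.
by rewrite mulmx1 -map_mxM ds map_mx1.
Qed.

Lemma counit_s : map_mx (pb (gone G)) s = 1%:M.
Proof.
have : map_mx (pb (gone G)) s *m map_mx (pb (gone G)) d = 1%:M by rewrite -map_mxM sd map_mx1.
by rewrite dU mulmx1.
Qed.

Lemma antipode_s : map_mx (pb (ginv G)) s = d.
Proof.
apply: (@mx_inverse_uniq _ _ s) => //.
by rewrite -{2}dS -map_mxM sd map_mx1.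
Qed.

Lemma mx_entry (C C' : comPzRingType) (h : C -> C') m (a : 'M[C]_m) (b : 'M[C']_m) j k :
  map_mx h a = b -> h (a j k) = b j k.
Proof. by move=> <-; rewrite mxE. Qed.

Lemma group_model : exists (G' : grp R) (J : mor (res i G) G'),
  [/\ is_model J, compm (gmul G') (prod_J J J) = compm J (res_mor i (gmul G)),
      compm (gone G') (to_base (res i base)) = compm J (res_mor i (gone G)),
      forall b, matrix_order (pb J b)
    & forall b, matrix_order b -> exists b', pb J b' = b].
Proof.
have hD : is_subring matrix_order by apply: subalg_subring.
have Dr r : matrix_order (strB (i r)) by apply: subalg_str.
have den b : exists2 r, r != 0 & matrix_order (strB (i r) * b).
  apply: (@dgen b (fun b => exists2 r : R, r != 0 & matrix_order (strB (i r) * b))).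
  - exact: den_subring.
  - exact: den_str.
  - by move=> j k; apply: den_mem; apply: matrix_order_d.
have [G0 [J [Jmod JD DJ]]] := subring_model hD Dr den.
have JJ := prod_model hR i_inj i_frac Jmod Jmod.
have J2 := prod_model hR i_inj i_frac JJ Jmod.
have [u uE] : exists u, compm u (prod_J J J) = compm J (res_mor i (gmul G)).
  apply: (model_lift JJ) => b.
  pose E b := exists t, pb (gmul G) b = pb (prod_J J J) t.
  suff : E (pb J b) by [].
  have hE : is_subring E by exact: (preim_subring (pb (gmul G)) (image_subring (pb (prod_J J J)))).
  have [_ _ EM] := image_subring (pb (prod_J J J)).
  have E1 b0 : matrix_order b0 -> exists t, tin1 strB strB b0 = pb (prod_J J J) t.
    move=> /DJ[b' <-]; exists (tin1 _ _ b').
    by rewrite /tin1 prod_J_pure rmorph1.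
  have E2 b0 : matrix_order b0 -> exists t, tin2 strB strB b0 = pb (prod_J J J) t.
    move=> /DJ[b' <-]; exists (tin2 _ _ b').
    by rewrite /tin2 prod_J_pure rmorph1.
  apply: (matrix_order_sub hE) (JD b) => [r|j k|j k].
  - exists (str_map _ r); rewrite (pb_model_str (prod_J J J)); exact: pbE.
  - rewrite /E (mx_entry _ _ dM) mxE; apply: (subring_sum (image_subring (pb (prod_J J J)))) => l.
    by apply: EM; rewrite mxE; [(apply: E1; apply: matrix_order_d)|(apply: E2; apply: matrix_order_d)].
  - rewrite /E (mx_entry _ _ comul_s) mxE; apply: (subring_sum (image_subring (pb (prod_J J J)))) => l.
    by apply: EM; rewrite mxE; [(apply: E2; apply: matrix_order_s)|(apply: E1; apply: matrix_order_s)].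
have [o oE] : exists o, compm o (to_base (res i base)) = compm J (res_mor i (gone G)).
  apply: (model_lift base_model) => b.
  pose E b := exists t, pb (gone G) b = pb (to_base (res i base)) t.
  have hE : is_subring E by exact: (preim_subring (pb (gone G)) (image_subring (pb (to_base (res i base))))).
  suff : E (pb J b) by [].
  apply: (matrix_order_sub hE) (JD b) => [r|j k|j k].
  - by exists r; apply: pbE.
  - by exists (j == k)%:R; rewrite (mx_entry _ _ dU) rmorph_nat mxE.
  - by exists (j == k)%:R; rewrite (mx_entry _ _ counit_s) rmorph_nat mxE.
have [v vE] : exists v, compm v J = compm J (res_mor i (ginv G)).
  apply: (model_lift Jmod) => b.
  pose E b := exists t, pb (ginv G) b = pb J t.
  have hE : is_subring E by exact: (preim_subring (pb (ginv G)) (image_subring (pb J))).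
  suff : E (pb J b) by [].
  apply: (matrix_order_sub hE) (JD b) => [r|j k|j k].
  - by exists (str_map _ r); rewrite pb_model_str; apply: pbE.
  - by rewrite /E (mx_entry _ _ dS); have [b' <-] := DJ _ (matrix_order_s j k); exists b'.
  - by rewrite /E (mx_entry _ _ antipode_s); have [b' <-] := DJ _ (matrix_order_d j k); exists b'.
have uA : compm u (pairm (compm u (pairm (compm pr1 pr1) (compm pr2 pr1))) pr2)
     = compm u (pairm (compm pr1 pr1) (compm u (pairm (compm pr2 pr1) pr2)))
     :> mor (prodm (prodm G0 G0) G0) G0.
  apply: (model_ext J2); rewrite !(compE, pair_compE, pr1_prod_J, pr2_prod_J,
    pr1_prod_J_comp, pr2_prod_J_comp) -!res_comp.
  by rewrite !(op_model_pt _ _ uE) gmulAp.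
have oJp X : compm o (to_base (res i X)) = compm J (res_mor i (compm (gone G) (to_base X))).
  rewrite res_comp Defs.compA -oE -Defs.compA; congr (compm o _); exact: to_base_uniq.
have toJ : compm (to_base G0) J = to_base (res i G) by apply: to_base_uniq.
have Jid : J = compm J (res_mor i (idm G)) by rewrite res_id compm1.
have u1l : compm u (pairm (compm o (to_base G0)) (idm G0)) = idm G0.
  apply: (model_ext Jmod); rewrite !(compE, pair_compE) toJ oJp {2}Jid.
  by rewrite (op_model_pt _ _ uE) gmul1l res_id compm1.
have u1r : compm u (pairm (idm G0) (compm o (to_base G0))) = idm G0.
  apply: (model_ext Jmod); rewrite !(compE, pair_compE) toJ oJp {1}Jid.
  by rewrite (op_model_pt _ _ uE) gmul1r res_id compm1.
have uVl : compm u (pairm v (idm G0)) = compm o (to_base G0).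
  apply: (model_ext Jmod); rewrite !(compE, pair_compE) toJ oJp vE {2}Jid.
  by rewrite (op_model_pt _ _ uE) gmulVl.
have uVr : compm u (pairm (idm G0) v) = compm o (to_base G0).
  apply: (model_ext Jmod); rewrite !(compE, pair_compE) toJ oJp vE {1}Jid.
  by rewrite (op_model_pt _ _ uE) gmulVr.
by exists (Grp uA u1l u1r uVl uVr), J.
Qed.
End GroupModel.

(** * Rescaling alpha_p *)

Section Scaling.
Variables (K : fieldType) (p : nat) (p_gt0 : (0 < p)%N).
Local Notation xK := (alpha_x K p).
Lemma scaled_x_nil k : (alpha_str p k * xK : ring_of (alpha K p)) ^+ p = 0.
Proof. by rewrite exprMn alpha_x_nil // mulr0. Qed.

Definition scaling k : mor (alpha K p) (alpha K p) := alpha_lift p_gt0 (scaled_x_nil k).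

Lemma scaling_x k : pb (scaling k) xK = alpha_str p k * xK.
Proof. exact: alpha_lift_x. Qed.

Lemma scaling_str k l : pb (scaling k) (alpha_str p l) = alpha_str p l.
Proof. exact: (pbE (scaling k) l). Qed.

Lemma scaling_comp k l : k * l = 1 -> compm (scaling k) (scaling l) = idm (alpha K p).
Proof.
move=> kl; apply: alpha_mor_ext; rewrite -[LHS]/(pb (scaling l) (pb (scaling k) xK)).
rewrite scaling_x [LHS]rmorphM scaling_str scaling_x mulrA.
by rewrite -[_ * _ in X in X * _](rmorphM (@alpha_str K p)) kl rmorph1 mul1r.
Qed.

End Scaling.

(** * The integral model of the torsor *)

Section TorsorOrder.
Variables (R : idomainType) (K : fieldType) (i : {rmorphism R -> K}).
Hypotheses (hR : valuation_ring R) (i_inj : injective i).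
Hypothesis i_frac : forall k, exists2 r, r != 0 & exists r', i r * k = i r'.
Hypothesis pid : forall I : R -> Prop, is_ideal I ->
  exists a, forall x, I x <-> exists b, x = b * a.
Variables (p : nat) (G : grp K) (Y : gspace G (alpha K p)).
Hypotheses (p_gt1 : (1 < p)%N) (hY : is_torsor Y).
Variables (y : mor base Y) (hy : compm (gproj Y) y = alpha_unit K p).
Local Notation strB := (str_map G).
Local Notation strC := (str_map Y).
Local Notation C := (ring_of Y).
Local Notation B := (ring_of G).
Local Notation x := (alg_map Y (alpha_x K p)).
Local Notation q := (pb (orbit_map y)).
Variables (n : nat) (d s : 'M[B]_n) (c e : 'M[C]_n).
Hypotheses (dM : mx_comul d) (dU : map_mx (pb (gone G)) d = 1%:M)
  (dS : map_mx (pb (ginv G)) d = s) (sd : s *m d = 1%:M) (ds : d *m s = 1%:M).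
Hypothesis dgen : forall b E, is_subring E -> (forall k, E (strB k)) ->
  (forall j k, E (d j k)) -> E b.
Hypotheses (ce : c *m e = 1%:M) (ec : e *m c = 1%:M) (qc : map_mx q c = d).
Hypothesis rho_c : map_mx (pb (gact Y)) c
  = map_mx (tin1 strC strB) c *m map_mx (tin2 strC strB) d.

Let p_gt0 : (0 < p)%N. Proof. exact: ltnW. Qed.
Let strRC : {rmorphism R -> C} := (strC \o i).
Local Notation B0 := (matrix_order i d s).

Lemma q_e : map_mx q e = s.
Proof.
apply: (@mx_inverse_uniq _ _ d) => //.
by rewrite -{1}qc -map_mxM ec map_mx1.
Qed.

Lemma q_str k : q (strC k) = strB k.
Proof. exact: (pbE (orbit_map y) k). Qed.

Lemma q_x : q x = 0.
Proof. by rewrite orbit_alg // alpha_ev0_x // rmorph0. Qed.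

(** The ring R[c, c^-1]. *)
Definition base_order : C -> Prop := subalg strRC (entries c ++ entries e).
(** The ring R[z, c, c^-1]. *)
Definition order_at (z : C) : C -> Prop := subalg strRC (z :: entries c ++ entries e).

Lemma order_at_sub z (E : C -> Prop) :
  is_subring E -> (forall r, E (strC (i r))) -> E z -> (forall j k, E (c j k)) ->
  (forall j k, E (e j k)) -> forall a, order_at z a -> E a.
Proof.
move=> hE Er Ez Ec Ee a; apply: subalg_sub => // g.
rewrite inE mem_cat => /predU1P[->//|/orP[]]; exact: entriesP.
Qed.

Lemma order_at_z z : order_at z z.
Proof. by apply: subalg_mem; rewrite inE eqxx. Qed.
Lemma order_at_str z r : order_at z (strC (i r)).
Proof. exact: (@subalg_str C R strRC _ r). Qed.
Lemma order_at_c z j k : order_at z (c j k).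
Proof. by apply: subalg_mem; rewrite inE mem_cat mem_entries orbT. Qed.
Lemma order_at_e z j k : order_at z (e j k).
Proof. by apply: subalg_mem; rewrite inE mem_cat mem_entries !orbT. Qed.
Lemma order_at_subring z : is_subring (order_at z).
Proof. exact: subalg_subring. Qed.
Lemma order_atM z a b : order_at z a -> order_at z b -> order_at z (a * b).
Proof. by have [_ _] := order_at_subring z; apply. Qed.

Lemma base_order_at z a : base_order a -> order_at z a.
Proof.
apply: subalg_sub; [exact: order_at_subring|exact: order_at_str|] => g.
by rewrite mem_cat => /orP[]; apply: entriesP => j k; [apply: order_at_c|apply: order_at_e].
Qed.

Lemma order_at_q z a : q z = 0 -> order_at z a -> B0 (q a).
Proof.
move=> qz; apply: (@order_at_sub z (fun a => B0 (q a))).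
- exact: (preim_subring q (subalg_subring _ _)).
- by move=> r; rewrite q_str; apply: subalg_str.
- by rewrite qz; apply: (subring0 (subalg_subring _ _)).
- by move=> j k; rewrite (mx_entry _ _ qc); apply: matrix_order_d.
- by move=> j k; rewrite (mx_entry _ _ q_e); apply: matrix_order_s.
Qed.

Lemma order_at_q_surj z b : B0 b -> exists2 a, order_at z a & q a = b.
Proof.
move=> Bb; suff [a [az <-]] : exists a, order_at z a /\ q a = b by exists a.
have [O1 OB OM] := order_at_subring z.
apply: (@matrix_order_sub R K i G n d s (fun b => exists a, order_at z a /\ q a = b)) Bb.
- split=> [|_ _ [a [az <-]] [a' [az' <-]]|_ _ [a [az <-]] [a' [az' <-]]].
  + by exists 1; rewrite rmorph1.
  + by exists (a - a'); rewrite rmorphB; split=> //; apply: OB.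
  + by exists (a * a'); rewrite rmorphM; split=> //; apply: OM.
- by move=> r; exists (strC (i r)); rewrite q_str; split=> //; apply: order_at_str.
- by move=> j k; exists (c j k); rewrite (mx_entry _ _ qc); split=> //; apply: order_at_c.
- by move=> j k; exists (e j k); rewrite (mx_entry _ _ q_e); split=> //; apply: order_at_e.
Qed.

(** R[x, c, c^-1] spans C over K: modulo x this holds because d generates B,
    and x is nilpotent. *)
Lemma order_x_den a : exists2 r : R, r != 0 & order_at x (strC (i r) * a).
Proof.
pose E a := exists2 r : R, r != 0 & order_at x (strC (i r) * a).
have hE : is_subring E.
  by apply: (den_subring (T := Y) (order_at_subring x)); apply: order_at_str.
have [_ EB EM] := hE.
have Estr k : E (strC k) by apply: (den_str i_frac (T := Y)); apply: order_at_str.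
have Emem a' : order_at x a' -> E a' by apply: (den_mem i (T := Y)).
have lift b : exists2 a', E a' & q a' = b.
  suff [a' [Ea' <-]] : exists a', E a' /\ q a' = b by exists a'.
  apply: (@dgen b (fun b => exists a', E a' /\ q a' = b)).
  - split=> [|_ _ [u [Eu <-]] [v [Ev <-]]|_ _ [u [Eu <-]] [v [Ev <-]]].
    + by exists 1; rewrite rmorph1; split=> //; case: hE.
    + by exists (u - v); rewrite rmorphB; split=> //; apply: EB.
    + by exists (u * v); rewrite rmorphM; split=> //; apply: EM.
  - by move=> k; exists (strC k); rewrite q_str.
  - move=> j k; exists (c j k); rewrite (mx_entry _ _ qc); split=> //.
    by apply: Emem; apply: order_at_c.
have step m : exists2 a', E a' & exists w, a = a' + x ^+ m * w.
  elim: m => [|m [a' Ea' [w ->]]].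
    exists 0; first by apply: Emem; apply: (subring0 (order_at_subring x)).
    by exists a; rewrite mul1r add0r.
  have [w' Ew' qw'] := lift (q w).
  have [|v vE] := torsor_orbit_ker p_gt0 hY hy (c := w - w').
    by rewrite rmorphB qw' subrr.
  exists (a' + x ^+ m * w').
    apply: (subringD hE) => //; apply: EM => //; apply: Emem.
    by apply: (subringX (order_at_subring x)); apply: order_at_z.
  by exists v; rewrite exprSr -mulrA -vE -addrA -mulrDr [w' + _]addrC subrK.
by have [a' Ea' [w]] := step p; rewrite alg_x_nil // mul0r addr0 => ->.
Qed.

(** The ideal of the elements of R[c, c^-1] killed by q has finitely many
    generators f = x w, and r is a common denominator of the w with respect to
    R[x, c, c^-1]; then f = z (r w). *)
Lemma scale_exists : exists2 r : R, r != 0 &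
  forall a, base_order a -> q a = 0 ->
  exists2 a', order_at (strC (i r)^-1 * x) a' & a = strC (i r)^-1 * x * a'.
Proof.
pose I a := base_order a /\ q a = 0.
have hD : is_subring base_order by apply: subalg_subring.
have [D1 DB DM] := hD.
have [||fs [fsI fsgen]] := @subalg_noetherian C R strRC (entries c ++ entries e) pid I.
- split=> [|a b [Da qa] [Db qb]|a b Da [Db qb]].
  + by split; [apply: (subring0 hD)|rewrite rmorph0].
  + by split; [apply: (subringD hD)|rewrite rmorphD qa qb addr0].
  + by split; [apply: DM|rewrite rmorphM qb mulr0].
- by move=> a [].
have [r r0 rfs] : exists2 r : R, r != 0 & forall f, f \in fs ->
    exists2 w, order_at x (strC (i r) * w) & f = x * w.
  elim: fs fsI {fsgen} => [|f fs IH] fsI; first by exists 1; rewrite ?oner_neq0.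
  have [|r r0 rfs] := IH; first by move=> g gfs; apply: fsI; rewrite inE gfs orbT.
  have [|_ /(torsor_orbit_ker p_gt0 hY hy)[w fE]] := fsI f; first by rewrite inE eqxx.
  have [t t0 tw] := order_x_den w; exists (r * t); first by rewrite mulf_neq0.
  move=> g; rewrite inE => /predU1P[->|/rfs[w' w'x ->]].
    by exists w; rewrite // !rmorphM -mulrA; apply: order_atM => //; apply: order_at_str.
  exists w'; rewrite // !rmorphM mulrAC mulrC; apply: order_atM => //; exact: order_at_str.
exists r => //; set z := _ * x.
have xz : x = strC (i r) * z.
  by rewrite mulrA -rmorphM mulfV ?rmorph1 ?mul1r // i_neq0.
have xsub a : order_at x a -> order_at z a.
  apply: order_at_sub; [exact: order_at_subring|exact: order_at_str| |exact: order_at_c|exact: order_at_e].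
  by rewrite xz; apply: order_atM; [apply: order_at_str|apply: order_at_z].
move=> a Da qa; have : I a by [].
move=> /fsgen/(_ (fun a => exists a', order_at z a' /\ a = z * a')) [||a' [za' ->]]; last by exists a'.
- have hz := order_at_subring z.
  split=> [|_ _ [u [uz ->]] [v [vz ->]]|b _ Db [u [uz ->]]].
  + by exists 0; rewrite mulr0; split=> //; apply: (subring0 hz).
  + by exists (u + v); rewrite mulrDr; split=> //; apply: (subringD hz).
  + by exists (b * u); rewrite mulrCA; split=> //; apply: order_atM => //; apply: base_order_at.
- move=> f /rfs[w wx ->]; exists (strC (i r) * w); split; first exact: xsub.
  by rewrite {1}xz -mulrA mulrCA mulrA.
Qed.

Variable r : R.
Hypothesis r_neq0 : r != 0.
Local Notation z := (strC (i r)^-1 * x).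
Hypothesis scale_r : forall a, base_order a -> q a = 0 ->
  exists2 a', order_at z a' & a = z * a'.
Local Notation C0 := (order_at z).

Lemma q_z : q z = 0.
Proof. by rewrite rmorphM q_x mulr0. Qed.

(** An element of R[z, c, c^-1] is u + z v with u in R[c, c^-1], and q(u) = 0
    is covered by the choice of r. *)
Lemma order_ker a : C0 a -> q a = 0 -> exists2 a', C0 a' & a = z * a'.
Proof.
move=> Ca; suff [u [v [Du [Cv ->]]]] : exists u v, base_order u /\ C0 v /\ a = u + z * v.
  rewrite rmorphD rmorphM q_z mul0r addr0 => /(scale_r Du)[w Cw ->].
  exists (w + v); last by rewrite mulrDr.
  exact: (subringD (order_at_subring z)).
have hC := order_at_subring z; have [C1 CB CM] := hC.
have hD : is_subring base_order by apply: subalg_subring.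
have [D1 DB DM] := hD.
have base u : base_order u -> exists u' v, base_order u' /\ C0 v /\ u = u' + z * v.
  move=> Du; exists u, 0; split=> //; split; first exact: (subring0 hC).
  by rewrite mulr0 addr0.
apply: (@order_at_sub z (fun a => exists u v, base_order u /\ C0 v /\ a = u + z * v)) Ca.
- split=> [|_ _ [u [v [Du [Cv ->]]]] [u' [v' [Du' [Cv' ->]]]]|
            _ _ [u [v [Du [Cv ->]]]] [u' [v' [Du' [Cv' ->]]]]].
  + exact: base.
  + exists (u - u'), (v - v'); split; [exact: DB|split; [exact: CB|]].
    by rewrite mulrBr opprD addrACA.
  + exists (u * u'), (u * v' + v * u' + z * v * v'); split; [exact: DM|split].
      apply: (subringD hC); last by apply: (CM) => //; apply: (CM) => //; apply: order_at_z.
      by apply: (subringD hC); apply: CM => //; apply: base_order_at.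
    move: z => w; rewrite mulrDl !mulrDr -!addrA; congr (_ + (_ + (_ + _))).
    + by rewrite mulrCA.
    + by rewrite mulrA.
    + by rewrite -!mulrA [v * (w * v')]mulrCA.
- by move=> t; apply: base; apply: (@subalg_str C R strRC _ t).
- exists 0, 1; split; first exact: (subring0 hD).
  by rewrite add0r mulr1.
- by move=> j k; apply: base; apply: subalg_mem; rewrite mem_cat mem_entries.
- by move=> j k; apply: base; apply: subalg_mem; rewrite mem_cat mem_entries orbT.
Qed.

Lemma order_den a : exists2 t : R, t != 0 & C0 (strC (i t) * a).
Proof.
have [t t0 ta] := order_x_den a; exists t => //.
apply: order_at_sub ta; [exact: order_at_subring|exact: order_at_str| |exact: order_at_c|exact: order_at_e].
suff : C0 (strC (i r) * z) by rewrite mulrA -rmorphM mulfV ?rmorph1 ?mul1r // i_neq0.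
by apply: order_atM; [apply: order_at_str|apply: order_at_z].
Qed.

Lemma y_c : map_mx (pb y) c = 1%:M.
Proof.
transitivity (map_mx (pb (gone G)) (map_mx q c)); last by rewrite qc.
by apply/matrixP => j k; rewrite !mxE -{1}(orbit_one y).
Qed.

Lemma y_e : map_mx (pb y) e = 1%:M.
Proof.
have : map_mx (pb y) e *m map_mx (pb y) c = 1%:M by rewrite -map_mxM ec map_mx1.
by rewrite y_c mulmx1.
Qed.

Lemma rho_e : map_mx (pb (gact Y)) e
  = map_mx (tin2 strC strB) s *m map_mx (tin1 strC strB) e.
Proof.
apply: (@mx_inverse_uniq _ _ (map_mx (pb (gact Y)) c)).
  by rewrite -map_mxM ec map_mx1.
rewrite rho_c mulmxA -[map_mx (tin1 _ _) c *m _ *m _]mulmxA -map_mxM ds map_mx1.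
by rewrite mulmx1 -map_mxM ce map_mx1.
Qed.

Variables (G' : grp R) (JG : mor (res i G) G').
Hypotheses (JG_model : is_model JG)
  (JG_mul : compm (gmul G') (prod_J JG JG) = compm JG (res_mor i (gmul G)))
  (JG_one : compm (gone G') (to_base (res i base)) = compm JG (res_mor i (gone G)))
  (JG_sub : forall b, B0 (pb JG b)) (JG_im : forall b, B0 b -> exists b', pb JG b' = b).

Lemma rho_z : pb (gact Y) z = tin1 strC strB z.
Proof.
rewrite rmorphM rho_alg [RHS]rmorphM; congr (_ * _).
exact: (pbE (gact Y)).
Qed.

Lemma z_nil : z ^+ p = 0.
Proof. by rewrite exprMn alg_x_nil // mulr0. Qed.

Lemma space_model : exists (Y' : gspace G' (alpha R p)) (JY : mor (res i Y) Y'),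
  [/\ is_model JY, forall a, C0 (pb JY a), forall a, C0 a -> exists a', pb JY a' = a,
      compm (gact Y') (prod_J JY JG) = compm JY (res_mor i (gact Y))
    & pb JY (pb (gproj Y') (alpha_x R p)) = z].
Proof.
have [Y0 [JY [JY_model YD DY]]] :=
  subring_model (T := Y) (order_at_subring z) (@order_at_str z) order_den.
have YG := prod_model hR i_inj i_frac JY_model JG_model.
have YGG := prod_model hR i_inj i_frac YG JG_model.
have [u uE] : exists u, compm u (prod_J JY JG) = compm JY (res_mor i (gact Y)).
  apply: (model_lift YG) => a.
  pose E b := exists t, pb (gact Y) b = pb (prod_J JY JG) t.
  suff : E (pb JY a) by [].
  have Im := image_subring (pb (prod_J JY JG)).
  have hE : is_subring E by exact: (preim_subring (pb (gact Y)) Im).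
  have [_ _ EM] := Im.
  have E1 c0 : C0 c0 -> exists t, tin1 strC strB c0 = pb (prod_J JY JG) t.
    by move=> /DY[c' <-]; exists (tin1 _ _ c'); rewrite /tin1 prod_J_pure rmorph1.
  have E2 b0 : B0 b0 -> exists t, tin2 strC strB b0 = pb (prod_J JY JG) t.
    by move=> /JG_im[b' <-]; exists (tin2 _ _ b'); rewrite /tin2 prod_J_pure rmorph1.
  apply: (@order_at_sub z E hE) (YD a) => [t||j k|j k].
  - exists (str_map _ t); rewrite (pb_model_str (prod_J JY JG)); exact: pbE.
  - by rewrite /E rho_z; apply: E1; apply: order_at_z.
  - rewrite /E (mx_entry _ _ rho_c) mxE; apply: (subring_sum Im) => l.
    apply: EM; rewrite mxE; first by apply: E1; apply: order_at_c.
    by apply: E2; apply: matrix_order_d.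
  - rewrite /E (mx_entry _ _ rho_e) mxE; apply: (subring_sum Im) => l.
    apply: EM; rewrite mxE; last by apply: E1; apply: order_at_e.
    by apply: E2; apply: matrix_order_s.
have [z' z'E] := DY z (@order_at_z z).
have z'p : z' ^+ p = 0 by apply: (proj1 JY_model); rewrite rmorphXn z'E z_nil rmorph0.
pose w : mor Y0 (alpha R p) := alpha_lift p_gt0 z'p.
have oJ X : compm (gone G') (to_base (res i X)) = compm JG (res_mor i (compm (gone G) (to_base X))).
  by rewrite res_comp Defs.compA -JG_one -Defs.compA; congr (compm _ _); apply: to_base_uniq.
have toJ : compm (to_base Y0) JY = to_base (res i Y) by apply: to_base_uniq.
have Jid : JY = compm JY (res_mor i (idm Y)) by rewrite res_id compm1.
have uA : compm u (pairm (compm u (pairm (compm pr1 pr1) (compm pr2 pr1))) pr2)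
     = compm u (pairm (compm pr1 pr1) (compm (gmul G') (pairm (compm pr2 pr1) pr2)))
     :> mor (prodm (prodm Y0 G') G') Y0.
  apply: (model_ext YGG); rewrite !(compE, pair_compE, pr1_prod_J, pr2_prod_J,
    pr1_prod_J_comp, pr2_prod_J_comp) -!res_comp.
  by rewrite (op_model_pt _ _ JG_mul) !(op_model_pt _ _ uE) actAp.
have u1 : compm u (pairm (idm Y0) (compm (gone G') (to_base Y0))) = idm Y0.
  apply: (model_ext JY_model); rewrite !(compE, pair_compE) toJ oJ {1}Jid.
  by rewrite (op_model_pt _ _ uE) act1 res_id compm1.
have wx : pb w (alpha_x R p) = z' by apply: alpha_lift_x.
have wu : compm w u = compm w (pr1 (Y := Y0) (Z := G')).
  apply: alpha_mor_ext; rewrite -[LHS]/(pb u (pb w _)) -[RHS]/(pb pr1 (pb w _)) wx.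
  apply: (proj1 YG); have := congr1 (fun m => pb m z') uE.
  rewrite -[LHS]/(pb (prod_J JY JG) (pb u z')) => ->.
  rewrite -[LHS]/(pb (gact Y) (pb JY z')) z'E rho_z -z'E.
  by rewrite -[pb pr1 z']/(tpure _ _ z' 1) prod_J_pure rmorph1.
exists (Gspace uA u1 wu), JY; split=> //.
by rewrite -[pb (gproj _) _]/(pb w (alpha_x R p)) wx.
Qed.

Variables (Y' : gspace G' (alpha R p)) (JY : mor (res i Y) Y').
Hypotheses (JY_model : is_model JY) (JY_sub : forall a, C0 (pb JY a))
  (JY_im : forall a, C0 a -> exists a', pb JY a' = a)
  (JY_act : compm (gact Y') (prod_J JY JG) = compm JY (res_mor i (gact Y)))
  (JY_x : pb JY (pb (gproj Y') (alpha_x R p)) = z).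

Definition alg_map' : {rmorphism {poly %/ 'X^p : {poly R}} -> ring_of Y'} := pb (gproj Y').

Lemma alg_str' t : alg_map' (alpha_str p t) = str_map Y' t.
Proof. exact: (pbE (gproj Y') t). Qed.

Lemma point_model : exists y' : mor base Y', compm (gproj Y') y' = alpha_unit R p.
Proof.
have [y' y'E] : exists y', compm y' (to_base (res i base)) = compm JY (res_mor i y).
  apply: (model_lift (base_model i_inj i_frac)) => a.
  pose E b := exists t, pb y b = pb (to_base (res i base)) t.
  suff : E (pb JY a) by [].
  have hE : is_subring E by exact: (preim_subring (pb y) (image_subring (pb (to_base (res i base))))).
  apply: (@order_at_sub z E hE) (JY_sub a) => [t||j k|j k].
  - by exists t; apply: pbE.
  - by exists 0; rewrite rmorphM y_alg // alpha_ev0_x // mulr0 rmorph0.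
  - by exists (j == k)%:R; rewrite (mx_entry _ _ y_c) rmorph_nat mxE.
  - by exists (j == k)%:R; rewrite (mx_entry _ _ y_e) rmorph_nat mxE.
have y'a a : i (pb y' a) = pb y (pb JY a) by apply: (congr1 (fun m => pb m a) y'E).
exists y'; apply: alpha_mor_ext; apply: i_inj.
rewrite -[LHS]/(i (pb y' (pb (gproj Y') _))) y'a JY_x rmorphM y_alg //.
by rewrite -[pb (alpha_unit R p) _]/(alpha_ev0 _) !alpha_ev0_x // mulr0 rmorph0.
Qed.

Lemma orbit_model : exists o : mor G' Y', compm o JG = compm JY (res_mor i (orbit_map y)).
Proof.
apply: (model_lift JG_model) => a.
have [b' b'E] := JG_im (order_at_q q_z (JY_sub a)).
by exists b'; rewrite b'E.
Qed.

Lemma flat_model : eq_flat (restr alg_map').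
Proof.
have [o oE] := orbit_model.
have oa a : pb JG (pb o a) = q (pb JY a) by apply: (congr1 (fun m => pb m a) oE).
have [JG_inj _] := JG_model; have [JY_inj _] := JY_model.
apply: (@alpha_eq_flat R p _ _ alg_map' (str_map G') (pb o)) => //.
- exact: (model_torsion_free i_inj JG_model).
- move=> b; have [a Ca aE] := order_at_q_surj z (JG_sub b).
  have [a' a'E] := JY_im Ca; exists a'; apply: JG_inj.
  by rewrite oa a'E.
- have h := @alpha_ext R p _ (pb o \o alg_map' : {rmorphism _ -> _})
    (str_map G' \o @alpha_ev0 R p : {rmorphism _ -> _}).
  move=> a; apply: h => [t|] /=.
    by rewrite alg_str' pbE alpha_ev0_str.
  apply: JG_inj; rewrite oa JY_x q_z alpha_ev0_x //.
  by rewrite !rmorph0.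
- move=> a oa0; have [||a1 Ca1 aE] := @order_ker (pb JY a).
  + exact: JY_sub.
  + by rewrite -oa oa0 rmorph0.
  have [a' a'E] := JY_im Ca1; exists a'; apply: JY_inj.
  by rewrite rmorphM JY_x a'E.
- move=> a za; apply: JG_inj; rewrite rmorph0 oa.
  apply: (flat_top p_gt0 hY hy); have := congr1 (pb JY) za.
  rewrite rmorphM rmorphXn JY_x rmorph0 exprMn -mulrA => zx.
  apply: (field_torsion_free (f := strC) (s := (i r)^-1 ^+ p.-1)).
    by rewrite expf_neq0 // invr_neq0 // i_neq0.
  by rewrite rmorphXn.
Qed.

Lemma flat_generic : eq_flat (restr (alg_map Y)).
Proof.
apply: (@alpha_eq_flat K p _ _ (alg_map Y) strB q) => //.
- exact: field_valuation_ring.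
- exact: field_torsion_free.
- exact: (torsor_orbit_surj p_gt0 hY hy).
- exact: orbit_alg.
- exact: (torsor_orbit_ker p_gt0 hY hy).
- exact: flat_top.
Qed.

Local Notation xK := (alpha_x K p).

(** On coordinate rings x |-> x / r; this is the comparison map of alpha_p
    that is compatible with the projections of Y and Y'. *)
Definition alpha_J : mor (res i (alpha K p)) (alpha R p) :=
  @alpha_lift R p (res i (alpha K p)) _ p_gt0 (scaled_x_nil p_gt0 (i r)^-1).

Lemma alpha_J_x : pb alpha_J (alpha_x R p) = alpha_str p (i r)^-1 * xK.
Proof. exact: alpha_lift_x. Qed.

Lemma alpha_J_str t : pb alpha_J (alpha_str p t) = alpha_str p (i t).
Proof. exact: (pbE alpha_J t). Qed.

Lemma z_alg : z = alg_map Y (alpha_str p (i r)^-1 * xK).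
Proof. by rewrite rmorphM alg_str. Qed.

Lemma gproj_J : compm (gproj Y') JY = compm alpha_J (res_mor i (gproj Y)).
Proof.
apply: alpha_mor_ext; rewrite -[LHS]/(pb JY (pb (gproj Y') _)) JY_x z_alg.
by rewrite -[RHS]/(alg_map Y (pb alpha_J _)) alpha_J_x.
Qed.

Lemma alpha_J_den (a : ring_of (alpha K p)) :
  exists2 t : R, t != 0 & exists a', str_map (alpha K p) (i t) * a = pb alpha_J a'.
Proof.
pose D (b : ring_of (alpha K p)) := exists a', b = pb alpha_J a'.
have Ds t : D (str_map (alpha K p) (i t)).
  by exists (alpha_str p t); rewrite alpha_J_str.
have hE := den_subring (D := D) (image_subring (pb alpha_J)) Ds.
have [_ _ EM] := hE.
rewrite (qpoly_expand a); apply: (subring_sum hE) => j; apply: EM.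
  exact: (den_str i_frac Ds).
apply: (subringX hE); apply: (den_mem i (D := D)).
exists (alpha_str p r * alpha_x R p); rewrite rmorphM alpha_J_str alpha_J_x mulrA.
by rewrite -[_ * _ in X in X * _](rmorphM (@alpha_str K p)) mulfV ?rmorph1 ?mul1r // i_neq0.
Qed.

Local Notation P := (fib (gproj Y) (gproj Y)).
Local Notation P' := (fib (gproj Y') (gproj Y')).

Lemma fib_J_comm : compm (gproj Y') (compm JY (res_mor i (fst_fib (gproj Y) (gproj Y))))
  = compm (gproj Y') (compm JY (res_mor i (snd_fib (gproj Y) (gproj Y)))).
Proof. by rewrite !Defs.compA gproj_J -!Defs.compA -!res_comp fib_comm. Qed.

Definition fib_J : mor (res i P) P' := pair_fib fib_J_comm.

(** An instance of [localized_tensor_inj], since C is flat over A and C' over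
    A'. *)
Lemma fib_J_inj : injective (pb fib_J).
Proof.
have [JY_inj JY_den] := JY_model.
have fj a : pb (gproj Y) (pb alpha_J a) = pb JY (pb (gproj Y') a).
  by have := congr1 (fun m => pb m a) gproj_J => /= ->.
apply: (@localized_tensor_inj (ring_of (alpha R p)) (ring_of (alpha K p)) (ring_of Y') C
  (ring_of Y') C (pb (gproj Y')) (pb (gproj Y')) (pb (gproj Y)) (pb (gproj Y))
  (pb alpha_J) (pb JY) (pb JY) (fun a => exists2 t : R, t != 0 & a = alpha_str p t)) => //.
- by exists 1; rewrite ?oner_neq0 ?rmorph1.
- by move=> _ _ [t t0 ->] [u u0 ->]; exists (t * u); rewrite ?mulf_neq0 ?rmorphM.
- move=> a; have [t t0 [a' aE]] := alpha_J_den a.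
  exists (alpha_str p t); first by exists t.
  by exists a'; rewrite -aE alpha_J_str.
- move=> a; have [t t0 [a' aE]] := JY_den a.
  exists (alpha_str p t); first by exists t.
  exists a'; rewrite -aE; congr (_ * _).
  by rewrite -[LHS]/(alg_map Y (pb alpha_J (alpha_str p t))) alpha_J_str alg_str.
- move=> _ a [t t0 ->]; rewrite -[pb (gproj Y') _]/(alg_map' (alpha_str p t)) alg_str'.
  exact: (model_torsion_free i_inj JY_model).
- exact: flat_generic.
- exact: flat_model.
- by move=> a b; rewrite [LHS]tcop_pure tpureE.
Qed.

Lemma canonical_J : compm (canonical_map Y') (prod_J JY JG)
  = compm fib_J (res_mor i (canonical_map Y)).
Proof.
apply: fib_ext; rewrite !Defs.compA !(fst_pair, snd_pair).
  by rewrite JY_act -!Defs.compA -!res_comp fst_pair.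
by rewrite ?pr1_prod_J -!Defs.compA -!res_comp snd_pair.
Qed.

Lemma canonical_inj : injective (pb (canonical_map Y')).
Proof.
move=> t u tu; apply: fib_J_inj.
have can_inj w w' : pb (canonical_map Y) w = pb (canonical_map Y) w' -> w = w'.
  move=> ww; have [_ [v [can_v _]]] := hY.
  have E a : pb v (pb (canonical_map Y) a) = a by apply: (congr1 (fun m => pb m a) can_v).
  by rewrite -[w]E ww E.
have E a : pb (prod_J JY JG) (pb (canonical_map Y') a) = pb (canonical_map Y) (pb fib_J a).
  exact: (congr1 (fun m => pb m a) canonical_J).
by apply: can_inj; rewrite -!E tu.
Qed.

(** The image contains C' (x) 1 and rho(c), hence 1 (x) d = (c^-1 (x) 1)
    rho(c), and likewise 1 (x) d^-1 = rho(c^-1) (c (x) 1). *)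
Lemma canonical_surj t : exists u, pb (canonical_map Y') u = t.
Proof.
pose I t := exists u, t = pb (canonical_map Y') u.
have hI : is_subring I := image_subring _.
have [_ _ IM] := hI.
suff [u ->] : I t by exists u.
have YG := prod_model hR i_inj i_frac JY_model JG_model.
have I1 a : I (tin1 (str_map Y') (str_map G') a).
  by exists (tin2 _ _ a); symmetry; apply: tcop2.
have Iact a : I (pb (gact Y') a).
  by exists (tin1 _ _ a); symmetry; apply: tcop1.
have E1 a : pb (prod_J JY JG) (tin1 _ _ a) = tin1 strC strB (pb JY a).
  by rewrite /tin1 prod_J_pure rmorph1.
have E2 b : pb (prod_J JY JG) (tin2 _ _ b) = tin2 strC strB (pb JG b).
  by rewrite /tin2 prod_J_pure rmorph1.
have Eact a : pb (prod_J JY JG) (pb (gact Y') a) = pb (gact Y) (pb JY a).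
  exact: (congr1 (fun m => pb m a) JY_act).
suff I2 b : I (tin2 (str_map Y') (str_map G') b).
  elim/tring_ind: t => [|t u It Iu|a b]; first exact: (subring0 hI).
    exact: (subringD hI).
  by rewrite tpureE; apply: IM.
(* The generation of B' is known inside B, so the induction runs over the
   elements of B. *)
pose E b0 := exists b, pb JG b = b0 /\ I (tin2 (str_map Y') (str_map G') b).
suff [b' [b'b Ib']] : E (pb JG b) by rewrite -(proj1 JG_model _ _ b'b).
have hE : is_subring E.
  have [I0 IB _] := hI; split=> [|_ _ [a [<- Ia]] [a' [<- Ia']]|_ _ [a [<- Ia]] [a' [<- Ia']]].
  - by exists 1; rewrite !rmorph1.
  - by exists (a - a'); rewrite !rmorphB; split=> //; apply: IB.
  - by exists (a * a'); rewrite !rmorphM; split=> //; apply: IM.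
apply: (matrix_order_sub hE) (JG_sub b) => [t'|j k|j k].
- exists (str_map G' t'); rewrite pb_model_str; split=> //.
  by rewrite -tin_comm.
- have [b' b'E] := JG_im (@matrix_order_d R K i G n d s j k); exists b'; split=> //.
  have /fin_all_exists[c' c'E] : forall l, exists a, pb JY a = c l k.
    by move=> l; apply: JY_im; apply: order_at_c.
  have /fin_all_exists[e' e'E] : forall l, exists a, pb JY a = e j l.
    by move=> l; apply: JY_im; apply: order_at_e.
  have -> : tin2 (str_map Y') (str_map G') b'
      = \sum_l tin1 _ _ (e' l) * pb (gact Y') (c' l).
    apply: (proj1 YG); rewrite E2 b'E rmorph_sum.
    have := congr1 (fun m : 'M_n => m j k)
      (congr1 (mulmx (map_mx (tin1 strC strB) e)) rho_c).
    rewrite mulmxA -map_mxM ec map_mx1 mul1mx mxE [RHS]mxE => <-.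
    by apply: eq_bigr => l _; rewrite rmorphM /= E1 Eact e'E c'E !mxE.
  by apply: (subring_sum hI) => l; apply: IM.
- have [b' b'E] := JG_im (@matrix_order_s R K i G n d s j k); exists b'; split=> //.
  have /fin_all_exists[c' c'E] : forall l, exists a, pb JY a = c l k.
    by move=> l; apply: JY_im; apply: order_at_c.
  have /fin_all_exists[e' e'E] : forall l, exists a, pb JY a = e j l.
    by move=> l; apply: JY_im; apply: order_at_e.
  have -> : tin2 (str_map Y') (str_map G') b'
      = \sum_l pb (gact Y') (e' l) * tin1 _ _ (c' l).
    apply: (proj1 YG); rewrite E2 b'E rmorph_sum.
    have := congr1 (fun m : 'M_n => m j k)
      (congr1 (mulmx^~ (map_mx (tin1 strC strB) c)) rho_e).
    rewrite -mulmxA -map_mxM ec map_mx1 mulmx1 mxE [RHS]mxE => <-.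
    by apply: eq_bigr => l _; rewrite rmorphM /= E1 Eact e'E c'E !mxE.
  by apply: (subring_sum hI) => l; apply: IM.
Qed.

(** Every prime of A' contains the nilpotent x, hence comes from R, and is the
    trace of its pullback by the point y' of Y'. *)
Lemma torsor_model : is_torsor Y'.
Proof.
split; last exact/bij_is_iso/inj_surj_bij/canonical_surj/canonical_inj.
split; first exact: (eq_flat_flat flat_model).
have [y' y'proj] := point_model.
move=> Q [[Q0 QD QZ] Q1 QM]; pose N (t : R) := Q (alpha_str p t).
have Qx : Q (alpha_x R p).
  suff Qn m : Q (alpha_x R p ^+ m) -> Q (alpha_x R p).
    by apply: (Qn p); rewrite alpha_x_nil.
  by elim: m => [/Q1[]|m IH]; rewrite exprS => /QM[].
have QE a : Q a <-> N (alpha_ev0 a).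
  have [a' aE] := alpha_decomp a; split=> [Qa|Na]; last first.
    by rewrite aE; apply: QD; [exact: Na|rewrite mulrC; apply: QZ].
  rewrite /N; have -> : alpha_str p (alpha_ev0 a) = a + (- a') * alpha_x R p.
    by rewrite {2}aE mulNr mulrC addrK.
  by apply: QD => //; apply: QZ.
have y'E a : pb y' (pb (gproj Y') a) = alpha_ev0 a by apply: (congr1 (fun m => pb m a) y'proj).
exists (fun a => N (pb y' a)); last by move=> a; rewrite y'E.
split; first split=> [|a b|a b]; rewrite /N ?rmorph0 ?rmorphD ?rmorphM ?rmorph1 //=.
- exact: QD.
- exact: QZ.
- move=> a b; rewrite !rmorphM; exact: QM.
Qed.
End TorsorOrder.

(** * Comparison of the generic fibres *)

Lemma op_inverse (S : comPzRingType) (T W Z T1 W1 Z1 : aff S) (m : mor (prodm T W) Z)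
    (m1 : mor (prodm T1 W1) Z1) (u : mor T T1) (v : mor W W1) (w : mor Z Z1)
    (u' : mor T1 T) (v' : mor W1 W) (w' : mor Z1 Z) :
  compm u u' = idm T1 -> compm v v' = idm W1 -> compm w' w = idm Z ->
  compm w m = compm m1 (pairm (compm u pr1) (compm v pr2)) ->
  compm w' m1 = compm m (pairm (compm u' pr1) (compm v' pr2)).
Proof.
move=> uu' vv' w'w wm.
transitivity (compm w' (compm (compm m1 (pairm (compm u pr1) (compm v pr2)))
   (pairm (compm u' pr1) (compm v' pr2)))).
  congr (compm w' _); rewrite !(compE, pair_compE) !Defs.compA uu' vv' !comp1m.
  have -> : pairm pr1 pr2 = idm (prodm T1 W1).
    by apply: prod_ext; rewrite ?pr1_pair ?pr2_pair compm1.
  by rewrite compm1.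
by rewrite -wm -!Defs.compA Defs.compA w'w comp1m.
Qed.

Section Extension.
Variables (R : idomainType) (K : fieldType) (i : {rmorphism R -> K}).
Hypotheses (hR : valuation_ring R) (i_inj : injective i).
Hypothesis i_frac : forall k, exists2 r, r != 0 & exists r', i r * k = i r'.
Variables (p : nat) (G : grp K) (Y : gspace G (alpha K p)).
Hypotheses (p_gt0 : (0 < p)%N).
Variables (r : R) (r_neq0 : r != 0).
Variables (G' : grp R) (JG : mor (res i G) G') (Y' : gspace G' (alpha R p)) (JY : mor (res i Y) Y').
Hypotheses (JG_model : is_model JG) (JY_model : is_model JY)
  (JG_mul : compm (gmul G') (prod_J JG JG) = compm JG (res_mor i (gmul G)))
  (JY_act : compm (gact Y') (prod_J JY JG) = compm JY (res_mor i (gact Y)))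
  (JY_x : pb JY (pb (gproj Y') (alpha_x R p)) = str_map Y (i r)^-1 * alg_map Y (alpha_x K p)).

Definition rescale : mor (alpha K p) (alpha K p) := scaling p_gt0 (i r).
Local Notation rescale' := (scaling p_gt0 (i r)^-1).

Lemma rescaleK : compm rescale rescale' = idm (alpha K p).
Proof. by apply: scaling_comp; rewrite mulfV // i_neq0. Qed.
Lemma rescaleK' : compm rescale' rescale = idm (alpha K p).
Proof. by apply: scaling_comp; rewrite mulVf // i_neq0. Qed.

Lemma rescale_iso : is_iso rescale.
Proof. by exists rescale'; rewrite rescaleK rescaleK'. Qed.

Local Notation P := (pullback Y rescale).
Local Notation q1 := (fst_fib (gproj Y) rescale).

Lemma pullback_section_comm : compm (gproj Y) (idm Y) = compm rescale (compm rescale' (gproj Y)).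
Proof. by rewrite Defs.compA rescaleK comp1m compm1. Qed.

(** The inverse of the projection of the pullback to Y. *)
Definition pullback_section : mor Y P := pair_fib pullback_section_comm.

Lemma pullback_sectionK : compm pullback_section q1 = idm P.
Proof.
apply: fib_ext; rewrite Defs.compA ?fst_pair ?snd_pair ?comp1m ?compm1 //.
by rewrite -Defs.compA fib_comm Defs.compA rescaleK' comp1m.
Qed.

Lemma bc_pt_lift (T W : aff K) (T' : aff R) (J : mor (res i T) T') (w : mor W T) :
  compm (bc_proj i T') (res_mor i (compm (bc_lift J) w)) = compm J (res_mor i w).
Proof. by rewrite res_comp Defs.compA bc_liftE. Qed.

(** Both generic fibres are compared with G and Y by [model_bc_iso]; the
    pullback by x |-> r x turns the projection with z = x / r into the
    standard one. *)
Lemma extends_model : extends (alpha_bc i p) Y' P.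
Proof.
have [a [ua au]] := model_bc_iso i_inj i_frac JG_model.
have [b [vb bv]] := model_bc_iso i_inj i_frac JY_model.
pose u := bc_lift JG; pose w : mor P (bc i Y') := compm (bc_lift JY) q1.
pose t : mor (bc i Y') P := compm pullback_section b.
have q1s : compm q1 pullback_section = idm Y by exact: fst_pair.
have wt : compm w t = idm (bc i Y').
  by rewrite /w /t -Defs.compA (Defs.compA q1) q1s comp1m.
have tw : compm t w = idm P.
  by rewrite /w /t -Defs.compA (Defs.compA b) bv comp1m pullback_sectionK.
have uM : compm u (gmul G) = compm (bc_op i (gmul G')) (pairm (compm u pr1) (compm u pr2)).
  by apply: bc_ext; rewrite bc_opE !bc_pt_lift -JG_mul.
have wM : compm w (gact P) = compm (bc_op i (gact Y')) (pairm (compm w pr1) (compm u pr2)).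
  apply: bc_ext; rewrite bc_opE /w -!Defs.compA !bc_pt_lift (op_model_pt _ _ JY_act).
  by congr (compm JY (res_mor i _)); exact: fst_pair.
exists a; first split.
- by exists u.
- exact: (op_inverse ua ua au uM).
exists t; split; first by exists w.
- have cw : compm (alpha_bc i p) (gproj P) = compm (gproj (bc_gspace i Y')) w.
    apply: bc_ext; rewrite bc_morE /w bc_pt_lift /alpha_bc bc_pt_lift.
    apply: alpha_mor_ext.
    rewrite -[LHS]/(tin2 (pb (gproj Y)) (pb rescale) (alpha_map i (alpha_x R p))).
    rewrite -[RHS]/(tin1 (pb (gproj Y)) (pb rescale) (pb JY (pb (gproj Y') (alpha_x R p)))) JY_x.
    rewrite -alg_str -rmorphM.
    rewrite -[RHS]/(tin1 (pb (gproj Y)) (pb rescale) (pb (gproj Y) _)) tin_comm.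
    congr (tin2 _ _ _); rewrite -(scaling_x p_gt0).
    have := congr1 (fun m : mor (alpha K p) (alpha K p) => pb m (alpha_x K p)) rescaleK'.
    rewrite -[LHS]/(pb rescale (pb rescale' (alpha_x K p))) => ->.
    by rewrite -[LHS]/(alpha_map i _) alpha_map_in map_polyX.
  by rewrite Defs.compA cw -Defs.compA wt compm1.
- exact: (op_inverse wt ua tw wM).
Qed.
End Extension.

Theorem corollary3p7 (R : idomainType) (p : nat)
    (hR : is_dvr R) (hp : p \in [pchar R])
    (G : grp {fraction R}) (hG : finite_type G)
    (Y : gspace G (alpha {fraction R} p)) (hY : is_torsor Y)
    (y : mor base Y) (hy : compm (gproj Y) y = alpha_unit {fraction R} p) :
  exists2 phi : mor (alpha {fraction R} p) (alpha {fraction R} p), is_iso phi &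
  exists2 G' : grp R, flat (str_map G') &
  exists Y' : gspace G' (alpha R p),
    [/\ is_torsor Y',
        exists y' : mor base Y', compm (gproj Y') y' = alpha_unit R p
      & extends (alpha_bc (tofrac_morphism R) p) Y' (pullback Y phi)].
Proof.
have tdR := dvr_valuation_ring hR; have [pid _] := hR.
have p_gt1 : (1 < p)%N by apply: prime_gt1; move: hp; rewrite inE => /andP[].
have p_gt0 := ltnW p_gt1.
pose i := tofrac_morphism R.
have i_inj : injective i by move=> a b /eqP; rewrite tofrac_eq => /eqP.
have i_frac := @tofrac_frac R.
have [n [d [s [c [e [[dM dU dS [sd ds] dgen] [ce ec qc rho_c]]]]]]] :=
  torsor_matrices p_gt0 hG hY hy.
have [r r0 scale_r] := scale_exists i_inj i_frac pid p_gt1 hY hy e dgen qc.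
have [G' [JG [JG_model JG_mul JG_one JG_sub JG_im]]] :=
  group_model tdR i_inj i_frac dM dU dS sd ds dgen.
have [Y' [JY [JY_model JY_sub JY_im JY_act JY_x]]] :=
  space_model tdR i_inj i_frac p_gt1 hY hy ds dgen ce ec qc rho_c r0
    JG_model JG_mul JG_one JG_im.
exists (rescale i p_gt0 r); first exact: rescale_iso.
exists G'; first exact: (eq_flat_flat (model_eq_flat tdR i_inj JG_model)).
exists Y'; split.
- exact: (torsor_model tdR i_inj i_frac p_gt1 hY hy dU ds ce ec qc rho_c r0 scale_r
    JG_model JG_sub JG_im JY_model JY_sub JY_im JY_act JY_x).
- exact: (point_model i_inj i_frac p_gt1 hy dU ec qc JY_sub JY_x).
- by apply: (extends_model i_inj i_frac p_gt0 r0 JG_model JY_model JG_mul JY_act JY_x).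
Qed.
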